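(* There exist an absolute constant $C^\flat>0$ and constants $c_1,c_2>0$ depending only on $(\tau,\kappa_1,\kappa_2,\kappa_u,l_0)$ such that the following holds. For any $t\ge0$, let the sample size and bandwidth satisfy $$ c_1\,\underline f^{-1}m_3^{1/2}\upsilon_1\sqrt{\frac{p+t}{n}}\ \le\ h\ \le\ c_2\,\underline f\,m_3^{-1/2}. $$ Then there exists an event $\mathcal E(t)$ (depending on the data $\{(y_i,\boldsymbol x_i)\}_{i=1}^n$) with $\mathbb P\{\mathcal E(t)\}\ge1-3e^{-t}$ such that, with $\mathbb P^*$-probability at least $1-2e^{-t}$ conditioned on $\mathcal E(t)$, $$ \|\hat{\boldsymbol\beta}^\flat_h-\boldsymbol\beta^*\|_{\boldsymbol\Sigma}\ \le\ \frac{C^\flat}{\underline f}\left\{\upsilon_1\sqrt{\frac{\log_2(1/h)+p+t}{n}}+l_0\kappa_2h^2\right\}. $$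
   Context: Model: fix $\tau\in(0,1)$ and $p\ge 2$. Let $\boldsymbol x=(x_1,\dots,x_p)^{\top}$ be a random vector with $x_1\equiv1$ and $\mathbb E(x_j)=0$ for $j=2,\dots,p$, and $\boldsymbol\Sigma=\mathbb E(\boldsymbol x\boldsymbol x^{\top})$ positive definite. Let $y=\langle\boldsymbol x,\boldsymbol\beta^*\rangle+\varepsilon$ with $\boldsymbol\beta^*\in\mathbb R^p$ and $\mathbb P(\varepsilon\le0\mid\boldsymbol x)=\tau$; $f_{\varepsilon|\boldsymbol x}$ is the conditional density of $\varepsilon$ given $\boldsymbol x$. $(y_i,\boldsymbol x_i)$, $i=1,\dots,n$, are i.i.d. copies of $(y,\boldsymbol x)$. Bootstrap estimator: $\rho_\tau(u)=u\{\tau-\mathbf 1(u<0)\}$, $K_h(u)=h^{-1}K(u/h)$, $\ell_h(u)=\int_{-\infty}^\infty\rho_\tau(v)K_h(v-u)\,dv$. Let $e_1,\dots,e_n$ be independent Rademacher variables ($\mathbb P(e_i=\pm1)=1/2$), independent of the data, $w_i=1+e_i$ the multipliers, $\hat Q_h^\flat(\boldsymbol\beta)=\frac1n\sum_{i=1}^nw_i\,\ell_h(y_i-\langle\boldsymbol x_i,\boldsymbol\beta\rangle)$, and $\hat{\boldsymbol\beta}_h^\flat\in\arg\min_{\boldsymbol\beta\in\mathbb R^p}\hat Q_h^\flat(\boldsymbol\beta)$. $\mathbb P^*$ is the conditional probability given the data $\{(y_i,\boldsymbol x_i)\}_{i=1}^n$ (i.e. over the $e_i$). Notation: $\|\boldsymbol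 u\|_{\boldsymbol\Sigma}=\|\boldsymbol\Sigma^{1/2}\boldsymbol u\|_2$; $\boldsymbol w=\boldsymbol\Sigma^{-1/2}\boldsymbol x$; $m_3=\sup_{\|\boldsymbol u\|_2=1}\mathbb E|\langle\boldsymbol u,\boldsymbol w\rangle|^3$; $\kappa_k=\int_{-\infty}^\infty|u|^kK(u)\,du$ (assumed finite for the $k$ that appear); $\log_2(x):=\log\log(x\vee e)$. Assumptions: (Kernel) $K$ is symmetric, non-negative, $\int K=1$, and $\kappa_u=\sup_uK(u)<\infty$. (Density) There are constants $\underline f>0$, $l_0>0$ such that $f_{\varepsilon|\boldsymbol x}(0)\ge\underline f$ almost surely and $|f_{\varepsilon|\boldsymbol x}(u)-f_{\varepsilon|\boldsymbol x}(v)|\le l_0|u-v|$ for all $u,v\in\mathbb R$ almost surely. (Sub-Gaussian design) There is $\upsilon_1>0$ such that $\mathbb P(|\langle\boldsymbol u,\boldsymbol w\rangle|\ge\upsilon_1t)\le2e^{-t^2/2}$ for all unit vectors $\boldsymbol u\in\mathbb R^p$ and $t\ge0$. *)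

(* Defs.v *)
From HB Require Import structures.
From mathcomp Require Import all_boot all_order all_algebra.
From mathcomp Require Import all_classical all_reals all_analysis.

Set Implicit Arguments.
Unset Strict Implicit.
Unset Printing Implicit Defensive.

Import Order.TTheory GRing.Theory Num.Theory.
Import numFieldNormedType.Exports.

Local Open Scope classical_set_scope.
Local Open Scope ring_scope.

Section linear_algebra.
Context {R : realType} {p : nat}.
Implicit Types (u v : 'cV[R]_p) (A S : 'M[R]_p).

Definition dotv u v : R := \sum_i u i 0 * v i 0.

(* The library norm on matrices is the sup norm, hence this definition. *)
Definition norm2 u : R := Num.sqrt (dotv u u).

Definition pos_semidefmx A : Prop :=
  A^T = A /\ forall u, 0 <= dotv u (A *m u).

Definition pos_defmx A : Prop :=
  A^T = A /\ forall u, u != 0 -> 0 < dotv u (A *m u).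

(* A^{1/2}: a positive semidefinite matrix A has exactly one positive
   semidefinite square root, so the default value 0 is never used for such A. *)
Definition sqrtmx A : 'M[R]_p :=
  xget 0 [set S | pos_semidefmx S /\ S *m S = A].

Definition normS A u : R := norm2 (sqrtmx A *m u).

(* Random vectors take values in p.-tuple R, which carries the product
   sigma-algebra. *)
Definition vec (x : p.-tuple R) : 'cV[R]_p := \col_i tnth x i.

End linear_algebra.

Section probability.
Context {R : realType} {d : measure_display} {T : measurableType d}.
Variable P : probability T R.

Definition mutually_independent {d'} {T' : measurableType d'} (n : nat)
    (X : 'I_n -> {RV P >-> T'}) : Prop :=
  forall A : 'I_n -> set T', (forall i, measurable (A i)) ->
  P (\bigcap_(i in [set: 'I_n]) (X i @^-1` A i)) =
  (\prod_(i < n) P (X i @^-1` A i))%E.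

Definition independent_classes (G H : set (set T)) : Prop :=
  forall A B, G A -> H B -> P (A `&` B) = (P A * P B)%E.

Definition sigma_RV {d'} {T' : measurableType d'} (n : nat)
    (X : 'I_n -> {RV P >-> T'}) : set (set T) :=
  g_sigma_preimage (fun i => X i : T -> T').

(* g(X) is a version of the conditional probability P(B | X). *)
Definition is_cond_prob {d'} {T' : measurableType d'} (X : {RV P >-> T'})
    (B : set T) (g : T' -> R) : Prop :=
  measurable_fun [set: T'] g /\
  forall A : set T', measurable A ->
  P (X @^-1` A `&` B) = (\int[P]_(w in X @^-1` A) (g (X w))%:E)%E.

(* f x is the Lebesgue density of the conditional law of e given X = x. *)
Definition is_cond_density {d'} {T' : measurableType d'} (X : {RV P >-> T'})
    (e : {RV P >-> R}) (f : T' -> R -> R) : Prop :=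
  [/\ measurable_fun [set: T' * R] (fun z : T' * R => f z.1 z.2),
      forall x u, 0 <= f x u &
      forall (A : set T') (B : set R), measurable A -> measurable B ->
      P (X @^-1` A `&` e @^-1` B) =
      (\int[P]_(w in X @^-1` A)
         \int[@lebesgue_measure R]_(u in B) (f (X w) u)%:E)%E].

Definition rademacher (e : {RV P >-> R}) : Prop :=
  [/\ forall w, e w = 1 \/ e w = -1,
      P [set w | e w = 1] = (2^-1)%:E &
      P [set w | e w = -1] = (2^-1)%:E].

End probability.

Section design.
Context {R : realType} {d : measure_display} {T : measurableType d}.
Variables (P : probability T R) (p : nat) (X : {RV P >-> p.-tuple R}).

Definition second_moment_mx : 'M[R]_p :=
  \matrix_(i, j) fine ('E_P[fun w => (tnth (X w) i * tnth (X w) j)%R])%E.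

Definition whiten (x : p.-tuple R) : 'cV[R]_p :=
  invmx (sqrtmx second_moment_mx) *m vec x.

Definition third_moment : R :=
  fine (ereal_sup [set ('E_P[fun w => (`|dotv u (whiten (X w))| ^+ 3)%R])%E
                  | u in [set u : 'cV[R]_p | norm2 u = 1]]).

Definition design_moments : Prop :=
  [/\ forall w (j : 'I_p), val j = 0%N -> tnth (X w) j = 1,
      forall j : 'I_p, (fun w => tnth (X w) j) \in Lfun P 2%:E,
      forall j : 'I_p, (0 < val j)%N -> ('E_P[fun w => tnth (X w) j] = 0)%E &
      pos_defmx second_moment_mx].

Definition subgaussian_design (ups : R) : Prop :=
  0 < ups /\
  forall (u : 'cV[R]_p) (s : R), norm2 u = 1 -> 0 <= s ->
  (P [set w | (ups * s <= `|dotv u (whiten (X w))|)%R]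
   <= (2 * expR (- (s ^+ 2 / 2)))%:E)%E.

Definition density_condition (f : p.-tuple R -> R -> R) (flow l0 : R) : Prop :=
  [/\ 0 < flow, 0 < l0,
      {ae P, forall w, flow <= f (X w) 0} &
      {ae P, forall w, forall u v, `|f (X w) u - f (X w) v| <= l0 * `|u - v|}].

End design.

Section smoothed_loss.
Context {R : realType}.
Local Notation mu := (@lebesgue_measure R).
Implicit Types (tau h u : R) (K : R -> R).

Definition kernel_moment K (k : nat) : \bar R :=
  (\int[mu]_u (`|u| ^+ k * K u)%R%:E)%E.

(* The last two clauses say that sup_u K u is finite and equal to ku. *)
Definition kernel_condition K (ku : R) : Prop :=
  [/\ measurable_fun [set: R] K,
      (forall u, K (- u) = K u) /\ (forall u, 0 <= K u),
      (\int[mu]_u (K u)%:E = 1)%E &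
      has_ubound (range K) /\ sup (range K) = ku].

Definition check_loss tau u : R := u * (tau - (u < 0)%R%:R).

Definition scaled_kernel K h u : R := h^-1 * K (u / h).

Definition smoothed_loss tau K h u : R :=
  \int[mu]_v (check_loss tau v * scaled_kernel K h (v - u)).

Definition loglog (x : R) : R := ln (ln (Num.max x (expR 1))).

End smoothed_loss.

Section estimator.
Context {R : realType} {p n : nat}.

(* The i-th observation is the pair D i = (y_i, x_i). *)
Definition boot_loss (tau : R) (K : R -> R) (h : R)
    (D : 'I_n -> R * p.-tuple R) (w : 'I_n -> R) (b : 'cV[R]_p) : R :=
  n%:R^-1 * \sum_(i < n)
    w i * smoothed_loss tau K h ((D i).1 - dotv (vec (D i).2) b).

Definition argmin {U : Type} (F : U -> R) : set U :=
  [set b | forall b', F b <= F b'].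

Definition multipliers (s : 'I_n -> R) : 'I_n -> R := fun i => 1 + s i.

(* A map sending the data D and the signs s to a minimizer of the bootstrap
   loss, with an arbitrary choice where the minimizer is not unique. *)
Definition is_boot_estimator (tau : R) (K : R -> R) (h : R)
    (bhat : ('I_n -> R * p.-tuple R) -> ('I_n -> R) -> 'cV[R]_p) : Prop :=
  forall (D : 'I_n -> R * p.-tuple R) (s : 'I_n -> R),
  (forall i, s i = 1 \/ s i = -1) ->
  argmin (boot_loss tau K h D (multipliers s)) (bhat D s).

End estimator.

Section sampling.
Context {R : realType} {d : measure_display} {T : measurableType d}.
Variables (P : probability T R) (p n : nat).

Definition copies_of (X : {RV P >-> p.-tuple R}) (eps : {RV P >-> R})
    (beta : 'cV[R]_p) (Z : 'I_n -> {RV P >-> (R * p.-tuple R)%type}) : Prop :=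
  forall i (A : set (R * p.-tuple R)), measurable A ->
  P (Z i @^-1` A) = P [set w | A (dotv (vec (X w)) beta + eps w, X w)].

(* P^* of a set A of sign vectors. The signs e are independent of the data,
   so once the data are frozen, the conditional probability of the event
   {(data, e) in B} is the probability over e that e lies in the section of B
   at the observed data. *)
Definition Pstar (e : 'I_n -> {RV P >-> R}) (A : set ('I_n -> R)) : \bar R :=
  P [set w | A (fun i => e i w)].

End sampling.

(* Main.v *)
Require Import Defs.
From HB Require Import structures.
From mathcomp Require Import all_boot all_order all_algebra.
From mathcomp Require Import all_classical all_reals all_analysis.
From mathcomp Require Import measurable_realfun.
From mathcomp Require Import complex.
From mathcomp Require Import ring lra.

(** The proof localizes the minimizer of a convex random function. Write
    [z_i = <v, whitened x_i>] and let [w_i = 1 + e_i], which is 0 or 2. By Knight's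
    identity the smoothed loss satisfies
    [l(eps - z) = l(eps) - z * (tau - below eps) + excess eps z]
    ([smoothed_lossB]), where [excess] is nonnegative and convex in [z] and of
    order [z ^ 2]. Hence the increment of the bootstrap loss at [v] is at least
    [- <v, S> + G v], with a random vector [S], the bootstrap score, and a random
    convex function [G], the curvature. If [G v > <v, S>] on the sphere of radius
    [r], then convexity confines every minimizer to the ball of radius [r]
    ([boot_localization]).

    Linear and convex functions are controlled on a whole ball by their values on
    a finite net ([lattice_net], [norm2_le_net], [midconvex_le_net]), so that
    finitely many sums of the form [sum_i w_i * phi (Z_i)] have to be bounded. For
    fixed signs such a sum is a sum of independent variables; averaging its moment
    generating function over the signs as well gives a bound on the mean, over the
    data, of the conditional probability of failure, and Markov's inequality turns
    it into a set of data of large probability on which the conditional probability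
    of failure is small ([boot_union]). A mean failure probability of
    [6 * exp (- 2 t)] gives the two levels [3 * exp (- t)] and [2 * exp (- t)].

    Three moment generating functions are needed. For the score, the kernel is
    symmetric and the density of the error is Lipschitz, so that [below] has
    conditional mean [tau] up to [l0 * k2 * h ^ 2] ([below_mean]), and the Gaussian
    tails of the design do the rest ([score_mgf]). For the curvature, an upper and
    a lower deviation bound are needed ([curv_mgf_up], [curv_mgf_lo]). The
    conditional density of the error has no upper bound in terms of [flow], so
    [excess] is multiplied by a factor in [0, 1] ([thin]) that replaces the density
    by its minimum with [flow]: the conditional mean of the curvature is then
    between constant multiples of [flow * z ^ 2] ([trunc_excess_le],
    [trunc_excess_ge]). The third moment of the design and the bandwidth enter the
    error terms of these bounds, and the two conditions that relate the sample
    size and the bandwidth make these terms small ([regime]). *)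

Set Implicit Arguments.
Unset Strict Implicit.
Unset Printing Implicit Defensive.

Import Order.TTheory GRing.Theory Num.Theory.
Import numFieldNormedType.Exports.

Local Open Scope classical_set_scope.
Local Open Scope ring_scope.

(** * Euclidean geometry *)

Section dot_product.
Context {R : realType} {p : nat}.
Implicit Types (u v w : 'cV[R]_p) (a : R) (A : 'M[R]_p).

Lemma dotvE u v : dotv u v = (u^T *m v) 0 0.
Proof. by rewrite mxE; apply: eq_bigr => i _; rewrite mxE. Qed.

Lemma dotvC u v : dotv u v = dotv v u.
Proof. by apply: eq_bigr => i _; rewrite mulrC. Qed.

Lemma dotvDl u v w : dotv (u + v) w = dotv u w + dotv v w.
Proof. by rewrite !dotvE linearD/= mulmxDl mxE. Qed.

Lemma dotvDr u v w : dotv u (v + w) = dotv u v + dotv u w.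
Proof. by rewrite dotvC dotvDl !(dotvC u). Qed.

Lemma dotvZl a u v : dotv (a *: u) v = a * dotv u v.
Proof. by rewrite !dotvE linearZ/= -scalemxAl mxE. Qed.

Lemma dotvZr a u v : dotv u (a *: v) = a * dotv u v.
Proof. by rewrite dotvC dotvZl dotvC. Qed.

Lemma dotvNl u v : dotv (- u) v = - dotv u v.
Proof. by rewrite -scaleN1r dotvZl mulN1r. Qed.

Lemma dotvBl u v w : dotv (u - v) w = dotv u w - dotv v w.
Proof. by rewrite dotvDl dotvNl. Qed.

Lemma dotvBr u v w : dotv u (v - w) = dotv u v - dotv u w.
Proof. by rewrite dotvC dotvBl !(dotvC u). Qed.

Lemma dotv0l u : dotv 0 u = 0.
Proof. by rewrite -(scale0r u) dotvZl mul0r. Qed.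

Lemma dotv_adj A u v : dotv u (A *m v) = dotv (A^T *m u) v.
Proof. by rewrite !dotvE trmx_mul trmxK mulmxA. Qed.

Lemma dotvv_ge0 u : 0 <= dotv u u.
Proof. by apply: sumr_ge0 => i _; rewrite -expr2 sqr_ge0. Qed.

Lemma dotvv_eq0 u : (dotv u u == 0) = (u == 0).
Proof.
apply/eqP/eqP => [/eqP|->]; last exact: dotv0l.
rewrite psumr_eq0 => [/allP h|i _]; last by rewrite -expr2 sqr_ge0.
apply/matrixP => i j; rewrite (ord1 j) mxE; apply/eqP.
by have := h i; rewrite mem_index_enum => /(_ isT); rewrite -expr2 sqrf_eq0.
Qed.

Lemma norm2_ge0 u : 0 <= norm2 u.
Proof. exact: sqrtr_ge0. Qed.

Lemma norm2_sqr u : norm2 u ^+ 2 = dotv u u.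
Proof. by rewrite sqr_sqrtr// dotvv_ge0. Qed.

Lemma norm2_eq0 u : (norm2 u == 0) = (u == 0).
Proof. by rewrite -dotvv_eq0 -norm2_sqr sqrf_eq0. Qed.

Lemma norm2Z a u : norm2 (a *: u) = `|a| * norm2 u.
Proof. by rewrite /norm2 dotvZl dotvZr mulrA -expr2 sqrtrM ?sqr_ge0// sqrtr_sqr. Qed.

Lemma dotv_le u v : dotv u v <= norm2 u * norm2 v.
Proof.
have [->|u0] := eqVneq u 0; first by rewrite dotv0l mulr_ge0// norm2_ge0.
have nu : 0 < norm2 u by rewrite lt_neqAle norm2_ge0 andbT eq_sym norm2_eq0.
have := dotvv_ge0 (norm2 u ^+ 2 *: v - dotv u v *: u).
rewrite !(dotvBl, dotvBr, dotvZl, dotvZr) (dotvC v u) -!norm2_sqr => h.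
have {h}: dotv u v ^+ 2 <= (norm2 u * norm2 v) ^+ 2.
  rewrite -(ler_pM2l (exprn_gt0 2 nu)) -subr_ge0.
  by apply: le_trans h _; rewrite le_eqVlt; apply/orP; left; apply/eqP; ring.
rewrite -ler_sqrt ?sqr_ge0// !sqrtr_sqr (ger0_norm (mulr_ge0 _ _)) ?norm2_ge0//.
by apply: le_trans; exact: ler_norm.
Qed.

Lemma norm2D u v : norm2 (u + v) <= norm2 u + norm2 v.
Proof.
rewrite -[leLHS]ger0_norm ?norm2_ge0// -[leRHS]ger0_norm ?addr_ge0 ?norm2_ge0//.
rewrite -!sqrtr_sqr ler_sqrt ?sqr_ge0// norm2_sqr.
rewrite dotvDl !dotvDr (dotvC v u) -!norm2_sqr.
have := dotv_le u v; nra.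
Qed.

Lemma norm2N u : norm2 (- u) = norm2 u.
Proof. by rewrite -scaleN1r norm2Z normrN1 mul1r. Qed.

End dot_product.

Section square_root.
Context {R : realType}.

Lemma poly_interp n (lam : 'I_n -> R) (g : R -> R) :
  exists q : {poly R}, forall i, q.[lam i] = g (lam i).
Proof.
pose s := undup [seq lam i | i <- enum 'I_n].
suff [q hq] : exists q : {poly R}, forall x, x \in s -> q.[x] = g x.
  by exists q => i; apply: hq; rewrite mem_undup map_f ?mem_enum.
have : uniq s by exact: undup_uniq.
elim: s => [_|x s IH /= /andP[xs /IH[q hq]]]; first by exists 0.
pose w := \prod_(y <- s) ('X - y%:P).
have w0 : w.[x] != 0 by rewrite -rootE root_prod_XsubC.
exists (q + ((g x - q.[x]) / w.[x]) *: w) => y; rewrite inE => /orP[/eqP->|ys].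
  by rewrite !hornerE divfK// addrC subrK.
have /eqP wy : w.[y] == 0 by rewrite -rootE root_prod_XsubC.
by rewrite !hornerE wy mulr0 addr0 hq.
Qed.

Lemma real_mx_lift m n (M : 'M[complex R]_(m, n)) : M \is a mxOver Num.real ->
  exists N : 'M[R]_(m, n), M = map_mx (real_complex R) N.
Proof.
move=> /mxOverP hM; exists (map_mx (fun z => complex.Re z) M).
by apply/matrixP => i j; rewrite !mxE; have /complex_realP[k ->] := hM i j.
Qed.

(** Over the complex extension of [R] a symmetric matrix is hermitian, hence
    diagonalizable with real spectrum, and two real matrices that are similar
    over the extension are similar over [R]. *)
Lemma sym_diagonalizable n (A : 'M[R]_n) : A^T = A ->
  exists (Q : 'M[R]_n) (l : 'rV[R]_n), Q \in unitmx /\ Q *m A = diag_mx l *m Q.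
Proof.
move=> symA; pose c := real_complex R; pose AC := map_mx c A.
have ACreal : AC \is a mxOver Num.real.
  by apply/mxOverP => i j; rewrite mxE; apply/complex_realP; exists (A i j).
have ACsym : AC \is symmetricmx.
  apply/is_hermitianmxP; rewrite expr0 scale1r map_mx_id//.
  by apply/matrixP => i j; rewrite !mxE -{1}symA mxE.
have ACherm := realsym_hermsym ACsym ACreal.
have ACeq := hermitian_normalmx ACherm.
move/orthomx_spectralP : ACeq => ACeq.
have Dreal := hermitian_spectral_diag_real ACherm.
set P := spectralmx AC in ACeq; set D := spectral_diag AC in ACeq Dreal.
have Pu : P \in unitmx by exact: spectral_unit.
have DDreal : diag_mx D \is a mxOver Num.real.
  apply/mxOverP => i j; rewrite mxE; case: eqP => [->|_]; last by rewrite mulr0n.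
  by rewrite mulr1n; apply: (mxOverP Dreal).
have : similar_in unitmx AC (diag_mx D).
  exists P => //; apply/similarP => //.
  by rewrite [in LHS]ACeq -mulmxA mulKVmx.
move=> /real_similar /(_ ACreal DDreal) [Q0].
rewrite inE => /andP[Q0real Q0u] /(similarP Q0u) hQ.
have [Q QE] := real_mx_lift Q0real; have [l lE] := real_mx_lift Dreal.
exists Q, l; split; first by rewrite -(map_unitmx c) -QE.
have := hQ; rewrite QE lE -map_diag_mx -!map_mxM => /map_mx_inj h; apply: h.
Qed.

(** In a basis of eigenvectors the square root acts on the eigenvalues, and there
    it agrees with a polynomial; a polynomial in a symmetric matrix is again
    symmetric. *)
Lemma sqrtmx_exists n (A : 'M[R]_n) : pos_defmx A ->
  exists S : 'M[R]_n, pos_semidefmx S /\ S *m S = A.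
Proof.
case: n A => [|n] A [symA posA].
  exists 0; split; last by apply/matrixP => -[].
  split; first by rewrite trmx0.
  by move=> u; rewrite mul0mx /dotv big_ord0.
have [Q [l [Qu QA]]] := sym_diagonalizable symA.
have AE : A = invmx Q *m diag_mx l *m Q by rewrite -mulmxA -QA mulKmx.
have l_ge0 i : 0 <= l 0 i.
  pose u := (row i Q)^T.
  have u0 : u != 0.
    apply/negP => /eqP /(congr1 (fun w => w^T *m invmx Q)).
    rewrite /u trmxK trmx0 mul0mx -row_mul mulmxV// => /matrixP/(_ 0 i)/eqP.
    by rewrite !mxE eqxx oner_eq0.
  have := posA _ u0; have -> : A *m u = l 0 i *: u.
    rewrite /u -[A]symA -trmx_mul -row_mul QA row_mul row_diag_mx.
    by rewrite -scalemxAl -rowE linearZ.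
  have uu : 0 < dotv u u by rewrite lt0r dotvv_eq0 u0 dotvv_ge0.
  by rewrite dotvZr => h; rewrite -(ler_pM2r uu) mul0r ltW.
(* S is the square of a symmetric fourth root of A; as a square of a symmetric
   matrix it is positive semidefinite *)
have [q hq] := poly_interp (l 0) (fun x => Num.sqrt (Num.sqrt x)).
pose B := horner_mx A q.
have symB : B^T = B.
  rewrite /B; elim/poly_ind : (q) => [|q' c IH]; first by rewrite !rmorph0 trmx0.
  rewrite !(rmorphD, rmorphM)/= !(horner_mx_X, horner_mx_C) linearD/= trmx_mul.
  rewrite IH symA tr_scalar_mx; congr (_ + _).
  exact: (comm_mx_horner q' (erefl (A *m A))).
exists (B *m B); split.
  split; first by rewrite trmx_mul symB.
  by move=> u; rewrite -mulmxA dotv_adj symB dotvv_ge0.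
have BE : B = invmx Q *m diag_mx (map_mx (fun x => Num.sqrt (Num.sqrt x)) l) *m Q.
  rewrite /B AE horner_mx_uconjC// horner_mx_diag.
  by congr (_ *m diag_mx _ *m _); apply/matrixP => i j; rewrite !mxE (ord1 i) hq.
have BB : B *m B = invmx Q *m diag_mx (map_mx Num.sqrt l) *m Q.
  rewrite BE !mulmxA mulmxK// -!mulmxA; congr (_ *m _); rewrite !mulmxA.
  congr (_ *m _); rewrite mulmx_diag; congr diag_mx; apply/matrixP => i j.
  by rewrite !mxE -expr2 (ord1 i) sqr_sqrtr ?sqrtr_ge0.
rewrite BB !mulmxA mulmxK// AE -!mulmxA; congr (_ *m _); rewrite !mulmxA.
congr (_ *m _); rewrite mulmx_diag; congr diag_mx; apply/matrixP => i j.
by rewrite !mxE -expr2 (ord1 i) sqr_sqrtr// l_ge0.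
Qed.

Lemma sqrtmxP n (A : 'M[R]_n) : pos_defmx A ->
  [/\ (sqrtmx A)^T = sqrtmx A, sqrtmx A *m sqrtmx A = A & sqrtmx A \in unitmx].
Proof.
move=> Apos; have [S0 hS0] := sqrtmx_exists Apos.
have [[symS _] SS] : [set S | pos_semidefmx S /\ S *m S = A] (sqrtmx A).
  by apply: xgetPex; exists S0.
split=> //; apply/negPn/negP => Snu.
have := Snu; rewrite -row_free_unit -kermx_eq0 => /negPf/negbT/rowV0Pn[v /sub_kermxP vS v0].
have /Apos.2 : v^T != 0 by rewrite trmx_eq0.
have -> : A *m v^T = 0.
  by rewrite -SS -mulmxA -{2}symS -trmx_mul vS trmx0 mulmx0.
by rewrite dotvC dotv0l ltxx.
Qed.

End square_root.

Section lattice_net.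
Context {R : realType}.

Lemma norm2_le_coord p (u v : 'cV[R]_p) :
  (forall i, `|u i 0| <= `|v i 0|) -> norm2 u <= norm2 v.
Proof.
move=> h; rewrite /norm2 ler_sqrt ?dotvv_ge0//; apply: ler_sum => i _.
by rewrite -!expr2 -(real_normK (num_real (u i 0)))
  -(real_normK (num_real (v i 0))) lerXn2r ?nnegrE.
Qed.

Lemma sum_abs_le_norm2 p (v : 'cV[R]_p) :
  \sum_i `|v i 0| <= Num.sqrt p%:R * norm2 v.
Proof.
have := dotv_le (const_mx 1) (\col_i `|v i 0|).
have -> : norm2 (\col_i `|v i 0|) = norm2 v.
  by apply/eqP; rewrite eq_le !norm2_le_coord// => i; rewrite mxE normr_id.
have -> : norm2 (const_mx 1 : 'cV[R]_p) = Num.sqrt p%:R.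
  rewrite /norm2 /dotv; under eq_bigr do rewrite mxE mulr1.
  by rewrite sumr_const card_ord.
by rewrite /dotv; under eq_bigr do rewrite !mxE mul1r.
Qed.

Lemma sum_halfpow_le N : \sum_(a < N) (2^-1 : R) ^+ a <= 2.
Proof.
suff -> : \sum_(a < N) (2^-1 : R) ^+ a = 2 - 2 * 2^-1 ^+ N.
  by rewrite gerBl mulr_ge0// exprn_ge0.
by elim: N => [|N IH]; [rewrite big_ord0; ring|rewrite big_ord_recr/= IH exprS; field].
Qed.

(** A finite [1/m]-net of the unit ball whose size is exponential in the
    dimension. It consists of points of the lattice of mesh [1 / (m * sqrt p)];
    rounding every coordinate towards zero does not increase the norm. A lattice
    point of the ball has integer coordinates of total size at most [m * p], and
    weighting each point by two to the power minus this total size bounds their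
    number by a product over the coordinates. *)
Lemma lattice_net (p m : nat) : (0 < p)%N -> (0 < m)%N ->
  exists (I : finType) (u : I -> 'cV[R]_p),
  [/\ (#|I|%:R <= (2 ^ ((m + 2) * p))%:R :> R),
      forall k, norm2 (u k) <= 1 &
      forall v, norm2 v <= 1 ->
        exists2 k, norm2 (v - u k) <= m%:R^-1 & norm2 (u k) <= norm2 v].
Proof.
move=> p0 m0; pose N := (m * p).+1.
have sp0 : 0 < Num.sqrt (p%:R : R) by rewrite sqrtr_gt0 ltr0n.
have m0R : 0 < m%:R :> R by rewrite ltr0n.
pose c : R := (m%:R * Num.sqrt p%:R)^-1.
have c0 : 0 < c by rewrite invr_gt0 mulr_gt0.
pose J := {ffun 'I_p -> 'I_N * bool}.
pose u0 (k : J) : 'cV[R]_p := \col_j (c * ((-1) ^+ (k j).2 * (k j).1%:R)).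
pose ok (k : J) := (\sum_j (k j).1 <= m * p)%N && (norm2 (u0 k) <= 1).
exists {k : J | ok k}, (fun k => u0 (val k)); split.
- rewrite card_sig -sum1_card natr_sum.
  have -> : (2 ^ ((m + 2) * p))%:R = 2 ^+ (m * p) * (4 : R) ^+ p.
    rewrite natrX mulnDl exprD; congr (_ * _).
    by rewrite exprM; congr (_ ^+ _); rewrite -natrX.
  apply: (@le_trans _ _ (\sum_(k : J) 2 ^+ (m * p) * \prod_j (2^-1 : R) ^+ (k j).1)).
    rewrite [leRHS](bigID ok)/= -[leLHS]addr0 lerD//; last first.
      by apply: sumr_ge0 => k _; rewrite mulr_ge0 ?exprn_ge0// prodr_ge0// => j _;
        rewrite exprn_ge0.
    apply: ler_sum => k /andP[wk _]; rewrite prodrXr.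
    by rewrite exprVn ler_pdivlMr ?exprn_gt0// mul1r ler_eXn2l// ltr1n.
  rewrite -mulr_sumr ler_pM2l ?exprn_gt0//.
  rewrite -(bigA_distr_bigA (fun _ (x : 'I_N * bool) => (2^-1 : R) ^+ x.1)).
  rewrite prodr_const card_ord lerXn2r ?nnegrE//.
    by apply: sumr_ge0 => x _; rewrite exprn_ge0.
  rewrite -(pair_bigA _ (fun (a : 'I_N) (b : bool) => (2^-1 : R) ^+ a))/=.
  under eq_bigr do rewrite sumr_const card_bool.
  by rewrite sumrMnl; have := sum_halfpow_le N; lra.
- by move=> k; case/andP : (valP k).
- move=> v v1.
  pose a j := Num.truncn (`|v j 0| / c).
  have a_itv j : (a j)%:R * c <= `|v j 0| < (a j).+1%:R * c.
    rewrite -ler_pdivlMr// -ltr_pdivrMr//; apply: truncn_itv.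
    by rewrite divr_ge0// ltW.
  have suma : (\sum_j a j <= m * p)%N.
    rewrite -(ler_nat R) natr_sum -(ler_pM2r c0) mulr_suml.
    apply: (@le_trans _ _ (\sum_j `|v j 0|)).
      by apply: ler_sum => j _; case/andP : (a_itv j).
    apply: le_trans (sum_abs_le_norm2 v) _.
    have -> : (m * p)%:R * c = Num.sqrt p%:R.
      rewrite /c natrM -[in X in X * _](sqr_sqrtr (ler0n R p)).
      by field; rewrite gt_eqF//= gt_eqF.
    by rewrite ler_piMr// ltW.
  have aN j : (a j < N)%N.
    by rewrite ltnS (leq_trans _ suma)// (bigD1 j)//= leq_addr.
  pose k : J := [ffun j => (Ordinal (aN j), v j 0 < 0)].
  have u0E j : u0 k j 0 = (-1) ^+ (v j 0 < 0)%R * (c * (a j)%:R).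
    by rewrite mxE ffunE/= mulrCA.
  have vE j : v j 0 = (-1) ^+ (v j 0 < 0)%R * `|v j 0|.
    by rewrite -realEsign ?num_real.
  have u0v j : `|u0 k j 0| <= `|v j 0|.
    rewrite u0E normrM normr_sign mul1r ger0_norm; last by rewrite mulr_ge0// ltW.
    by rewrite mulrC; case/andP : (a_itv j).
  have kv : norm2 (u0 k) <= norm2 v by exact: norm2_le_coord.
  have okk : ok k.
    rewrite /ok (le_trans kv v1) andbT.
    by under eq_bigr do rewrite ffunE.
  exists (Sub k okk); rewrite SubK//.
  apply: (@le_trans _ _ (norm2 (const_mx c : 'cV[R]_p))).
    apply: norm2_le_coord => j; rewrite mxE [(- u0 k) j 0]mxE u0E {1}vE -mulrBr.
    rewrite normrM normr_sign mul1r mxE (gtr0_norm c0).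
    rewrite ger0_norm; last by rewrite subr_ge0 mulrC; case/andP : (a_itv j).
    case/andP : (a_itv j) => _; rewrite -natr1 => /ltW; lra.
  rewrite -[const_mx c](_ : c *: const_mx 1 = _); last first.
    by apply/matrixP => i j; rewrite !mxE mulr1.
  rewrite norm2Z /norm2 /dotv; under eq_bigr do rewrite mxE mulr1.
  rewrite sumr_const card_ord gtr0_norm// /c.
  by rewrite invfM mulfVK// gt_eqF.
Qed.

End lattice_net.

(** * Image measures, densities and affine changes of variables *)

Section image_and_density.
Local Open Scope ereal_scope.
Context {d d' : measure_display} {T1 : measurableType d} {T2 : measurableType d'}.
Context {R : realType}.

Definition image_measure (m : {measure set T1 -> \bar R}) (f : T1 -> T2)
  (mf : measurable_fun [set: T1] f) : {measure set T2 -> \bar R}.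
Proof. refine (pushforward m f : {measure set T2 -> \bar R}); exact: mf. Defined.

Arguments image_measure : simpl never.

Lemma image_measureE m f (mf : measurable_fun [set: T1] f) A :
  image_measure m mf A = m (f @^-1` A).
Proof. by []. Qed.

Lemma ge0_integral_image m f (mf : measurable_fun [set: T1] f) (g : T2 -> \bar R) :
  measurable_fun [set: T2] g -> (forall y, 0 <= g y) ->
  \int[image_measure m mf]_y g y = \int[m]_x g (f x).
Proof. by move=> mg g0; rewrite ge0_integral_pushforward// => y _; exact: g0. Qed.

End image_and_density.

Section density_measure.
Local Open Scope ereal_scope.
Context {d : measure_display} {T : measurableType d} {R : realType}.
Variables (m : {measure set T -> \bar R}) (g : T -> R).
Hypotheses (mg : measurable_fun [set: T] g) (g0 : forall x, (0 <= g x)%R).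

Let dens (A : set T) := \int[m]_(x in A) (g x)%:E.

Let dens0 : dens set0 = 0. Proof. exact: integral_set0. Qed.

Let dens_ge0 A : 0 <= dens A.
Proof. by apply: integral_ge0 => x _; rewrite lee_fin. Qed.

Let dens_additive : semi_sigma_additive dens.
Proof.
move=> F mF tF mUF; rewrite /dens ge0_integral_bigcup//.
- by apply: is_cvg_ereal_nneg_natsum => n _; exact: dens_ge0.
- by apply/measurable_EFinP; exact: measurable_funTS.
- by move=> x _; rewrite lee_fin.
Qed.

Definition density_measure : {measure set T -> \bar R}.
Proof.
pose M := isMeasure.Build _ _ _ dens dens0 dens_ge0 dens_additive.
exact: (HB.pack dens M).
Defined.

Import HBNNSimple.

Lemma ge0_integral_density (f : T -> \bar R) :
  measurable_fun [set: T] f -> (forall x, 0 <= f x) ->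
  \int[density_measure]_x f x = \int[m]_x (f x * (g x)%:E).
Proof.
move=> mf f0.
pose f_ := nnsfun_approx measurableT mf.
have f_cvg x : (f_ n x)%:E @[n --> \oo] --> f x.
  by apply: cvg_nnsfun_approx => // y _; exact: f0.
have f_nd x : {homo (fun n => (f_ n x)%:E) : n k / (n <= k)%N >-> n <= k}.
  by move=> n k nk; rewrite lee_fin; exact/lefP/nd_nnsfun_approx.
transitivity (limn (fun n => \int[density_measure]_x (f_ n x)%:E)).
  rewrite -monotone_convergence//.
  - by apply: eq_integral => y _; apply/esym/cvg_lim.
  - by move=> n; exact/measurable_EFinP/measurable_funP.
  - by move=> n y _; rewrite lee_fin.
transitivity (limn (fun n => \int[m]_x ((f_ n x)%:E * (g x)%:E))); last first.
  rewrite -monotone_convergence//.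
  - apply: eq_integral => y _; apply/cvg_lim => //.
    by apply: cvgeZr => //; exact: f_cvg.
  - move=> n; apply: emeasurable_funM; last exact/measurable_EFinP.
    exact/measurable_EFinP/measurable_funP.
  - by move=> n y _; rewrite mule_ge0// lee_fin.
  - by move=> y _ n k nk; apply: lee_wpmul2r; [rewrite lee_fin|exact: f_nd].
apply: congr_lim; apply/funext => n.
transitivity (\sum_(r \in range (f_ n))
    \int[m]_x ((r * \1_(f_ n @^-1` [set r]) x)%:E * (g x)%:E)).
  under eq_integral do rewrite fimfunE -fsumEFin//.
  rewrite ge0_integral_fsum//; last 2 first.
  - by move=> y; exact/measurable_EFinP/measurable_funM.
  - by move=> y x _; rewrite nnfun_muleindic_ge0.
  apply: eq_fsbigr => r _; rewrite integralZl_indic_nnsfun// integral_indic//.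
  rewrite setIT.
  transitivity (r%:E * \int[m]_(x in f_ n @^-1` [set r]) (g x)%:E); first by [].
  rewrite integral_mkcond.
  have [r0|r0] := leP 0%R r; last first.
    rewrite preimage_nnfun0// -integral_mkcond integral_set0 mule0.
    under eq_integral do rewrite indicE in_set0 mulr0 mul0e.
    by rewrite integral0.
  rewrite -ge0_integralZl//.
  - apply: eq_integral => x _; rewrite /patch/= indicE.
    by case: ifPn => _; rewrite ?mulr1 ?mulr0 ?mul0e ?mule0.
  - apply/(measurable_restrictT (fun x => (g x)%:E)) => //.
    by apply/measurable_EFinP; exact: measurable_funTS.
  - by move=> x _; rewrite /patch; case: ifP => _ //; rewrite lee_fin.
rewrite -ge0_integral_fsum//.
- apply: eq_integral => x _; rewrite [in RHS]fimfunE -fsumEFin//.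
  by rewrite ge0_mule_fsuml// => r; rewrite nnfun_muleindic_ge0.
- move=> r; apply: emeasurable_funM; last exact/measurable_EFinP.
  exact/measurable_EFinP/measurable_funM.
- by move=> r x _; rewrite mule_ge0 ?nnfun_muleindic_ge0// lee_fin.
Qed.

End density_measure.

Section affine.
Context {R : realType}.
Local Notation mu := (@lebesgue_measure R).
Local Open Scope ereal_scope.

Lemma lebesgue_measure_itvcc (a b : R) : (a <= b)%R ->
  mu `[a, b]%classic = (b - a)%:E.
Proof.
rewrite lebesgue_measure_itv/= lte_fin le_eqVlt => /orP[/eqP->|->//].
by rewrite ltxx subrr.
Qed.

(** Lebesgue measure is the only measure that gives intervals their length, and
    [h] times the image of Lebesgue measure under the affine map does. *)
Lemma ge0_integral_affine (h b : R) (f : R -> \bar R) : (0 < h)%R ->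
  measurable_fun [set: R] f -> (forall x, 0 <= f x) ->
  \int[mu]_x f x = h%:E * \int[mu]_x f (h * x + b)%R.
Proof.
move=> h0 mf f0.
pose phi := (fun x : R => h * x + b)%R : measurableTypeR R -> measurableTypeR R.
have mphi : measurable_fun setT phi.
  by apply: measurable_funD => //; exact: measurable_funM.
have h0' : (0 <= h)%R by exact: ltW.
transitivity (\int[mscale (NngNum h0') (image_measure mu mphi)]_x f x).
  apply: eq_measure_integral => A mA _.
  apply: lebesgue_measure_unique => //= _ [[x y]] _ <-.
  transitivity (h%:E * mu (phi @^-1` `]x, y]%classic)); last by [].
  have -> : phi @^-1` `]x, y]%classic = `]((x - b) / h)%R, ((y - b) / h)%R]%classic.
    apply/seteqP; split => z /=; rewrite !in_itv/= ltr_pdivrMr// ler_pdivlMr//;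
    by rewrite ltrBlDr lerBrDr mulrC.
  rewrite lebesgue_measure_itv/= lebesgue_measure_itv/= !lte_fin.
  rewrite ltr_pM2r ?invr_gt0// ltrD2r; case: ifPn => _; last by rewrite mule0.
  by rewrite -EFinB -EFinM; congr EFin; field; rewrite gt_eqF.
transitivity (h%:E * \int[image_measure mu mphi]_x f x).
  exact: (ge0_integral_mscale (image_measure mu mphi) measurableT (NngNum h0') mf).
by congr (_ * _); exact: (ge0_integral_image _ mphi mf).
Qed.

Lemma ge0_integralN (f : R -> \bar R) :
  measurable_fun [set: R] f -> (forall x, 0 <= f x) ->
  \int[mu]_x f x = \int[mu]_x f (- x)%R.
Proof.
move=> mf f0.
pose phi := (fun x : R => - x)%R : measurableTypeR R -> measurableTypeR R.
have mphi : measurable_fun setT phi by exact: measurable_funN.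
transitivity (\int[image_measure mu mphi]_x f x).
  apply: eq_measure_integral => A mA _.
  by apply/esym; exact: lebesgue_measureN.
exact: (ge0_integral_image _ mphi mf).
Qed.

End affine.

(** * The smoothed check loss *)

Section knight.
Context {R : realType}.
Implicit Types a s t tau : R.

(** The remainder of Knight's identity for the check loss. *)
Definition knight a s : R :=
  if 0 <= a then Num.max (s - a) 0 else Num.max (a - s) 0.

Lemma check_lossB tau a s :
  check_loss tau (a - s) = check_loss tau a - s * (tau - (a < 0)%R%:R) + knight a s.
Proof.
rewrite /check_loss /knight; case: (leP 0 a) => a0; case: (ltP (a - s) 0) => h;
  rewrite /= ?mulr0n ?mulr1n; [rewrite max_l|rewrite max_r| |];
  try lra; ring.
Qed.

Lemma knight_ge0 a s : 0 <= knight a s.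
Proof. by rewrite /knight; case: ifP => _; rewrite le_max lexx orbT. Qed.

Lemma knight_le a s : knight a s <= `|s|.
Proof.
have hs2 := ler_norm s.
have hs3 : - s <= `|s| by rewrite -normrN ler_norm.
have hs4 : 0 <= `|s| by [].
by rewrite /knight; case: (leP 0 a) => a0; rewrite ge_max hs4 andbT; lra.
Qed.

Lemma knight_supp a s : `|s| < `|a| -> knight a s = 0.
Proof.
have hs3 : - s <= `|s| by rewrite -normrN ler_norm.
have hs2 := ler_norm s.
rewrite /knight; case: (leP 0 a) => a0.
  by rewrite (ger0_norm a0) => h; apply/max_idPr; lra.
by rewrite (ltr0_norm a0) => h; apply/max_idPr; lra.
Qed.

(** The interval of length [|s| / 4] in this hypothesis lies between 0 and [s], at
    distance at least [|s| / 2] from [s]. *)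
Lemma knight_ge a s : `|a - 3 / 8 * s| <= `|s| / 8 -> `|s| / 2 <= knight a s.
Proof.
rewrite /knight => h; have [s0|s0] := leP 0 s.
  move: h; rewrite (ger0_norm s0) ler_norml => /andP[h1 h2].
  have -> : 0 <= a by lra.
  by rewrite le_max; apply/orP; left; lra.
move: h; rewrite (ltr0_norm s0) ler_norml => /andP[h1 h2].
have -> : (0 <= a) = false by apply/negbTE; rewrite -ltNge; lra.
by rewrite le_max; apply/orP; left; lra.
Qed.

Lemma knight_convex a t s s' : 0 <= t <= 1 ->
  knight a (t * s + (1 - t) * s') <= t * knight a s + (1 - t) * knight a s'.
Proof.
move=> /andP[t0 t1]; rewrite /knight; case: ifP => _.
  have h1 : s - a <= Num.max (s - a) 0 by rewrite le_max lexx.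
  have h2 : s' - a <= Num.max (s' - a) 0 by rewrite le_max lexx.
  have h3 : 0 <= Num.max (s - a) 0 by rewrite le_max lexx orbT.
  have h4 : 0 <= Num.max (s' - a) 0 by rewrite le_max lexx orbT.
  rewrite ge_max; apply/andP; split; nra.
have h1 : a - s <= Num.max (a - s) 0 by rewrite le_max lexx.
have h2 : a - s' <= Num.max (a - s') 0 by rewrite le_max lexx.
have h3 : 0 <= Num.max (a - s) 0 by rewrite le_max lexx orbT.
have h4 : 0 <= Num.max (a - s') 0 by rewrite le_max lexx orbT.
rewrite ge_max; apply/andP; split; nra.
Qed.

Lemma measurable_knight d (T : measurableType d) (f g : T -> R) :
  measurable_fun [set: T] f -> measurable_fun [set: T] g ->
  measurable_fun [set: T] (fun x => knight (f x) (g x)).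
Proof.
move=> mf mg; apply: measurable_fun_ifT.
- exact: measurable_fun_ler.
- by apply: measurable_maxr => //; exact: measurable_funB.
- by apply: measurable_maxr => //; exact: measurable_funB.
Qed.

Lemma measurable_below0 d (T : measurableType d) (f : T -> R) :
  measurable_fun [set: T] f ->
  measurable_fun [set: T] (fun x => (f x < 0)%R%:R : R).
Proof.
move=> mf; rewrite (_ : (fun _ => _) = (fun x => if f x < 0 then 1 else 0)).
  by apply: measurable_fun_ifT => //; exact: measurable_fun_ltr.
by apply/funext => x; case: ifP.
Qed.

End knight.

Section smoothing.
Context {R : realType}.
Local Notation mu := (@lebesgue_measure R).
Variables (K : R -> R) (ku k1 : R).
Hypothesis KC : kernel_condition K ku.
Hypothesis K1 : kernel_moment K 1 = k1%:E.

Lemma kernel_measurable : measurable_fun [set: R] K.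
Proof. by case: KC. Qed.

Lemma kernel_ge0 x : 0 <= K x.
Proof. by case: KC => _ [_ +] _ _; exact. Qed.

Lemma kernel_even x : K (- x) = K x.
Proof. by case: KC => _ [+ _] _ _; exact. Qed.

Lemma kernel_le x : K x <= ku.
Proof. by case: KC => _ _ _ [ub <-]; apply: ub_le_sup => //; exists x. Qed.

Lemma kernel_mass : (\int[mu]_x (K x)%:E = 1)%E.
Proof. by case: KC. Qed.

(** The first moment of the kernel is finite, so functions of linear growth are
    integrable against it. *)
Lemma kernel_integrable (F : R -> R) (A B : R) :
  measurable_fun [set: R] F -> (forall x, `|F x| <= A + B * `|x|) ->
  mu.-integrable [set: R] (EFin \o (fun x => F x * K x)).
Proof.
move=> mF hF; have mK := kernel_measurable.
have mFK := measurable_funM mF mK.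
have mXK : measurable_fun [set: R] (fun x => `|x| ^+ 1 * K x).
  have mX : measurable_fun [set: R] (fun x : R => `|x| ^+ 1) by exact: measurable_funX.
  exact: (measurable_funM mX mK).
have mFE : measurable_fun [set: R] (EFin \o (fun x => F x * K x)) by exact/measurable_EFinP.
apply/integrableP; split => //.
pose G x : \bar R := (`|A|%:E * (K x)%:E + `|B|%:E * (`|x| ^+ 1 * K x)%:E)%E.
apply: (@le_lt_trans _ _ (\int[mu]_x G x)%E).
  apply: ge0_le_integral => //=.
  - exact: (measurableT_comp (@abse_measurable _ _) mFE).
  - by apply: emeasurable_funD; apply: emeasurable_funM => //; exact/measurable_EFinP.
  - move=> x _; rewrite lee_fin normrM (ger0_norm (kernel_ge0 x)) expr1 mulrA -mulrDl.
    rewrite ler_wpM2r ?kernel_ge0// (le_trans (hF x))// lerD ?ler_norm//.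
    by rewrite ler_wpM2r// ler_norm.
rewrite ge0_integralD//; first last.
- by apply: emeasurable_funM => //; exact/measurable_EFinP.
- by move=> x _; rewrite mule_ge0// lee_fin mulr_ge0// kernel_ge0.
- by apply: emeasurable_funM => //; exact/measurable_EFinP.
- by move=> x _; rewrite mule_ge0// lee_fin kernel_ge0.
rewrite !ge0_integralZl//; first last.
- by move=> x _; rewrite lee_fin ?mulr_ge0// kernel_ge0.
- exact/measurable_EFinP.
- by move=> x _; rewrite lee_fin ?mulr_ge0// kernel_ge0.
- exact/measurable_EFinP.
by have := K1; rewrite /kernel_moment kernel_mass => ->; rewrite -!EFinM -EFinD ltry.
Qed.

(** The probability that [u + h V] is negative, for [V] of density [K]. *)
Definition below (h u : R) : R := \int[mu]_x ((u + h * x < 0)%R%:R * K x).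

(** The mean of [knight (u + h V) s], for [V] of density [K]. *)
Definition excess (h u s : R) : R := \int[mu]_x (knight (u + h * x) s * K x).

Lemma measurable_shift (h u : R) : measurable_fun [set: R] (fun x : R => u + h * x).
Proof. by apply: measurable_funD => //; exact: measurable_funM. Qed.

Lemma measurable_check_loss (tau : R) : measurable_fun [set: R] (check_loss tau).
Proof.
by apply: measurable_funM => //; apply: measurable_funB => //; exact: measurable_below0.
Qed.

Lemma check_loss_ge0 (tau a : R) : 0 < tau < 1 -> 0 <= check_loss tau a.
Proof.
move=> /andP[t0 t1]; rewrite /check_loss; case: (ltP a 0) => a0; rewrite ?mulr1n ?mulr0n.
  by rewrite mulr_le0//; lra.
by rewrite subr0 mulr_ge0// ltW.
Qed.

Lemma check_loss_le (tau a : R) : 0 < tau < 1 -> `|check_loss tau a| <= `|a|.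
Proof.
move=> /andP[t0 t1]; rewrite /check_loss normrM ler_piMr// ler_norml.
by case: (ltP a 0) => a0; rewrite ?mulr1n ?mulr0n; lra.
Qed.

Lemma affine_norm_le (h u x : R) : 0 < h -> `|u + h * x| <= `|u| + h * `|x|.
Proof. by move=> h0; rewrite (le_trans (ler_normD _ _))// normrM (gtr0_norm h0). Qed.

Lemma smoothed_lossE tau h u : 0 < tau < 1 -> 0 < h ->
  smoothed_loss tau K h u = \int[mu]_x (check_loss tau (u + h * x) * K x).
Proof.
move=> ht h0; rewrite /smoothed_loss /Rintegral; congr fine.
rewrite (@ge0_integral_affine _ h u _ h0); first last.
- move=> x; rewrite lee_fin mulr_ge0 ?check_loss_ge0// /scaled_kernel mulr_ge0 ?kernel_ge0//.
  by rewrite invr_ge0 ltW.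
- apply/measurable_EFinP; apply: measurable_funM; first exact: measurable_check_loss.
  rewrite /scaled_kernel; apply: measurable_funM => //.
  apply: (measurableT_comp kernel_measurable) => //.
  by apply: measurable_funM => //; exact: measurable_funB.
rewrite -ge0_integralZl//; first last.
- by rewrite lee_fin ltW.
- move=> x _; rewrite lee_fin mulr_ge0 ?check_loss_ge0// /scaled_kernel mulr_ge0 ?kernel_ge0//.
  by rewrite invr_ge0 ltW.
- apply/measurable_EFinP; apply: measurable_funM.
    apply: (measurableT_comp (measurable_check_loss tau)) => //.
    by apply: measurable_funD => //; exact: measurable_funM.
  rewrite /scaled_kernel; apply: measurable_funM => //.
  apply: (measurableT_comp kernel_measurable) => //.
  apply: measurable_funM => //; apply: measurable_funB => //.
  by apply: measurable_funD => //; exact: measurable_funM.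
apply: eq_integral => x _; rewrite -EFinM /scaled_kernel addrK.
rewrite [h * x]mulrC mulfK ?gt_eqF// [x * h]mulrC [h * x + u]addrC.
by congr EFin; field; rewrite gt_eqF.
Qed.

Lemma below_integrable h u :
  mu.-integrable [set: R] (EFin \o (fun x => (u + h * x < 0)%R%:R * K x)).
Proof.
apply: (@kernel_integrable _ 1 0); first by apply: measurable_below0; exact: measurable_shift.
by move=> x; rewrite mul0r addr0; case: (_ < _); rewrite ?normr1 ?normr0.
Qed.

Lemma excess_integrable h u s :
  mu.-integrable [set: R] (EFin \o (fun x => knight (u + h * x) s * K x)).
Proof.
apply: (@kernel_integrable _ `|s| 0); first by
  apply: measurable_knight => //; exact: measurable_shift.
by move=> x; rewrite mul0r addr0 ger0_norm ?knight_ge0// knight_le.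
Qed.

(** Knight's identity, integrated against the kernel. *)
Lemma smoothed_lossB tau h u s : 0 < tau < 1 -> 0 < h ->
  smoothed_loss tau K h (u - s) =
  smoothed_loss tau K h u - s * (tau - below h u) + excess h u s.
Proof.
move=> ht h0; rewrite !smoothed_lossE//.
have iL : mu.-integrable [set: R] (EFin \o (fun x => check_loss tau (u + h * x) * K x)).
  apply: (@kernel_integrable _ `|u| h).
    apply: (measurableT_comp (measurable_check_loss tau)) => //; exact: measurable_shift.
  by move=> x; rewrite (le_trans (check_loss_le _ ht))// affine_norm_le.
have iK : mu.-integrable [set: R] (EFin \o (fun x => s * tau * K x)).
  by apply: (@kernel_integrable _ `|s * tau| 0) => // x; rewrite mul0r addr0.
have iB : mu.-integrable [set: R] (EFin \o (fun x => s * ((u + h * x < 0)%R%:R * K x))).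
  have := integrableZl measurableT s (below_integrable h u).
  by apply: eq_integrable => // x _ /=; rewrite EFinM.
pose L (x : R) := check_loss tau (u + h * x) * K x.
pose B (x : R) := s * ((u + h * x < 0)%R%:R * K x).
transitivity (\int[mu]_x (L x - (s * tau * K x - B x) + knight (u + h * x) s * K x)).
  apply: eq_Rintegral => x _; rewrite /L /B.
  have -> : u - s + h * x = u + h * x - s by rewrite addrAC.
  rewrite check_lossB; move: (check_loss _ _) (knight _ _) (_%:R) => c k b; ring.
have i1 : mu.-integrable [set: R] (EFin \o (fun x => s * tau * K x - B x)).
  have := integrableB measurableT iK iB.
  by apply: eq_integrable => // x _ /=; rewrite EFinB.
have i2 : mu.-integrable [set: R] (EFin \o (fun x => L x - (s * tau * K x - B x))).
  have := integrableB measurableT iL i1.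
  by apply: eq_integrable => // x _ /=; rewrite EFinB.
rewrite RintegralD//; last exact: excess_integrable.
rewrite RintegralB// RintegralB// -/(excess h u s); congr (_ - _ + _).
have -> : \int[mu]_x B x = s * below h u.
  by rewrite /B RintegralZl//; exact: below_integrable.
rewrite mulrBr; congr (_ - _).
have iK1 : mu.-integrable [set: R] (EFin \o K).
  have h1 (x : R) : `|(cst 1 : R -> R) x| <= 1 + 0 * `|x| by rewrite /= normr1 mul0r addr0.
  have := kernel_integrable (measurable_cst _) h1.
  by apply: eq_integrable => // x _ /=; rewrite mul1r.
by rewrite RintegralZl// /Rintegral kernel_mass/= mulr1.
Qed.

Lemma excessE h u s : ((excess h u s)%:E = \int[mu]_x (knight (u + h * x) s * K x)%:E)%E.
Proof.
by rewrite /excess /Rintegral fineK//; apply: integrable_fin_num => //; exact: excess_integrable.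
Qed.

Lemma belowE h u : ((below h u)%:E = \int[mu]_x ((u + h * x < 0)%R%:R * K x)%:E)%E.
Proof.
by rewrite /below /Rintegral fineK//; apply: integrable_fin_num => //; exact: below_integrable.
Qed.

Lemma excess_ge0 h u s : 0 <= excess h u s.
Proof. by apply: Rintegral_ge0 => x _; rewrite mulr_ge0 ?knight_ge0 ?kernel_ge0. Qed.

Lemma excess_le h u s : excess h u s <= `|s|.
Proof.
rewrite -lee_fin excessE.
apply: (@le_trans _ _ (\int[mu]_x (`|s|%:E * (K x)%:E))%E).
  apply: ge0_le_integral => //.
  - by move=> x _; rewrite lee_fin mulr_ge0 ?knight_ge0 ?kernel_ge0.
  - by have /measurable_int := excess_integrable h u s.
  - by apply: emeasurable_funM => //; apply/measurable_EFinP; exact: kernel_measurable.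
  - by move=> x _; rewrite -EFinM lee_fin ler_wpM2r ?kernel_ge0// knight_le.
rewrite ge0_integralZl ?kernel_mass ?mule1//.
- by apply/measurable_EFinP; exact: kernel_measurable.
- by move=> x _; rewrite lee_fin kernel_ge0.
Qed.

Lemma below_ge0 h u : 0 <= below h u.
Proof. by apply: Rintegral_ge0 => x _; rewrite mulr_ge0 ?kernel_ge0. Qed.

Lemma below_le1 h u : below h u <= 1.
Proof.
rewrite -lee_fin belowE -kernel_mass.
apply: ge0_le_integral => //.
- by move=> x _; rewrite lee_fin mulr_ge0 ?kernel_ge0.
- by have /measurable_int := below_integrable h u.
- by apply/measurable_EFinP; exact: kernel_measurable.
- by move=> x _; rewrite lee_fin ler_piMl ?kernel_ge0//; case: (_ < _).
Qed.

Lemma excess0 h u : excess h u 0 = 0.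
Proof. by apply/eqP; rewrite eq_le excess_ge0 andbT (le_trans (excess_le _ _ _))// normr0. Qed.

Lemma excess_convex h u t s s' : 0 <= t <= 1 ->
  excess h u (t * s + (1 - t) * s') <= t * excess h u s + (1 - t) * excess h u s'.
Proof.
move=> ht; rewrite -RintegralZl//; last exact: excess_integrable.
rewrite -RintegralZl//; last exact: excess_integrable.
have i1 r v : mu.-integrable [set: R] (EFin \o (fun x => r * (knight (u + h * x) v * K x))).
  have := integrableZl measurableT r (excess_integrable h u v).
  by apply: eq_integrable => // x _ /=; rewrite EFinM.
rewrite -RintegralD//; apply: le_Rintegral => //; first exact: excess_integrable.
  have := integrableD measurableT (i1 t s) (i1 (1 - t) s').
  by apply: eq_integrable => // x _ /=; rewrite EFinD.
move=> x _; rewrite !mulrA -mulrDl ler_wpM2r ?kernel_ge0//.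
exact: knight_convex.
Qed.

(** Only the kernel mass of [V] with [u + h V] between [- |s|] and [|s|]
    contributes. *)
Lemma excess_le_sqr h u s : 0 < h -> excess h u s <= 2 * ku / h * s ^+ 2.
Proof.
move=> h0; rewrite -lee_fin excessE.
pose I : set R := `[(- u - `|s|) / h, (- u + `|s|) / h]%classic.
have mI : measurable I by exact: measurable_itv.
apply: (@le_trans _ _ (\int[mu]_(x in I) (`|s| * ku)%:E)%E).
  rewrite [leRHS]integral_mkcond; apply: ge0_le_integral => //.
  - by move=> x _; rewrite lee_fin mulr_ge0 ?knight_ge0 ?kernel_ge0.
  - by have /measurable_int := excess_integrable h u s.
  - apply/(measurable_restrictT (fun x => (`|s| * ku)%:E)) => //.
  - move=> x _; rewrite patchE; case: ifPn => [_|].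
      by rewrite lee_fin ler_pM ?knight_ge0 ?kernel_ge0 ?knight_le ?kernel_le.
    rewrite notin_setE /I/= in_itv/= => /negP xI; rewrite knight_supp ?mul0r//.
    rewrite ltNge; apply: contra xI; rewrite ler_norml => /andP[h1 h2].
    by rewrite ler_pdivrMr// ler_pdivlMr//; apply/andP; split; lra.
rewrite integral_cst//= /I lebesgue_measure_itvcc; last first.
  by rewrite ler_pM2r ?invr_gt0//; have := normr_ge0 s; lra.
rewrite -EFinM lee_fin -(real_normK (num_real s)) le_eqVlt; apply/orP; left.
by apply/eqP; field; rewrite gt_eqF.
Qed.

End smoothing.

(** * Independence and the bootstrap union bound *)

Lemma measurable_superlevel d (T : measurableType d) (R : realType) (g : T -> R) c :
  measurable_fun [set: T] g -> measurable [set w | c <= g w].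
Proof.
move=> mg; have := mg measurableT _ (measurable_itv `[c, +oo[).
by rewrite setTI; congr measurable; apply/seteqP; split => w /=; rewrite in_itv/= andbT.
Qed.

Section independence.
Local Open Scope ereal_scope.
Context {R : realType} {d : measure_display} {T : measurableType d}.
Variable P : probability T R.
Context {d' : measure_display} {T' : measurableType d'} {n : nat}.
Variable Z : 'I_n -> {RV P >-> T'}.
Hypothesis indZ : mutually_independent Z.

(** Independence of sets extends to nonnegative functions one coordinate at a
    time. With the other factors fixed, the product of these factors is a
    density, and the image of the weighted measure by [Z i0] is proportional to
    the law of [Z i0], since the two agree on measurable sets. *)
Lemma expectation_prod_indep (g : 'I_n -> T' -> R) (m : 'I_n -> R) :
  (forall i, measurable_fun [set: T'] (g i)) -> (forall i x, (0 <= g i x)%R) ->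
  (forall i, \int[P]_w (g i (Z i w))%:E = (m i)%:E) ->
  \int[P]_w (\prod_i g i (Z i w))%:E = (\prod_i m i)%:E.
Proof.
have mZ i : measurable_fun [set: T] (Z i) by exact: measurable_funP.
suff H k : (k <= n)%N -> forall (g : 'I_n -> T' -> R) (m : 'I_n -> R),
    (forall i, measurable_fun [set: T'] (g i)) -> (forall i x, (0 <= g i x)%R) ->
    (forall i, \int[P]_w (g i (Z i w))%:E = (m i)%:E) ->
    (forall i : 'I_n, (k <= i)%N -> exists2 A, measurable A & g i = \1_A) ->
    \int[P]_w (\prod_i g i (Z i w))%:E = (\prod_i m i)%:E.
  by move=> mg g0 gm; apply: (H n) => // i; rewrite leqNgt ltn_ord.
elim: k => [_|k IH kn] {}g {}m mg g0 gm gA.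
  have [A AP] : exists A : 'I_n -> set T', forall i, measurable (A i) /\ g i = \1_(A i).
    have := fun i => cid2 (gA i (leq0n _)).
    by move=> h; exists (fun i => projT1 (h i)) => i; case: (h i) => /=.
  have -> : \int[P]_w (\prod_i g i (Z i w))%:E =
      \int[P]_w (\1_(\bigcap_(i in [set: 'I_n]) (Z i @^-1` A i)) w)%:E.
    apply: eq_integral => w _; congr EFin.
    under eq_bigr do rewrite (AP _).2 indicE.
    rewrite indicE; have [wA|wA] := boolP (_ \in _).
      rewrite big1// => i _; rewrite mem_set//.
      by move: wA; rewrite inE => /(_ i I).
    have [i wi] : exists i, Z i w \notin A i.
      apply/not_existsP => h; move: wA; rewrite notin_setE; apply => i _ /=.
      by apply/set_mem/negPn/negP; exact: h.
    by rewrite (bigD1 i)//= (negbTE wi) mul0r.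
  have mA i : measurable (Z i @^-1` A i).
    by rewrite -[X in measurable X]setTI; apply: mZ => //; case: (AP i).
  rewrite integral_indic//; last by apply: fin_bigcap_measurable.
  rewrite setIT; transitivity (\prod_(i < n) P (Z i @^-1` A i)).
    by apply: indZ => i; case: (AP i).
  rewrite -prodEFin; apply: eq_bigr => i _; rewrite -gm (AP i).2.
  by rewrite -[RHS]/(\int[P]_w (\1_(Z i @^-1` A i) w)%:E) integral_indic// setIT.
pose i0 : 'I_n := Ordinal kn.
pose H w := (\prod_(i | i != i0) g i (Z i w))%R.
pose c := (\prod_(i | i != i0) m i)%R.
have mgZ i : measurable_fun [set: T] (fun w => g i (Z i w)).
  exact: (measurableT_comp (mg i) (mZ i)).
have mH : measurable_fun [set: T] H.
  have -> : H = fun w =>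
      (\prod_(i <- index_enum 'I_n) (if i != i0 then fun w => g i (Z i w) else cst 1%R) w)%R.
    by apply/funext => w; rewrite /H big_mkcond; apply: eq_bigr => i _; case: ifP.
  by apply: measurable_prod => i _; case: ifP => _.
have H0 w : (0 <= H w)%R by apply: prodr_ge0.
have m0 i : (0 <= m i)%R.
  by rewrite -lee_fin -gm; apply: integral_ge0 => w _; rewrite lee_fin.
have c0 : (0 <= c)%R by apply: prodr_ge0.
have HB (B : set T') : measurable B ->
    \int[P]_(w in Z i0 @^-1` B) (H w)%:E = c%:E * P (Z i0 @^-1` B).
  move=> mB.
  have mZB : measurable (Z i0 @^-1` B).
    by rewrite -[X in measurable X]setTI; exact: mZ.
  pose g' i := if i == i0 then \1_B else g i.
  pose m' i := if i == i0 then fine (P (Z i0 @^-1` B)) else m i.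
  have m'E : (\prod_i m' i)%:E = c%:E * P (Z i0 @^-1` B).
    rewrite (bigD1 i0)//= {1}/m' eqxx EFinM fineK ?fin_num_measure// muleC.
    congr (_%:E * _).
    by apply: eq_bigr => i /negPf ii0; rewrite /m' ii0.
  rewrite -m'E -(IH (ltnW kn) g' m').
  - rewrite [LHS]integral_mkcond; apply: eq_integral => w _.
    rewrite (bigD1 i0)//= {1}/g' eqxx.
    have -> : (\prod_(i | i != i0) g' i (Z i w))%R = H w.
      by apply: eq_bigr => i /negPf ii0; rewrite /g' ii0.
    rewrite patchE indicE; have -> : (w \in Z i0 @^-1` B) = (Z i0 w \in B).
      by apply/idP/idP; rewrite !inE.
    by case: (_ \in B); rewrite ?mul1r ?mul0r.
  - by move=> i; rewrite /g'; case: ifP => _ //; exact: measurable_indic.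
  - by move=> i x; rewrite /g'; case: ifP => _ //; rewrite indicE.
  - move=> i; rewrite /g' /m'; case: eqP => [->|_]; last exact: gm.
    rewrite fineK ?fin_num_measure//.
    by rewrite -[LHS]/(\int[P]_w (\1_(Z i0 @^-1` B) w)%:E) integral_indic// setIT.
  - move=> i ki; rewrite /g'; case: eqP => [_|/eqP ii0]; first by exists B.
    apply: gA; rewrite ltn_neqAle ki andbT eq_sym.
    by apply: contra ii0 => /eqP ik; exact/eqP/val_inj.
have -> : \int[P]_w (\prod_i g i (Z i w))%:E =
    \int[P]_w ((g i0 (Z i0 w))%:E * (H w)%:E).
  by apply: eq_integral => w _; rewrite (bigD1 i0)//= EFinM.
rewrite -(ge0_integral_density P mH H0); last 2 first.
  - exact/measurable_EFinP.
  - by move=> w; rewrite lee_fin.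
pose D : {measure set T -> \bar R} := density_measure P mH H0.
transitivity (\int[image_measure D (mZ i0)]_x (g i0 x)%:E).
  rewrite ge0_integral_image//; first exact/measurable_EFinP.
  by move=> x; rewrite lee_fin.
transitivity (\int[mscale (NngNum c0) (image_measure P (mZ i0))]_x (g i0 x)%:E).
  by apply: eq_measure_integral => B mB _; exact: HB.
rewrite ge0_integral_mscale//; last 2 first.
  - exact/measurable_EFinP.
  - by move=> x; rewrite lee_fin.
rewrite ge0_integral_image//; last 2 first.
  - exact/measurable_EFinP.
  - by move=> x; rewrite lee_fin.
by rewrite gm -EFinM (bigD1 i0)//= mulrC.
Qed.

End independence.

Section bootstrap.
Context {R : realType} {d : measure_display} {T : measurableType d}.
Variable P : probability T R.
Context {d' : measure_display} {T' : measurableType d'} {n : nat}.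
Variable Z : 'I_n -> {RV P >-> T'}.
Hypothesis indZ : mutually_independent Z.
Variable e : 'I_n -> {RV P >-> R}.
Hypotheses (rad : forall i, rademacher (e i)) (inde : mutually_independent e).

Local Notation signs := {ffun 'I_n -> bool}.

Definition sign_of (b : signs) : 'I_n -> R := fun i => if b i then 1 else -1.

Lemma rademacher_signs (b : signs) :
  P [set w | (fun i => e i w) = sign_of b] = ((2^-1) ^+ n)%:E.
Proof.
have -> : [set w | (fun i => e i w) = sign_of b] =
    \bigcap_(i in [set: 'I_n]) (e i @^-1` [set sign_of b i]).
  apply/seteqP; split => [w /= h i _ /=|w /= h]; first by rewrite -h.
  by apply/funext => i; exact: (h i).
transitivity (\prod_(i < n) P (e i @^-1` [set sign_of b i]))%E.
  by apply: (inde (A := fun i => [set sign_of b i])).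
under eq_bigr => i _.
  have -> : P (e i @^-1` [set sign_of b i]) = (2^-1)%:E.
    by rewrite /sign_of; case: (b i); case: (rad i) => _ h1 h2.
  over.
by rewrite prodEFin prodr_const card_ord.
Qed.

Lemma sign_of_surj w : exists b, (fun i => e i w) = sign_of b.
Proof.
exists [ffun i => e i w == 1]; apply/funext => i; rewrite /sign_of ffunE.
case: (rad i) => /(_ w)[->|->] _ _; first by rewrite eqxx.
by rewrite lt_eqF// ltrN10.
Qed.

Lemma sign_of_inj : injective sign_of.
Proof.
move=> b b' h; apply/ffunP => i; have := congr1 (fun f => f i) h; rewrite /sign_of.
have n1 : (1 : R) <> -1 by apply/eqP; rewrite gt_eqF// ltrN10.
by case: (b i); case: (b' i) => // /esym /n1.
Qed.

(** The signs take finitely many values, so every set of sign vectors, even one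
    that is not measurable, has the probability that counting gives to it. *)
Lemma PstarE (A : set ('I_n -> R)) :
  Pstar e A = (\sum_(b : signs) (2^-1) ^+ n * (sign_of b \in A)%:R)%:E.
Proof.
rewrite /Pstar.
pose ev (b : signs) := [set w | (fun i => e i w) = sign_of b].
have mev b : measurable (ev b).
  have -> : ev b = \bigcap_(i in [set: 'I_n]) (e i @^-1` [set sign_of b i]).
    apply/seteqP; split => [w /= h i _ /=|w /= h]; first by rewrite -h.
    by apply/funext => i; exact: (h i).
  apply: fin_bigcap_measurable; first exact: finite_finset.
  move=> i _; have := measurable_funP (e i) measurableT _ (measurable_set1 (sign_of b i)).
  by rewrite setTI.
set D := [set w | A _].
have DE : D = \bigcup_(b in [set b | sign_of b \in A]) ev b.
  apply/seteqP; split => w /=.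
    move=> Aw; have [b hb] := sign_of_surj w; exists b => //=.
    by rewrite -hb inE.
  by move=> [b /=]; rewrite inE /D /ev /= => Ab ->.
have mD : measurable D by rewrite DE; apply: fin_bigcup_measurable.
transitivity (\int[P]_w (\1_D w)%:E)%E; first by rewrite integral_indic// setIT.
transitivity (\int[P]_w (\sum_(b : signs) ((sign_of b \in A)%:R * \1_(ev b) w)%:E))%E.
  apply: eq_integral => w _; rewrite sumEFin; congr EFin.
  have [b hb] := sign_of_surj w; rewrite (bigD1 b)//= big1 ?addr0 => [|b' b'b].
    rewrite !indicE (_ : w \in ev b) ?mulr1; last by rewrite inE.
    by congr ((nat_of_bool _)%:R); apply/idP/idP; rewrite !inE /D/= hb.
  rewrite indicE (_ : w \in ev b' = false) ?mulr0//; apply/negbTE.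
  rewrite notin_setE => ewb'; move/negP : b'b; apply.
  by apply/eqP/sign_of_inj; rewrite -hb; exact: esym ewb'.
rewrite ge0_integral_sum//; last first.
  by move=> b; apply/measurable_EFinP; apply: measurable_funM => //; exact: measurable_indic.
rewrite -sumEFin; apply: eq_bigr => b _.
under eq_integral do rewrite EFinM.
rewrite ge0_integralZl//; last by apply/measurable_EFinP; exact: measurable_indic.
rewrite integral_indic// setIT mulrC EFinM; congr (_ * _)%E.
exact: rademacher_signs.
Qed.

Section chernoff.
Variables (phi : T' -> R) (q c : R).
Hypothesis mphi : measurable_fun [set: T'] phi.
Hypothesis mgf : forall i,
  (\int[P]_w (expR (2 * phi (Z i w)))%:E <= (2 * expR q - 1)%:E)%E.

Definition signed_sum (b : signs) (D : 'I_n -> T') : R :=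
  \sum_i (1 + sign_of b i) * phi (D i).

Lemma measurable_signed_sum (b : signs) :
  measurable_fun [set: T] (fun w => signed_sum b (fun i => Z i w)).
Proof.
apply: measurable_sum => i; apply: measurable_funM => //.
exact: (measurableT_comp mphi (measurable_funP (Z i))).
Qed.

(** The signs are averaged first: the multiplier [1 + s] is 0 or 2, so
    averaging the product of the moment generating functions over the signs
    turns each factor into the mean of 1 and the moment generating function. *)
Lemma boot_chernoff :
  (\sum_(b : signs) (2^-1 ^+ n)%:E *
     P [set w | (c <= signed_sum b (fun i => Z i w))%R] <=
   (expR (n%:R * q - c))%:E)%E.
Proof.
have mZ i : measurable_fun [set: T] (Z i) by exact: measurable_funP.
pose m i := fine (\int[P]_w (expR (2 * phi (Z i w)))%:E)%E.
have I0 i : (0 <= \int[P]_w (expR (2 * phi (Z i w)))%:E)%E.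
  by apply: integral_ge0 => w _; rewrite lee_fin expR_ge0.
have mE i : (\int[P]_w (expR (2 * phi (Z i w)))%:E)%E = (m i)%:E.
  rewrite /m fineK// ge0_fin_numE//.
  by apply: le_lt_trans (mgf i) _; rewrite ltry.
have m0 i : 0 <= m i by rewrite -lee_fin -mE.
have mq i : 1 + m i <= 2 * expR q by have := mgf i; rewrite mE lee_fin; lra.
have mexp : measurable_fun [set: T'] (fun x => expR (2 * phi x)).
  by apply: measurableT_comp => //; exact: measurable_funM.
have cb (b : signs) : (P [set w | (c <= signed_sum b (fun i => Z i w))%R] <=
    (expR (- c) * \prod_i (if b i then m i else 1)%R)%:E)%E.
  have mS := measurable_signed_sum b.
  set D := [set w | _].
  have mD : measurable D by exact: measurable_superlevel.
  rewrite -[X in P X]setIT -integral_indic//.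
  apply: (@le_trans _ _ (\int[P]_w ((expR (- c))%:E *
      (\prod_i (if b i then (fun x => expR (2 * phi x)) else cst 1%R) (Z i w))%:E))%E).
    apply: ge0_le_integral => //.
    - by apply/measurable_EFinP; exact: measurable_indic.
    - apply: emeasurable_funM => //; apply/measurable_EFinP; apply: measurable_prod => i _.
      by case: (b i) => //; exact: (measurableT_comp mexp (mZ i)).
    - move=> w _; rewrite -EFinM lee_fin.
      have -> : \prod_i (if b i then (fun x => expR (2 * phi x)) else cst 1%R) (Z i w) =
          expR (signed_sum b (fun i => Z i w)).
        rewrite /signed_sum expR_sum; apply: eq_bigr => i _; rewrite /sign_of.
        by case: (b i); [congr (expR (_ * _)); ring|rewrite subrr mul0r expR0].
      rewrite -expRD indicE; case: (boolP (w \in D)) => [|_]; last exact: expR_ge0.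
      by rewrite inE /D/= => cS; rewrite -expR0 ler_expR; lra.
  rewrite ge0_integralZl//; last 2 first.
  - apply/measurable_EFinP; apply: measurable_prod => i _.
    by case: (b i) => //; exact: (measurableT_comp mexp (mZ i)).
  - move=> w _; rewrite lee_fin; apply: prodr_ge0 => i _.
    by case: (b i) => //; exact: expR_ge0.
  rewrite EFinM lee_wpmul2l ?lee_fin ?expR_ge0// le_eqVlt; apply/orP; left; apply/eqP.
  apply: (expectation_prod_indep indZ
    (g := fun i => if b i then (fun x => expR (2 * phi x)) else cst 1)).
  - by move=> i; case: (b i).
  - by move=> i x; case: (b i) => //; exact: expR_ge0.
  - move=> i; case: (b i); first exact: mE.
    by rewrite -[LHS]/(\int[P]_w (cst 1%:E w))%E integral_cst// mul1e; exact: probability_setT.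
apply: (@le_trans _ _ (\sum_(b : signs) ((2^-1 ^+ n) *
    (expR (- c) * \prod_i (if b i then m i else 1)%R))%:E)%E).
  by apply: lee_sum => b _; rewrite EFinM lee_wpmul2l// lee_fin exprn_ge0.
rewrite sumEFin lee_fin.
under eq_bigr do rewrite mulrCA.
rewrite -mulr_sumr addrC expRD ler_pM2l ?expR_gt0// -mulr_sumr.
rewrite -(bigA_distr_bigA (fun i (b : bool) => if b then m i else 1)).
rewrite expRM_natl exprVn ler_pdivrMl ?exprn_gt0// -exprMn.
rewrite -[n in leRHS]card_ord -prodr_const.
apply: ler_prod => i _; rewrite big_bool/= addrC; apply/andP; split; last exact: mq.
exact: addr_ge0.
Qed.

End chernoff.

(** The bad event is a finite union over the test functions; the Chernoff bounds
    control its mean over the signs and the data, and Markov's inequality turns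
    this into a bound on the conditional probability of the bad event given the
    data, outside a set of data of small probability. *)
Theorem boot_union (I : finType) (phi : I -> T' -> R) (q c : I -> R) (eps delta : R) :
  (forall k, measurable_fun [set: T'] (phi k)) ->
  (forall k i, (\int[P]_w (expR (2 * phi k (Z i w)))%:E <= (2 * expR (q k) - 1)%:E)%E) ->
  0 < eps ->
  \sum_k expR (n%:R * q k - c k) <= delta ->
  exists E, [/\ sigma_RV Z E, ((1 - delta / eps)%:E <= P E)%E &
    forall w, E w -> ((1 - eps)%:E <=
      Pstar e [set s | forall k, (\sum_i (1 + s i) * phi k (Z i w) < c k)%R])%E].
Proof.
move=> mphi mgf eps0 sum_le.
pose bad k (b : signs) : set (n.-tuple T') := [set D | c k <= signed_sum (phi k) b (tnth D)].
have mbad k b : measurable (bad k b).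
  have mS : measurable_fun [set: n.-tuple T'] (fun D => signed_sum (phi k) b (tnth D)).
    apply: measurable_sum => i; apply: measurable_funM => //.
    exact: (measurableT_comp (mphi k) (measurable_tnth i)).
  exact: measurable_superlevel.
pose badU b := \bigcup_(k in [set: I]) bad k b.
have mbadU b : measurable (badU b) by apply: fin_bigcup_measurable => //; exact: finite_finset.
pose N (D : n.-tuple T') : R := \sum_(b : signs) (2^-1) ^+ n * \1_(badU b) D.
have mN : measurable_fun [set: n.-tuple T'] N.
  by apply: measurable_sum => b; apply: measurable_funM => //; exact: measurable_indic.
have N0 D : 0 <= N D by apply: sumr_ge0 => b _; rewrite mulr_ge0 ?exprn_ge0// indicE.
pose Zt w : n.-tuple T' := [tuple Z i w | i < n].
have tZ w i : tnth (Zt w) i = Z i w by rewrite tnth_mktuple.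
(* N D is the conditional probability of failure given the data D. *)
pose B := [set D | N D <= eps].
have mB : measurable B.
  have := mN measurableT _ (measurable_itv `]-oo, eps]).
  by rewrite setTI; congr measurable; apply/seteqP; split => D /=; rewrite in_itv/=.
have mZt : measurable_fun [set: T] Zt.
  apply/measurable_fun_tnthP => i; rewrite (_ : _ \o _ = Z i); first exact: measurable_funP.
  by apply/funext => w /=; rewrite tZ.
have mE : measurable (Zt @^-1` B) by rewrite -[X in measurable X]setTI; exact: mZt.
exists (Zt @^-1` B); split.
- rewrite /sigma_RV; have -> : (fun i => Z i : T -> T') =
      (fun i => (fun D => @tnth n T' D i) \o Zt).
    by apply/funext => i; apply/funext => w /=; rewrite tZ.
  by rewrite g_sigma_preimage_comp; exists B => //; rewrite setTI.
- have EN : (\int[P]_w (N (Zt w))%:E <= delta%:E)%E.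
    under eq_integral do rewrite /N -sumEFin.
    have mI b : measurable_fun [set: T] (fun w => \1_(badU b) (Zt w) : R).
      by apply: (measurableT_comp _ mZt); exact: measurable_indic.
    rewrite ge0_integral_sum//; last first.
      by move=> b; apply/measurable_EFinP; exact: measurable_funM.
    pose D k b := [set w | c k <= signed_sum (phi k) b (fun i => Z i w)].
    have mD k b : measurable (D k b).
      exact/measurable_superlevel/measurable_signed_sum.
    apply: (@le_trans _ _ (\sum_(b : signs) (2^-1 ^+ n)%:E * \sum_k P (D k b))%E).
      apply: lee_sum => b _; under eq_integral do rewrite EFinM.
      rewrite ge0_integralZl//; last exact/measurable_EFinP.
      apply: lee_wpmul2l; first by rewrite lee_fin exprn_ge0.
      apply: (@le_trans _ _ (\int[P]_w (\sum_k (\1_(D k b) w)%:E))%E).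
        apply: ge0_le_integral => //.
        - exact/measurable_EFinP.
        - apply: emeasurable_sum => k; apply/measurable_EFinP; exact: measurable_indic.
        - move=> w _; rewrite indicE; case: (boolP (_ \in _)) => [|_]; last first.
            by apply: sume_ge0 => k _; rewrite lee_fin.
          rewrite inE => -[k _ /= bk]; rewrite (bigD1 k)//= indicE mem_set; last first.
            by move: bk; rewrite /bad /D /signed_sum/=; under eq_bigr do rewrite tZ.
          by rewrite leeDl// sume_ge0.
      rewrite ge0_integral_sum//; last first.
        by move=> k; apply/measurable_EFinP; exact: measurable_indic.
      by apply: lee_sum => k _; rewrite integral_indic// setIT.
    under eq_bigr do rewrite ge0_sume_distrr//.
    rewrite exchange_big/=.
    apply: (@le_trans _ _ (\sum_k (expR (n%:R * q k - c k))%:E)%E); last first.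
      by rewrite sumEFin lee_fin.
    by apply: lee_sum => k _; apply: boot_chernoff => //; exact: mgf.
  have mNZ : measurable_fun [set: T] (fun w => (N (Zt w))%:E).
    by apply/measurable_EFinP; exact: (measurableT_comp mN mZt).
  have : (eps%:E * P (~` (Zt @^-1` B)) <= delta%:E)%E.
    apply: le_trans EN; rewrite -[X in P X]setIT -integral_indic//; last exact: measurableC.
    have e0 : (0 <= eps%:E)%E by rewrite lee_fin ltW.
    rewrite -ge0_integralZl//; last first.
      by apply/measurable_EFinP; apply: measurable_indic; exact: measurableC.
    apply: ge0_le_integral => //.
    - by move=> w _; rewrite mule_ge0// lee_fin ltW.
    - apply: emeasurable_funM => //; apply/measurable_EFinP; apply: measurable_indic.
      exact: measurableC.
    - move=> w _; rewrite -EFinM lee_fin indicE; case: (boolP (_ \in _)) => [|_].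
        by rewrite inE /B/= => /negP; rewrite -ltNge mulr1 => /ltW.
      by rewrite mulr0 N0.
  rewrite probability_setC//.
  have xfin : P (Zt @^-1` B) \is a fin_num by exact: fin_num_measure.
  rewrite -(fineK xfin) -EFinB -EFinM !lee_fin => h.
  by rewrite lerBlDr -lerBlDl ler_pdivlMr// mulrC.
- move=> w Ew; rewrite PstarE lee_fin.
  have sum1 : \sum_(b : signs) (2^-1 : R) ^+ n = 1.
    rewrite sumr_const card_ffun card_bool card_ord -[LHS]mulr_natr natrX exprVn mulVf//.
  have : N (Zt w) <= eps by exact: Ew.
  suff -> : N (Zt w) = 1 - \sum_(b : signs) (2^-1) ^+ n * (sign_of b \in
      [set s | forall k, \sum_i (1 + s i) * phi k (Z i w) < c k])%:R by lra.
  rewrite -[X in X - _]sum1 -sumrB; apply: eq_bigr => b _.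
  rewrite -[X in X - _]mulr1 -mulrBr indicE; congr (_ * _).
  set A := [set s | _].
  have [Ab|Ab] := boolP (sign_of b \in A).
    rewrite subrr memNset//= => -[k _] /=; rewrite /bad/= leNgt => /negP; apply.
    by move: Ab; rewrite inE /A/= => /(_ k); rewrite /signed_sum; under eq_bigr do rewrite -tZ.
  rewrite subr0 mem_set//.
  move: Ab; rewrite notin_setE => /existsNP[k /negP]; rewrite -leNgt => h.
  by exists k => //; move: h; rewrite /bad /signed_sum/=; under eq_bigr do rewrite -tZ.
Qed.

End bootstrap.

(** * Moments of the whitened design *)

Section exponential_inequalities.
Context {R : realType}.
Implicit Types y : R.

Lemma expR_le_mul y : expR y <= 1 + y * expR y.
Proof.
have h2 := expR_ge1Dx (- y); have e0 := expR_gt0 y.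
have h3 : expR y * (1 + - y) <= expR y * expR (- y) by rewrite ler_wpM2l// ltW.
rewrite -expRD subrr expR0 in h3; lra.
Qed.

Lemma expR_le_quad y : y <= 0 -> expR y <= 1 + y + y ^+ 2.
Proof.
move=> y0; have := expR_ge1Dx y; have := expR_le_mul y.
move: (expR y) => e h1 h2.
have : y * (e - 1 - y) <= 0 by rewrite mulr_le0_ge0//; lra.
lra.
Qed.

Lemma expR_taylor2 y : expR y <= 1 + y + y ^+ 2 * expR `|y|.
Proof.
have [y0|y0] := leP 0 y.
  rewrite ger0_norm//; have h := expR_le_mul y.
  have := ler_wpM2l y0 h; move: (expR y) h => e; lra.
rewrite ltr0_norm//; apply: le_trans (expR_le_quad (ltW y0)) _.
rewrite lerD2l ler_peMr ?sqr_ge0// -expR0 ler_expR; lra.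
Qed.

End exponential_inequalities.

Section expectation_bounds.
Context {R : realType} {d : measure_display} {T : measurableType d}.
Variable P : probability T R.
Local Open Scope ereal_scope.

Lemma ge0_expectation_le (f g : T -> R) (c : R) :
  measurable_fun [set: T] f -> measurable_fun [set: T] g ->
  (forall w, (0 <= f w)%R) -> (forall w, (f w <= g w)%R) ->
  \int[P]_w (g w)%:E <= c%:E -> \int[P]_w (f w)%:E <= c%:E.
Proof.
move=> mf mg f0 fg; apply: le_trans; apply: ge0_le_integral => //.
- by move=> w _; rewrite lee_fin.
- exact/measurable_EFinP.
- exact/measurable_EFinP.
- by move=> w _; rewrite lee_fin.
Qed.

Lemma ge0_expectationD (f g : T -> R) :
  measurable_fun [set: T] f -> measurable_fun [set: T] g ->
  (forall w, (0 <= f w)%R) -> (forall w, (0 <= g w)%R) ->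
  \int[P]_w (f w + g w)%:E = \int[P]_w (f w)%:E + \int[P]_w (g w)%:E.
Proof.
move=> mf mg f0 g0; under eq_integral do rewrite EFinD.
apply: ge0_integralD => //.
- by move=> w _; rewrite lee_fin.
- exact/measurable_EFinP.
- by move=> w _; rewrite lee_fin.
- exact/measurable_EFinP.
Qed.

Lemma ge0_expectationZ (c : R) (f : T -> R) : (0 <= c)%R ->
  measurable_fun [set: T] f -> (forall w, (0 <= f w)%R) ->
  \int[P]_w (c * f w)%:E = c%:E * \int[P]_w (f w)%:E.
Proof.
move=> c0 mf f0; under eq_integral do rewrite EFinM.
apply: ge0_integralZl => //.
- exact/measurable_EFinP.
- by move=> w _; rewrite lee_fin.
Qed.

Lemma expectation_cstr (c : R) : \int[P]_w c%:E = c%:E.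
Proof.
rewrite -[LHS]/(\int[P]_w (cst c%:E w)) integral_cst// -[RHS]mule1.
by congr (_ * _); exact: probability_setT.
Qed.

Lemma ge0_expectation_le_lin2 (f g1 g2 : T -> R) (a1 a2 b1 b2 : R) :
  measurable_fun [set: T] f -> measurable_fun [set: T] g1 -> measurable_fun [set: T] g2 ->
  (forall w, (0 <= f w)%R) -> (forall w, (0 <= g1 w)%R) -> (forall w, (0 <= g2 w)%R) ->
  (0 <= a1)%R -> (0 <= a2)%R ->
  (forall w, (f w <= a1 * g1 w + a2 * g2 w)%R) ->
  \int[P]_w (g1 w)%:E <= b1%:E -> \int[P]_w (g2 w)%:E <= b2%:E ->
  \int[P]_w (f w)%:E <= (a1 * b1 + a2 * b2)%:E.
Proof.
move=> mf m1 m2 f0 g10 g20 a10 a20 fg h1 h2.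
have m1' : measurable_fun [set: T] (fun w => a1 * g1 w)%R by exact: measurable_funM.
have m2' : measurable_fun [set: T] (fun w => a2 * g2 w)%R by exact: measurable_funM.
apply: (ge0_expectation_le mf _ f0 fg); first exact: measurable_funD.
rewrite ge0_expectationD//; last 2 first.
- by move=> w; rewrite mulr_ge0.
- by move=> w; rewrite mulr_ge0.
by rewrite !ge0_expectationZ// EFinD !EFinM leeD// lee_wpmul2l// lee_fin.
Qed.

(** A Gaussian tail makes the exponential of a quarter of the square, in units of
    the scale [ups], integrable: this exponential exceeds [2 ^ k] with
    probability at most [2 * 4 ^ - k], and is at most the sum of [2 ^ k.+1] over
    the [k] for which it exceeds [2 ^ k]. *)
Lemma exp_sqr_moment (z : T -> R) (ups : R) : (0 < ups)%R ->
  measurable_fun [set: T] z ->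
  (forall s, (0 <= s)%R ->
     P [set w | (ups * s <= `|z w|)%R] <= (2 * expR (- (s ^+ 2 / 2)))%:E) ->
  \int[P]_w (expR (z w ^+ 2 / (4 * ups ^+ 2)))%:E <= 8%:E.
Proof.
move=> ups0 mz tail.
pose W w := expR (z w ^+ 2 / (4 * ups ^+ 2)).
have mW : measurable_fun [set: T] W.
  apply: measurableT_comp => //; apply: measurable_funM => //; exact: measurable_funX.
pose D k := [set w | (2 ^+ k <= W w)%R].
have mD k : measurable (D k) by exact: measurable_superlevel.
have mf k : measurable_fun [set: T] (fun w => ((2 : R) ^+ k.+1 * \1_(D k) w)%:E).
  by apply/measurable_EFinP; apply: measurable_funM => //; exact: measurable_indic.
have f0 k w : 0 <= (2 ^+ k.+1 * \1_(D k) w)%:E :> \bar R.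
  by rewrite lee_fin mulr_ge0 ?exprn_ge0// indicE.
have PD k : P (D k) <= (2 * (4^-1) ^+ k)%:E.
  (* s solves expR (s ^ 2 / 4) = 2 ^ k. *)
  pose s : R := Num.sqrt (4 * (k%:R * ln 2)).
  have l2 : (0 <= ln 2 :> R)%R by apply: ln_ge0; rewrite ler1n.
  have ss : (s ^+ 2 = 4 * (k%:R * ln 2))%R by rewrite sqr_sqrtr// !mulr_ge0.
  have -> : (2 * 4^-1 ^+ k = 2 * expR (- (s ^+ 2 / 2)) :> R)%R.
    congr (_ * _)%R; rewrite ss (_ : - (_ / 2) = k%:R * (- ln 2 - ln 2))%R; last by field.
    rewrite expRM_natl expRD expRN lnK ?posrE//; congr (_ ^+ _)%R; by field.
  apply: le_trans _ (tail s (sqrtr_ge0 _)).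
  apply: le_measure; rewrite ?inE//.
    by apply: measurable_superlevel; exact: measurableT_comp.
  move=> w; rewrite /D/= -[X in (X ^+ k)%R](@lnK R) ?posrE// -expRM_natl ler_expR.
  rewrite ler_pdivlMr ?mulr_gt0 ?exprn_gt0// => h.
  have us0 : (0 <= ups * s)%R by rewrite mulr_ge0 ?sqrtr_ge0// ltW.
  rewrite -(@ler_pXn2r _ 2)// exprMn ss real_normK ?num_real//.
  by move: h; rewrite mulrCA [(ups ^+ 2 * _)%R]mulrC mulrA.
apply: (@le_trans _ _ (\int[P]_w (\sum_(k <oo) (2 ^+ k.+1 * \1_(D k) w)%:E))).
  apply: ge0_le_integral => //.
  - exact/measurable_EFinP.
  - by apply: ge0_emeasurable_sum => // k w _ _; exact: f0.
  - move=> w _.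
    have W1 : (1 <= W w)%R by rewrite -expR0 ler_expR divr_ge0// ?sqr_ge0// mulr_ge0// sqr_ge0.
    pose K := trunc_log 2 (Num.truncn (W w)).
    have W0 : (0 <= W w)%R by exact: le_trans W1.
    have /andP[W2 W3] := truncn_itv W0.
    have tW : (0 < Num.truncn (W w))%N.
      by rewrite -(ltr_nat R); move: W3; rewrite -natr1; lra.
    have /andP[K1 K2] := trunc_log_bounds (isT : (1 < 2)%N) tW.
    have wD : w \in D K.
      by rewrite inE /D/= (le_trans _ W2)// -natrX ler_nat.
    apply: (@le_trans _ _ (\sum_(k < K.+1) (2 ^+ k.+1 * \1_(D k) w)%:E)).
      rewrite big_ord_recr/= [X in _ + (_ * X)%:E]indicE wD mulr1.
      rewrite -[leLHS]add0e leeD//; first by apply: sume_ge0 => k _; exact: f0.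
      rewrite lee_fin (le_trans (ltW W3))// -natrX ler_nat.
      exact: K2.
    rewrite -(big_mkord xpredT (fun k => (2 ^+ k.+1 * \1_(D k) w)%:E)).
    by apply: nneseries_lim_ge => k _ _; exact: f0.
rewrite integral_nneseries//.
apply: lime_le.
  by apply: is_cvg_nneseries => k _ _; apply: integral_ge0 => w _; exact: f0.
apply: nearW => N.
apply: (@le_trans _ _ (\sum_(0 <= k < N) (4 * 2^-1 ^+ k)%:E)).
  apply: lee_sum => k _.
  have mi : measurable_fun [set: T] (\1_(D k) : T -> R) by exact: measurable_indic.
  have i0 w : (0 <= (\1_(D k) w : R))%R by rewrite indicE.
  rewrite (ge0_expectationZ _ mi i0) ?exprn_ge0// integral_indic// setIT.
  apply: (@le_trans _ _ ((2 ^+ k.+1)%:E * (2 * 4^-1 ^+ k)%:E)).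
    by apply: lee_wpmul2l; rewrite ?lee_fin ?exprn_ge0//; exact: PD.
  rewrite -EFinM lee_fin exprS mulrACA -exprMn (_ : 2 * 4^-1 = 2^-1)%R; last by field.
  by rewrite (_ : 2 * 2 = 4)%R//; ring.
rewrite sumEFin lee_fin big_mkord -mulr_sumr.
have := @sum_halfpow_le R N; lra.
Qed.

End expectation_bounds.

Lemma measurable_dotv_vec (R : realType) p (b : 'cV[R]_p) :
  measurable_fun [set: p.-tuple R] (fun x : p.-tuple R => dotv (vec x) b).
Proof.
rewrite (_ : (fun _ => _) = fun x : p.-tuple R => \sum_i tnth x i * b i 0).
  by apply: measurable_sum => i; apply: measurable_funM => //; exact: measurable_tnth.
by apply/funext => x; apply: eq_bigr => i _; rewrite mxE.
Qed.

Section design_moments.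
Context {R : realType} {d : measure_display} {T : measurableType d}.
Variables (P : probability T R) (p : nat) (X : {RV P >-> p.-tuple R}) (ups : R).
Hypotheses (p0 : (0 < p)%N) (DM : design_moments X) (SG : subgaussian_design X ups).

Local Notation Sigma := (second_moment_mx X).
Local Notation m3 := (third_moment X).

Definition wdot (v : 'cV[R]_p) (x : p.-tuple R) : R := dotv v (whiten X x).

Let Spos : pos_defmx Sigma. Proof. by case: DM. Qed.

Let ups0 : 0 < ups. Proof. by case: SG. Qed.

Lemma wdotE v x : wdot v x = dotv (invmx (sqrtmx Sigma) *m v) (vec x).
Proof.
have [symS _ _] := sqrtmxP Spos.
by rewrite /wdot /whiten dotv_adj trmx_inv symS.
Qed.

Lemma wdotZ a v x : wdot (a *: v) x = a * wdot v x.
Proof. exact: dotvZl. Qed.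

Lemma wdotD u v x : wdot (u + v) x = wdot u x + wdot v x.
Proof. exact: dotvDl. Qed.

Lemma measurable_wdot v : measurable_fun [set: p.-tuple R] (wdot v).
Proof.
rewrite (_ : wdot v = fun x => dotv (vec x) (invmx (sqrtmx Sigma) *m v)).
  exact: measurable_dotv_vec.
by apply/funext => x; rewrite wdotE dotvC.
Qed.

Lemma measurable_wdotX v : measurable_fun [set: T] (fun w => wdot v (X w)).
Proof. exact: (measurableT_comp (measurable_wdot v) (measurable_funP X)). Qed.

(** The whitened covariate has the identity as its second moment matrix. *)
Lemma wdot_sqr_mean v : (\int[P]_w (wdot v (X w) ^+ 2)%:E = (norm2 v ^+ 2)%:E)%E.
Proof.
have [symS SS Su] := sqrtmxP Spos.
set a := invmx (sqrtmx Sigma) *m v.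
have mom i j : P.-integrable [set: T] (fun w => (tnth (X w) i * tnth (X w) j)%:E).
  case: DM => _ L2 _ _.
  by apply/Lfun1_integrable; exact: Lfun2_mul_Lfun1.
have momE i j : (\int[P]_w (tnth (X w) i * tnth (X w) j)%:E = (Sigma i j)%:E)%E.
  by rewrite mxE unlock fineK// integrable_fin_num.
under eq_integral => w _.
  have -> : ((wdot v (X w) ^+ 2)%:E =
      \sum_i \sum_j (a i 0 * a j 0)%:E * (tnth (X w) i * tnth (X w) j)%:E)%E.
    rewrite wdotE -/a expr2 {1}/dotv mulr_suml -sumEFin; apply: eq_bigr => i _.
    rewrite /dotv mulr_sumr -sumEFin; apply: eq_bigr => j _.
    rewrite [vec (X w) i 0]mxE [vec (X w) j 0]mxE -EFinM; congr EFin; ring.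
  over.
rewrite integral_sum//=; last first.
  by move=> i; apply: integrable_sum => // j _; exact: integrableZl.
transitivity (\sum_i \sum_j (a i 0 * a j 0 * Sigma i j)%:E)%E.
  apply: eq_bigr => i _; rewrite integral_sum//; last first.
    by move=> j; exact: integrableZl.
  apply: eq_bigr => j _; rewrite integralZl// momE.
  by rewrite EFinM.
under eq_bigr do rewrite sumEFin.
rewrite sumEFin; congr EFin.
transitivity (dotv a (Sigma *m a)).
  apply: eq_bigr => i _; rewrite [(Sigma *m a) i 0]mxE mulr_sumr.
  by apply: eq_bigr => j _; ring.
by rewrite -SS -mulmxA dotv_adj symS /a mulKVmx// norm2_sqr.
Qed.

(** The moment bounds are proved for unit vectors; this transfers them to the
    ball of radius [q]. *)
Lemma wdot_unit v q : norm2 v <= q ->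
  exists2 u, norm2 u = 1 & forall x, `|wdot v x| <= q * `|wdot u x|.
Proof.
move=> vq; have [v0|v0] := eqVneq v 0.
  exists (delta_mx (Ordinal p0) 0).
    rewrite /norm2 /dotv (bigD1 (Ordinal p0))//= big1 ?addr0 => [|i /negPf i0].
      by rewrite mxE !eqxx mulr1 sqrtr1.
    by rewrite mxE i0 mul0r.
  move=> x; rewrite v0 /wdot dotv0l normr0 mulr_ge0//.
  by rewrite (le_trans _ vq)// norm2_ge0.
have nv : 0 < norm2 v by rewrite lt0r norm2_eq0 v0 norm2_ge0.
exists ((norm2 v)^-1 *: v).
  by rewrite norm2Z gtr0_norm ?invr_gt0// mulVf// gt_eqF.
move=> x; rewrite wdotZ normrM gtr0_norm ?invr_gt0// mulrA ler_peMl//.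
by rewrite ler_pdivlMr// mul1r.
Qed.

Lemma wdot_exp_moment u : norm2 u = 1 ->
  (\int[P]_w (expR (wdot u (X w) ^+ 2 / (4 * ups ^+ 2)))%:E <= 8%:E)%E.
Proof.
move=> u1; apply: exp_sqr_moment => //; first exact: measurable_wdotX.
by move=> s s0; case: SG => _; apply.
Qed.

(** The second moment of a unit direction is 1, and it is at most a multiple of
    [ups ^ 2] by the exponential moment. *)
Lemma ups_sqr_ge : 1 <= 32 * ups ^+ 2.
Proof.
have [u u1 _] := wdot_unit (lexx (norm2 (0 : 'cV[R]_p))).
suff : (\int[P]_w (wdot u (X w) ^+ 2)%:E <= (32 * ups ^+ 2)%:E)%E.
  by rewrite wdot_sqr_mean u1 expr1n lee_fin.
have hW := wdot_exp_moment u1.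
pose W w := expR (wdot u (X w) ^+ 2 / (4 * ups ^+ 2)).
have -> : 32 * ups ^+ 2 = 4 * ups ^+ 2 * 8 by ring.
have mz := measurable_wdotX u.
have mW : measurable_fun [set: T] W.
  by apply: measurableT_comp => //; apply: measurable_funM => //; exact: measurable_funX.
have c0 : 0 < 4 * ups ^+ 2 by rewrite mulr_gt0 ?exprn_gt0.
apply: (@ge0_expectation_le _ _ _ _ _ (fun w => 4 * ups ^+ 2 * W w)).
- exact: measurable_funX.
- exact: measurable_funM.
- by move=> w; exact: sqr_ge0.
- move=> w; rewrite -ler_pdivrMl// mulrC.
  by rewrite /W; have := expR_ge1Dx (wdot u (X w) ^+ 2 / (4 * ups ^+ 2)); lra.
- have c0' := ltW c0; rewrite ge0_expectationZ//; last by move=> w; exact: expR_ge0.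
  by rewrite [leRHS]EFinM lee_wpmul2l// lee_fin ltW.
Qed.

Let cube_le (z : R) : `|z| ^+ 3 <= 400 * ups ^+ 3 * expR (z ^+ 2 / (4 * ups ^+ 2)).
Proof.
pose y := `|z| / ups.
have y0 : 0 <= y by rewrite divr_ge0// ltW.
have -> : `|z| = ups * y by rewrite /y mulrC divfK// gt_eqF.
have -> : z ^+ 2 / (4 * ups ^+ 2) = y ^+ 2 / 4.
  by rewrite /y expr_div_n real_normK ?num_real//; field; rewrite gt_eqF.
suff h : y ^+ 3 <= 400 * expR (y ^+ 2 / 4).
  by rewrite exprMn; have := ler_wpM2l (ltW (exprn_gt0 3 ups0)) h; lra.
have e1 := expR_ge1Dx (y ^+ 2 / 8).
have -> : expR (y ^+ 2 / 4) = expR (y ^+ 2 / 8) ^+ 2.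
  by rewrite -expRM_natl; congr expR; field.
have y2 : 0 <= y ^+ 2 by exact: sqr_ge0.
have : (1 + y ^+ 2 / 8) ^+ 2 <= expR (y ^+ 2 / 8) ^+ 2.
  by rewrite lerXn2r ?nnegrE ?expR_ge0// addr_ge0// divr_ge0.
set E := expR _ => h.
have : 0 <= y ^+ 2 * (1 - y) ^+ 2 by rewrite mulr_ge0 ?sqr_ge0.
have : 0 <= (y ^+ 2) ^+ 2 by rewrite sqr_ge0.
lra.
Qed.

(** The supremum that defines the third moment is finite, since the exponential
    moment bounds the third moments of all unit directions at once. *)
Lemma third_moment_sup u : norm2 u = 1 ->
  (\int[P]_w (`|wdot u (X w)| ^+ 3)%:E <= m3%:E)%E.
Proof.
move=> u1.
pose S : set (\bar R) := [set ('E_P[fun w => (`|dotv u (whiten X (X w))| ^+ 3)%R])%E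
                  | u in [set u : 'cV[R]_p | norm2 u = 1]].
have Sub : ubound S (400 * ups ^+ 3 * 8)%:E.
  move=> _ [v /= v1 <-]; rewrite unlock.
  have mz := measurable_wdotX v.
  have c0 : 0 <= 400 * ups ^+ 3 by apply: mulr_ge0; [exact: ler0n|exact/exprn_ge0/ltW].
  have mW : measurable_fun [set: T] (fun w => expR (wdot v (X w) ^+ 2 / (4 * ups ^+ 2))).
    by apply: measurableT_comp => //; apply: measurable_funM => //; exact: measurable_funX.
  apply: (@ge0_expectation_le _ _ _ _ _
    (fun w => 400 * ups ^+ 3 * expR (wdot v (X w) ^+ 2 / (4 * ups ^+ 2)))).
  - by apply: measurable_funX; exact: measurableT_comp.
  - exact: measurable_funM.
  - by move=> w; rewrite exprn_ge0.
  - by move=> w; exact: cube_le.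
  - rewrite ge0_expectationZ//.
    by rewrite [leRHS]EFinM lee_wpmul2l// ?lee_fin//; exact: wdot_exp_moment.
have Su : S (\int[P]_w (`|wdot u (X w)| ^+ 3)%:E)%E by exists u => //; rewrite unlock.
have supfin : ereal_sup S \is a fin_num.
  rewrite ge0_fin_numE.
    by rewrite (le_lt_trans (ge_ereal_sup Sub)) ?ltry.
  apply: le_trans (ereal_sup_ubound Su).
  by apply: integral_ge0 => w _; rewrite lee_fin exprn_ge0.
by rewrite /third_moment fineK//; exact: ereal_sup_ubound.
Qed.

(** The second moment of a unit direction is 1, and
    [z ^ 2 <= 2 / 3 * |z| ^ 3 + 1 / 3]. *)
Lemma third_moment_ge1 : 1 <= m3.
Proof.
have [u u1 _] := wdot_unit (lexx (norm2 (0 : 'cV[R]_p))).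
have mz := measurable_wdotX u.
have := @ge0_expectation_le_lin2 _ _ _ P (fun w => wdot u (X w) ^+ 2)
  (fun w => `|wdot u (X w)| ^+ 3) (fun=> 1) (2/3) (1/3) m3 1.
rewrite wdot_sqr_mean u1 expectation_cstr lee_fin => h.
suff hh : (1 : R) ^+ 2 <= 2 / 3 * m3 + 1 / 3 * 1.
  by move: hh {h}; rewrite expr1n; move: m3 => m; lra.
rewrite -lee_fin; apply: h => //.
- exact: measurable_funX.
- by apply: measurable_funX; exact: measurableT_comp.
- by move=> w; exact: sqr_ge0.
- move=> w; rewrite -(real_normK (num_real (wdot u (X w)))).
  have := normr_ge0 (wdot u (X w)); set z := `| _ | => z0.
  have : 0 <= (z - 1) ^+ 2 * (2 * z + 1) by apply: mulr_ge0; [exact: sqr_ge0|lra].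
  by lra.
- exact: third_moment_sup.
Qed.

End design_moments.

Section subgaussian_pointwise.
Context {R : realType}.
Implicit Types (z ups th : R).

(** Where [z * exp (th * z ^ 2)] is at most [ups ^ 2], the left side is at most the
    cubic term. Elsewhere multiplying by the square of
    [z * exp (th * z ^ 2) / ups ^ 2 >= 1] brings the whole expression below the
    Gaussian exponential. In both cases the tails cost a factor [ups ^ 2] instead of
    [ups ^ 4]. *)
Lemma quartic_exp_le z ups th : 0 < ups -> 0 <= z -> 0 <= th -> 24 * th * ups ^+ 2 <= 1 ->
  z ^+ 4 * expR (th * z ^+ 2) <=
  ups ^+ 2 * z ^+ 3 + 24 ^+ 3 * ups ^+ 2 * expR (z ^+ 2 / (4 * ups ^+ 2)).
Proof.
move=> u0 z0 th0 hth; set E := expR (th * _); set W := expR (_ / _).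
have E0 : 0 < E by exact: expR_gt0.
have W0 : 0 < W by exact: expR_gt0.
have u2 : 0 < ups ^+ 2 by rewrite exprn_gt0.
have c0 : 0 <= 24 ^+ 3 * ups ^+ 2 * W.
  by apply: mulr_ge0; [apply: mulr_ge0; [apply/exprn_ge0/ler0n|exact: ltW]|exact: ltW].
have [zE|zE] := leP (z * E) (ups ^+ 2).
  have : z ^+ 3 * (z * E) <= z ^+ 3 * ups ^+ 2 by rewrite ler_wpM2l ?exprn_ge0.
  by move: (24 ^+ 3 * _ * _) c0 => c; lra.
have z3 : 0 <= ups ^+ 2 * z ^+ 3 by rewrite mulr_ge0 ?exprn_ge0// ltW.
suff : z ^+ 4 * E <= 24 ^+ 3 * ups ^+ 2 * W.
  by move: (24 ^+ 3 * _ * _) c0 => c; lra.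
pose y := z ^+ 2 / ups ^+ 2.
have zy : z ^+ 2 = ups ^+ 2 * y by rewrite /y mulrC divfK// gt_eqF.
have y0 : 0 <= y by rewrite divr_ge0// ?sqr_ge0.
rewrite -(ler_pM2l u2) -(ler_pM2l u2).
have WE : W = expR (y / 8) ^+ 2.
  rewrite -expRM_natl; congr expR; rewrite /y; field; exact: lt0r_neq0.
have E3 : E ^+ 3 <= expR (y / 8).
  rewrite -expRM_natl ler_expR zy.
  have : y * (24 * th * ups ^+ 2) <= y * 1 by rewrite ler_wpM2l.
  lra.
have y3 : y ^+ 3 <= 24 ^+ 3 * expR (y / 8).
  have -> : expR (y / 8) = expR (y / 24) ^+ 3.
    by rewrite -expRM_natl; congr expR; field.
  have := expR_ge1Dx (y / 24); have := expR_ge0 (y / 24); set e := expR _ => e0 h.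
  have c24 : 0 <= 24 * e by lra.
  rewrite -exprMn; apply: lerXn2r; rewrite ?nnegrE//; lra.
apply: (@le_trans _ _ (z ^+ 6 * E ^+ 3)).
  have h : ups ^+ 2 * ups ^+ 2 <= (z * E) * (z * E).
    by apply: ler_pM; rewrite ?ltW.
  have := ler_wpM2r (mulr_ge0 (exprn_ge0 4 z0) (ltW E0)) h.
  by clear; lra.
have -> : z ^+ 6 = (ups ^+ 2) ^+ 3 * y ^+ 3.
  by rewrite -exprMn -zy -exprM.
apply: (@le_trans _ _ ((ups ^+ 2) ^+ 3 * (24 ^+ 3 * expR (y / 8)) * expR (y / 8))).
  apply: ler_pM => //.
  - by apply: mulr_ge0; apply: exprn_ge0 => //; exact: sqr_ge0.
  - by apply: exprn_ge0; exact: ltW.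
  - by apply: ler_wpM2l => //; apply: exprn_ge0; exact: sqr_ge0.
rewrite WE; set e := expR _; move: (24 ^+ 3) => c.
by rewrite le_eqVlt; apply/orP; left; apply/eqP; ring.
Qed.

(** In units of [ups] the left side is at most [x ^ 2 * exp (2 * x)], which is
    dominated by the exponential of [x ^ 2 / 4]. *)
Lemma sqr_exp_abs_le z ups lam : 0 < ups -> 0 <= z -> 0 <= lam -> lam * ups <= 1 ->
  z ^+ 2 * expR (2 * lam * z) <=
  8 * expR 8 * ups ^+ 2 * expR (z ^+ 2 / (4 * ups ^+ 2)).
Proof.
move=> u0 z0 lam0 hlam.
pose x := z / ups.
have zx : z = ups * x by rewrite /x mulrC divfK// gt_eqF.
have x0 : 0 <= x by rewrite divr_ge0// ltW.
have -> : z ^+ 2 / (4 * ups ^+ 2) = x ^+ 2 / 8 + x ^+ 2 / 8.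
  by rewrite /x; field; exact: lt0r_neq0.
have h1 : x ^+ 2 <= 8 * expR (x ^+ 2 / 8).
  have := expR_ge1Dx (x ^+ 2 / 8); set e := expR _; lra.
have h2 : expR (2 * lam * z) <= expR 8 * expR (x ^+ 2 / 8).
  rewrite -expRD ler_expR zx.
  have : x * (lam * ups) <= x * 1 by rewrite ler_wpM2l.
  (* completing the square in 2 x <= 8 + x ^ 2 / 8 *)
  have : 0 <= (x - 8) ^+ 2 by rewrite sqr_ge0.
  lra.
have -> : z ^+ 2 = ups ^+ 2 * x ^+ 2 by rewrite zx exprMn.
have h3 := ler_pM (sqr_ge0 x) (expR_ge0 _) h1 h2.
have := ler_wpM2l (sqr_ge0 ups) h3.
rewrite [expR (x ^+ 2 / 8 + _)]expRD; move: (expR (x ^+ 2 / 8)) (expR 8) (expR _) => e e8 el; lra.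
Qed.

End subgaussian_pointwise.

Section design_moments_radius.
Context {R : realType} {d : measure_display} {T : measurableType d}.
Variables (P : probability T R) (p : nat) (X : {RV P >-> p.-tuple R}) (ups : R).
Hypotheses (p0 : (0 < p)%N) (DM : design_moments X) (SG : subgaussian_design X ups).

Local Notation m3 := (third_moment X).
Local Notation z v := (fun w => wdot X v (X w)).

Let ups0 : 0 < ups. Proof. by case: SG. Qed.

Let mz v : measurable_fun [set: T] (z v). Proof. exact: measurable_wdotX. Qed.

Let mabs v : measurable_fun [set: T] (fun w => `|wdot X v (X w)|).
Proof. exact: (measurableT_comp (@normr_measurable R setT) (mz v)). Qed.

Let m3_1 : 1 <= m3. Proof. exact: (third_moment_ge1 p0 DM SG). Qed.

Lemma wdot_sqr_le v q : norm2 v <= q -> (\int[P]_w (wdot X v (X w) ^+ 2)%:E <= (q ^+ 2)%:E)%E.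
Proof.
move=> vq; rewrite wdot_sqr_mean// lee_fin lerXn2r ?nnegrE ?norm2_ge0//.
by rewrite (le_trans _ vq)// norm2_ge0.
Qed.

Lemma wdot_cube_le v q : 0 <= q -> norm2 v <= q ->
  (\int[P]_w (`|wdot X v (X w)| ^+ 3)%:E <= (q ^+ 3 * m3)%:E)%E.
Proof.
move=> q0 vq; have [u u1 hu] := wdot_unit X p0 vq.
apply: (@ge0_expectation_le _ _ _ _ _ (fun w => q ^+ 3 * `|wdot X u (X w)| ^+ 3)).
- exact: measurable_funX.
- by apply: measurable_funM => //; exact: measurable_funX.
- by move=> w; rewrite exprn_ge0.
- by move=> w; rewrite -exprMn lerXn2r ?nnegrE ?mulr_ge0.
have q30 : 0 <= q ^+ 3 by rewrite exprn_ge0.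
rewrite ge0_expectationZ//; last exact: measurable_funX.
by rewrite [leRHS]EFinM lee_wpmul2l// ?lee_fin//; exact: (third_moment_sup DM SG).
Qed.

Lemma measurable_exp_sqr v (c : R) :
  measurable_fun [set: T] (fun w => expR (c * wdot X v (X w) ^+ 2)).
Proof.
apply: measurableT_comp => //; apply: measurable_funM => //; exact: measurable_funX.
Qed.

Definition quartic_cst : R := 2 ^+ 17.

Lemma wdot_quartic_exp v q th : 0 < q -> norm2 v <= q -> 0 <= th ->
  24 * th * ups ^+ 2 <= 1 ->
  (\int[P]_w (wdot X v (X w) ^+ 4 * expR (th / q ^+ 2 * wdot X v (X w) ^+ 2))%:E <=
   (quartic_cst * (ups ^+ 2 * m3) * q ^+ 4)%:E)%E.
Proof.
move=> q0 vq th0 hth; have [u u1 hu] := wdot_unit X p0 vq.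
have u2 : 0 < ups ^+ 2 by rewrite exprn_gt0.
have q4 : 0 < q ^+ 4 by rewrite exprn_gt0.
pose Z w := `|wdot X u (X w)|.
pose W w := expR (wdot X u (X w) ^+ 2 / (4 * ups ^+ 2)).
have mZ : measurable_fun [set: T] Z by exact: mabs.
have mW : measurable_fun [set: T] W.
  by apply: measurableT_comp => //; apply: measurable_funM => //; exact: measurable_funX.
have h : (\int[P]_w (wdot X v (X w) ^+ 4 * expR (th / q ^+ 2 * wdot X v (X w) ^+ 2))%:E <=
    (q ^+ 4 * ups ^+ 2 * m3 + q ^+ 4 * (24 ^+ 3 * ups ^+ 2) * 8)%:E)%E.
  apply: (@ge0_expectation_le_lin2 _ _ _ _ _ (fun w => Z w ^+ 3) W).
  - by apply: measurable_funM; [exact: measurable_funX|exact: measurable_exp_sqr].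
  - exact: measurable_funX.
  - exact: mW.
  - move=> w; apply: mulr_ge0; last exact: expR_ge0.
    by rewrite (exprM _ 2 2) sqr_ge0.
  - by move=> w; apply: exprn_ge0; exact: normr_ge0.
  - by move=> w; exact: expR_ge0.
  - by apply: mulr_ge0; exact: ltW.
  - by apply: mulr_ge0; [exact: ltW|apply: mulr_ge0; [apply/exprn_ge0/ler0n|exact: ltW]].
  - move=> w; have hw := hu (X w).
    have z4 : wdot X v (X w) ^+ 4 <= q ^+ 4 * Z w ^+ 4.
      have -> : wdot X v (X w) ^+ 4 = `|wdot X v (X w)| ^+ 4.
        by rewrite (exprM _ 2 2) [RHS](exprM _ 2 2) real_normK ?num_real.
      rewrite -exprMn; apply: lerXn2r => //; rewrite nnegrE; exact: le_trans hw.
    have ez : expR (th / q ^+ 2 * wdot X v (X w) ^+ 2) <= expR (th * Z w ^+ 2).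
      rewrite ler_expR -mulrA ler_wpM2l// ler_pdivrMl ?exprn_gt0// -exprMn.
      rewrite -(real_normK (num_real (wdot X v (X w)))).
      apply: lerXn2r => //; rewrite nnegrE; exact: le_trans hw.
    have zz : 0 <= wdot X v (X w) ^+ 4 by rewrite (exprM _ 2 2) sqr_ge0.
    apply: (le_trans (ler_pM zz (expR_ge0 _) z4 ez)).
    have Z0 : 0 <= Z w by exact: normr_ge0.
    have := ler_wpM2l (ltW q4) (quartic_exp_le ups0 Z0 th0 hth).
    rewrite [Z w ^+ 2 in X in _ <= X -> _]real_normK ?num_real// -/(W w).
    move: (expR _) (W w) (24 ^+ 3) => a b c; lra.
  - exact: (third_moment_sup DM SG).
  - exact: (wdot_exp_moment DM SG).
apply: (le_trans h); rewrite lee_fin.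
have m31 : 0 <= (m3 - 1) * (q ^+ 4 * ups ^+ 2).
  by apply: mulr_ge0; [rewrite subr_ge0|apply: mulr_ge0; exact: ltW].
have : 0 <= q ^+ 4 * ups ^+ 2 by apply: mulr_ge0; exact: ltW.
move: m31; rewrite /quartic_cst; move: (q ^+ 4) (ups ^+ 2) m3 => a b m; lra.
Qed.

(** The exponent is small enough for the exponential factor to be nearly
    constant where the second moment lives, so the bound stays proportional to
    the second moment although the tails are of size [ups]. *)
Lemma wdot_sqr_exp v q : 0 < q -> norm2 v <= q ->
  (\int[P]_w (wdot X v (X w) ^+ 2 *
     expR ((quartic_cst * (ups ^+ 2 * m3))^-1 / q ^+ 2 * wdot X v (X w) ^+ 2))%:E <=
   (2 * q ^+ 2)%:E)%E.
Proof.
move=> q0 vq.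
have u2 : 0 < ups ^+ 2 by rewrite exprn_gt0.
have m30 : 0 < m3 by exact: lt_le_trans m3_1.
have c40 : 0 < quartic_cst by rewrite exprn_gt0.
have D0 : 0 < quartic_cst * (ups ^+ 2 * m3) by rewrite !mulr_gt0.
pose th := (quartic_cst * (ups ^+ 2 * m3))^-1; rewrite -/th.
have th0 : 0 < th by rewrite invr_gt0.
have q2 : 0 < q ^+ 2 by rewrite exprn_gt0.
have hth : 24 * th * ups ^+ 2 <= 1.
  rewrite mulrAC ler_pdivrMr// mul1r /quartic_cst.
  have : 0 <= (m3 - 1) * ups ^+ 2 by apply: mulr_ge0; [rewrite subr_ge0|exact: ltW].
  by move: (ups ^+ 2) u2 m3 => b b0 m; lra.
pose a := th / q ^+ 2.
have a0 : 0 < a by rewrite divr_gt0.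
have h4 := wdot_quartic_exp q0 vq (ltW th0) hth.
have : (\int[P]_w (wdot X v (X w) ^+ 2 * expR (a * wdot X v (X w) ^+ 2))%:E <=
    (1 * q ^+ 2 + a * (quartic_cst * (ups ^+ 2 * m3) * q ^+ 4))%:E)%E.
  apply: (@ge0_expectation_le_lin2 _ _ _ _ _ (fun w => wdot X v (X w) ^+ 2)
    (fun w => wdot X v (X w) ^+ 4 * expR (th / q ^+ 2 * wdot X v (X w) ^+ 2))).
  - by apply: measurable_funM; [exact: measurable_funX|exact: measurable_exp_sqr].
  - exact: measurable_funX.
  - by apply: measurable_funM; [exact: measurable_funX|exact: measurable_exp_sqr].
  - by move=> w; apply: mulr_ge0; [exact: sqr_ge0|exact: expR_ge0].
  - by move=> w; exact: sqr_ge0.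
  - by move=> w; apply: mulr_ge0; [rewrite (exprM _ 2 2) sqr_ge0|exact: expR_ge0].
  - exact: ler01.
  - exact: ltW.
  - move=> w; rewrite -/a mul1r.
    set y := wdot X v (X w) ^+ 2; have y0 : 0 <= y by exact: sqr_ge0.
    have -> : wdot X v (X w) ^+ 4 = y ^+ 2 by rewrite /y -exprM.
    by have := ler_wpM2l y0 (expR_le_mul (a * y)); lra.
  - exact: (wdot_sqr_le vq).
  - exact: h4.
move=> /le_trans; apply; rewrite lee_fin.
have -> : a * (quartic_cst * (ups ^+ 2 * m3) * q ^+ 4) = q ^+ 2.
  by rewrite /a /th; field; rewrite !gt_eqF.
by lra.
Qed.

Lemma wdot_sqr_exp_abs v lam : norm2 v <= 1 -> 0 <= lam -> lam * ups <= 1 ->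
  (\int[P]_w (wdot X v (X w) ^+ 2 * expR (2 * lam * `|wdot X v (X w)|))%:E <=
   (8 * expR 8 * ups ^+ 2 * 8)%:E)%E.
Proof.
move=> v1 lam0 hlam; have [u u1 hu] := wdot_unit X p0 v1.
pose W w := expR (wdot X u (X w) ^+ 2 / (4 * ups ^+ 2)).
have mW : measurable_fun [set: T] W.
  by apply: measurableT_comp => //; apply: measurable_funM => //; exact: measurable_funX.
have c0 : 0 <= 8 * expR 8 * ups ^+ 2.
  by apply: mulr_ge0; [apply: mulr_ge0; [exact: ler0n|exact: expR_ge0]|exact: sqr_ge0].
apply: (@ge0_expectation_le _ _ _ _ _ (fun w => 8 * expR 8 * ups ^+ 2 * W w)).
- apply: measurable_funM; first exact: measurable_funX.
  by apply: measurableT_comp => //; exact: measurable_funM.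
- exact: measurable_funM.
- by move=> w; apply: mulr_ge0; [exact: sqr_ge0|exact: expR_ge0].
- move=> w; have := hu (X w); rewrite mul1r => hw.
  have h2 : wdot X v (X w) ^+ 2 <= `|wdot X u (X w)| ^+ 2.
    by rewrite -(real_normK (num_real (wdot X v (X w)))) lerXn2r ?nnegrE.
  have he : expR (2 * lam * `|wdot X v (X w)|) <= expR (2 * lam * `|wdot X u (X w)|).
    by rewrite ler_expR ler_wpM2l// mulr_ge0.
  apply: (le_trans (ler_pM (sqr_ge0 _) (expR_ge0 _) h2 he)).
  have := sqr_exp_abs_le ups0 (normr_ge0 (wdot X u (X w))) lam0 hlam.
  by rewrite [X in expR (X / _)]real_normK ?num_real.
- rewrite ge0_expectationZ//; last by move=> w; exact: expR_ge0.
  by rewrite [leRHS]EFinM lee_wpmul2l// ?lee_fin//; exact: (wdot_exp_moment DM SG).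
Qed.

Lemma wdot_abs_le v : norm2 v <= 1 -> (\int[P]_w (`|wdot X v (X w)|)%:E <= 1%:E)%E.
Proof.
move=> v1.
have := @ge0_expectation_le_lin2 _ _ _ P (fun w => `|wdot X v (X w)|)
  (fun w => wdot X v (X w) ^+ 2) (fun=> 1) 2^-1 2^-1 1 1.
rewrite expectation_cstr => h.
have -> : (1 : R) = 2^-1 * 1 + 2^-1 * 1 by field.
apply: h => //.
- exact: measurable_funX.
- by move=> w; exact: sqr_ge0.
- move=> w; rewrite -(real_normK (num_real (wdot X v (X w)))).
  by have := sqr_ge0 (`|wdot X v (X w)| - 1); set y := `| _ |; lra.
- by have := wdot_sqr_le v1; rewrite expr1n.
Qed.

End design_moments_radius.

(** * The conditional law of the error *)

Section smoothing_measurability.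
Context {R : realType}.
Local Notation mu := (@lebesgue_measure R).
Variables (K : R -> R) (ku k1 : R).
Hypothesis KC : kernel_condition K ku.
Hypothesis K1 : kernel_moment K 1 = k1%:E.
Local Notation mR := (measurableTypeR R).

Lemma measurable_below (h : R) : measurable_fun [set: R] (below K h).
Proof.
have mF : measurable_fun [set: mR * mR]
    (fun z : mR * mR => ((z.1 + h * z.2 < 0)%R%:R * K z.2 : R)%:E).
  apply/measurable_EFinP; apply: measurable_funM.
    apply: measurable_below0; apply: measurable_funD => //.
    by apply: measurable_funM.
  exact: (measurableT_comp (kernel_measurable KC) measurable_snd).
have F0 z : (0 <= ((z.1 + h * z.2 < 0)%R%:R * K z.2 : R)%:E)%E.
  by rewrite lee_fin mulr_ge0// (kernel_ge0 KC).
have := @measurable_fun_fubini_tonelli_F _ _ mR mR R mu _ mF F0.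
exact: (measurableT_comp (fine_measurable measurableT)).
Qed.

Lemma measurable_excess (h : R) d (T : measurableType d) (g s : T -> R) :
  measurable_fun [set: T] g -> measurable_fun [set: T] s ->
  measurable_fun [set: T] (fun x => excess K h (g x) (s x)).
Proof.
move=> mg ms.
have mF : measurable_fun [set: T * mR]
    (fun z : T * mR => (knight (g z.1 + h * z.2) (s z.1) * K z.2)%:E).
  apply/measurable_EFinP; apply: measurable_funM.
    apply: measurable_knight; last exact: (measurableT_comp ms measurable_fst).
    apply: measurable_funD; first exact: (measurableT_comp mg measurable_fst).
    by apply: measurable_funM.
  exact: (measurableT_comp (kernel_measurable KC) measurable_snd).
have F0 z : (0 <= (knight (g z.1 + h * z.2) (s z.1) * K z.2)%:E)%E.
  by rewrite lee_fin mulr_ge0 ?knight_ge0// (kernel_ge0 KC).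
have := @measurable_fun_fubini_tonelli_F _ _ T mR R mu _ mF F0.
exact: (measurableT_comp (fine_measurable measurableT)).
Qed.

End smoothing_measurability.

Section conditional_law.
Context {R : realType} {d : measure_display} {T : measurableType d}.
Local Notation mu := (@lebesgue_measure R).
Local Notation mR := (measurableTypeR R).
Variables (P : probability T R) (p : nat) (X : {RV P >-> p.-tuple R}).
Variables (eps : {RV P >-> R}) (f : p.-tuple R -> R -> R) (tau flow l0 : R).
Hypothesis CP : is_cond_prob X [set w | eps w <= 0] (cst tau).
Hypothesis CD : is_cond_density X eps f.
Hypothesis DC : density_condition X f flow l0.
Local Open Scope ereal_scope.

Let mf : measurable_fun [set: p.-tuple R * R] (fun z => f z.1 z.2).
Proof. by case: CD. Qed.

Let f0 x u : (0 <= f x u)%R. Proof. by case: CD. Qed.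

Let mX : measurable_fun [set: T] X. Proof. exact: measurable_funP. Qed.
Let meps : measurable_fun [set: T] eps. Proof. exact: measurable_funP. Qed.

Let mfX : measurable_fun [set: T * mR] (fun z : T * mR => f (X z.1) z.2).
Proof.
have mz : measurable_fun [set: T * mR] (fun z : T * mR => (X z.1, z.2 : R)).
  apply/measurable_fun_pairP; split.
    exact: (measurableT_comp mX measurable_fst).
  exact: measurable_snd.
exact: (measurableT_comp mf mz).
Qed.

(** The law of [(X, eps)] is the image of the measure of density [f (X w) u]
    with respect to the product of [P] and Lebesgue measure. *)
Lemma disintegration (g : p.-tuple R * R -> \bar R) :
  measurable_fun [set: p.-tuple R * R] g -> (forall z, 0 <= g z) ->
  \int[P]_w g (X w, eps w) = \int[P]_w \int[mu]_u (g (X w, u) * (f (X w) u)%:E).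
Proof.
move=> mg g0.
have mXe : measurable_fun [set: T] (fun w => (X w, eps w)).
  by apply/measurable_fun_pairP; split.
have mXi : measurable_fun [set: T * mR] (fun z : T * mR => (X z.1, z.2 : R)).
  apply/measurable_fun_pairP; split.
    exact: (measurableT_comp mX measurable_fst).
  exact: measurable_snd.
pose m1 := image_measure P mXe.
pose D := density_measure (P \x mu)%E mfX (fun z => f0 (X z.1) z.2).
pose m2 := image_measure D mXi.
transitivity (\int[m1]_z g z); first by rewrite ge0_integral_image.
transitivity (\int[m2]_z g z); last first.
  rewrite ge0_integral_image// ge0_integral_density//; last exact: (measurableT_comp mg mXi).
  apply: (@fubini_tonelli1 _ _ T mR R P mu
    (fun z : T * mR => g (X z.1, z.2 : R) * (f (X z.1) z.2)%:E)).
  - apply: emeasurable_funM; first exact: (measurableT_comp mg mXi).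
    exact/measurable_EFinP.
  - by move=> z; rewrite mule_ge0// lee_fin.
apply: eq_measure_integral => A mA _.
pose G := [set A `*` B | A in @measurable _ (p.-tuple R) & B in @measurable _ R].
apply: (measure_unique G (fun=> setT)) => //.
- exact: measurable_prod_measurableType.
- move=> _ _ [A1 mA1 [B1 mB1 <-]] [A2 mA2 [B2 mB2 <-]].
  exists (A1 `&` A2); first exact: measurableI.
  by exists (B1 `&` B2); [exact: measurableI|rewrite setXI].
- by move=> i; exists setT => //; exists setT => //; rewrite setXTT.
- by rewrite bigcup_const.
- move=> _ [A1 mA1 [B1 mB1 <-]].
  have -> : m1 (A1 `*` B1) = P (X @^-1` A1 `&` eps @^-1` B1) by [].
  have [_ _ ->//] := CD.
  have -> : m2 (A1 `*` B1) =
      \int[(P \x mu)%E]_(z in (fun z : T * mR => (X z.1, z.2 : R)) @^-1` (A1 `*` B1))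
        (f (X z.1) z.2)%:E by [].
  rewrite [RHS]integral_mkcond fubini_tonelli1; last 2 first.
  - apply/(measurable_restrictT _ _).1 => //.
      by have := mXi measurableT _ (measurableX mA1 mB1); rewrite setTI.
    by apply: measurable_funTS; exact/measurable_EFinP.
  - by move=> z; rewrite patchE; case: ifP => // _; rewrite lee_fin.
  rewrite [LHS]integral_mkcond; apply: eq_integral => w _; rewrite /fubini_F patchE.
  case: ifPn => [Xw|Xw].
    rewrite [LHS]integral_mkcond;  apply: eq_integral => u _.
    rewrite !patchE; congr (if _ then _ else _).
    apply/idP/idP; rewrite !inE /= => //; last by case.
    by move=> Bu; split => //; move: Xw; rewrite inE.
  rewrite -[LHS](integral0 mu setT); apply: eq_integral => u _.
  rewrite patchE ifF//; apply/negP; rewrite inE /= => -[XA _].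
  by move/negP : Xw; apply; rewrite inE.
- move=> _; have -> : m1 setT = P setT by [].
  by rewrite [X in X < _](probability_setT P) ltry.
Qed.

(** Two functions of the covariate with the same integral over every event that
    the covariate determines agree almost everywhere. *)
Lemma cond_mass_ae (B : set R) (c : R) : measurable B -> (0 <= c)%R ->
  (forall A, measurable A -> P (X @^-1` A `&` eps @^-1` B) = c%:E * P (X @^-1` A)) ->
  {ae P, forall w, \int[mu]_(u in B) (f (X w) u)%:E = c%:E}.
Proof.
move=> mB c0 hA.
pose muX := image_measure P mX.
pose g x := \int[mu]_(u in B) (f x u)%:E.
have mg : measurable_fun [set: p.-tuple R] g.
  pose F (z : p.-tuple R * mR) := ((f z.1 z.2)%:E : \bar R).
  have mFB : measurable_fun [set: p.-tuple R * mR] (F \_ (setT `*` B)).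
    apply/(measurable_restrictT _ _).1; first exact: measurableX.
    by apply: measurable_funTS; exact/measurable_EFinP.
  have F0 z : 0 <= (F \_ (setT `*` B)) z.
    by rewrite patchE; case: ifP => // _; rewrite lee_fin.
  have := @measurable_fun_fubini_tonelli_F _ _ (p.-tuple R) mR R mu _ mFB F0.
  congr measurable_fun; apply/funext => x; rewrite /g [RHS]integral_mkcond.
  apply: eq_integral => u _; rewrite !patchE; congr (if _ then _ else _).
  by apply/idP/idP; rewrite !inE /= => //; case.
have : ae_eq muX setT (cst c%:E) g.
  apply: integral_ae_eq => //.
    apply/integrableP; split; first exact: measurable_cst.
    rewrite (_ : (fun x => _) = cst `|c%:E|)// integral_cst//.
    by rewrite [X in _ * X](_ : _ = P setT)// probability_setT mule1 ltry.
  move=> A _ mA; rewrite integral_cst// [in RHS]integral_mkcond.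
  rewrite ge0_integral_image; last 2 first.
  - by apply/(measurable_restrictT _ _).1 => //; exact: measurable_funTS.
  - move=> x; rewrite patchE; case: ifP => // _.
    by apply: integral_ge0 => u _; rewrite lee_fin.
  transitivity (P (X @^-1` A `&` eps @^-1` B)); first by rewrite hA.
  have [_ _ ->//] := CD.
  rewrite [LHS]integral_mkcond; apply: eq_integral => w _; rewrite !patchE.
  by congr (if _ then _ else _); apply/idP/idP; rewrite !inE.
move=> [N [mN muN sN]]; exists (X @^-1` N); split => //.
  by rewrite -[X in measurable X]setTI; exact: mX.
by move=> w /= h; apply: sN => /= h'; apply: h; rewrite -/(g (X w)) -h'.
Qed.

(** What holds for the conditional density of the error at almost every
    covariate. *)
Definition good_density (phi : R -> R) : Prop :=
  [/\ measurable_fun [set: R] phi, (forall u, (0 <= phi u)%R), (flow <= phi 0)%R,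
      (forall u v, (`|phi u - phi v| <= l0 * `|u - v|)%R) &
      \int[mu]_u (phi u)%:E = 1 /\ \int[mu]_(u in `]-oo, 0%R]) (phi u)%:E = tau%:E].

Lemma good_density_ae : (0 < tau < 1)%R -> {ae P, forall w, good_density (f (X w))}.
Proof.
move=> /andP[tau0 _].
have h1 : {ae P, forall w, \int[mu]_(u in setT) (f (X w) u)%:E = 1%:E}.
  by apply: cond_mass_ae => // A mA; rewrite preimage_setT setIT mul1e.
have h2 : {ae P, forall w, \int[mu]_(u in `]-oo, 0%R]) (f (X w) u)%:E = tau%:E}.
  apply: cond_mass_ae => //; first exact: ltW.
  move=> A mA; have [_ hP] := CP; have := hP A mA.
  rewrite -[X in _ = X -> _]/(\int[P]_(w in X @^-1` A) (cst tau%:E w)).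
  rewrite integral_cst//; last by rewrite -[X in measurable X]setTI; exact: mX.
have [_ _ h3 h4] := DC.
near=> w; split => //.
- have mp : measurable_fun [set: R] (fun u : R => (X w, u)).
    by apply/measurable_fun_pairP; split; [exact: measurable_cst|exact: measurable_id].
  exact: (measurableT_comp mf mp).
- by near: w.
- by near: w.
- by split; near: w.
Unshelve. all: by end_near. Qed.

End conditional_law.

Section interval_integrals.
Context {R : realType}.
Local Notation mu := (@lebesgue_measure R).
Local Open Scope ereal_scope.
Implicit Types (g : R -> R) (a b c : R).

Lemma integral_cst_itvcc a b c : (a <= b)%R ->
  \int[mu]_(u in `[a, b]%classic) c%:E = (c * (b - a))%:E.
Proof.
move=> ab; rewrite -[LHS]/(\int[mu]_(u in `[a, b]%classic) (cst c%:E u)) integral_cst//.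
by rewrite EFinM; congr (_ * _); exact: lebesgue_measure_itvcc.
Qed.

Lemma integral_le_itv g a b c : measurable_fun [set: R] g -> (a <= b)%R ->
  (forall u, (0 <= g u)%R) ->
  (forall u, (a <= u <= b)%R -> (g u <= c)%R) ->
  (forall u, ~~ (a <= u <= b)%R -> g u = 0%R) ->
  \int[mu]_u (g u)%:E <= (c * (b - a))%:E.
Proof.
move=> mg ab g0 gc gout.
apply: (@le_trans _ _ (\int[mu]_(u in `[a, b]%classic) c%:E)).
  rewrite [leRHS]integral_mkcond; apply: ge0_le_integral => //.
  - by move=> u _; rewrite lee_fin.
  - exact/measurable_EFinP.
  - by apply/(measurable_restrictT _ _).1.
  - move=> u _; rewrite patchE; case: ifPn => [|]; first by rewrite inE/= in_itv/= lee_fin => /gc.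
    by rewrite notin_setE/= in_itv/= => /negP /gout ->.
by rewrite integral_cst_itvcc.
Qed.

Lemma integral_ge_itv g a b c : measurable_fun [set: R] g -> (a <= b)%R ->
  (forall u, (0 <= g u)%R) -> (0 <= c)%R ->
  (forall u, (a <= u < b)%R -> (c <= g u)%R) ->
  (c * (b - a))%:E <= \int[mu]_u (g u)%:E.
Proof.
move=> mg ab g0 c0 gc.
apply: (@le_trans _ _ (\int[mu]_(u in `[a, b[%classic) c%:E)).
  rewrite -[leRHS]/(\int[mu]_(u in `[a, b[%classic) (cst c%:E u)) integral_cst//.
  rewrite EFinM; apply: lee_wpmul2l; first by rewrite lee_fin.
  rewrite [leRHS]lebesgue_measure_itv/= lte_fin; case: ltP => // ba.
  by rewrite lee_fin; lra.
rewrite [leLHS]integral_mkcond; apply: ge0_le_integral => //.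
- by move=> u _; rewrite patchE; case: ifP; rewrite ?lee_fin.
- by apply/(measurable_restrictT _ _).1.
- exact/measurable_EFinP.
- move=> u _; rewrite patchE; case: ifPn => [|]; last by rewrite lee_fin.
  by rewrite inE/= in_itv/= lee_fin => /gc.
Qed.

End interval_integrals.

Section good_density.
Context {R : realType}.
Local Notation mu := (@lebesgue_measure R).
Local Notation mR := (measurableTypeR R).
Variables (K : R -> R) (ku k1 k2 tau flow l0 h : R) (phi : R -> R).
Hypothesis KC : kernel_condition K ku.
Hypothesis K1 : kernel_moment K 1 = k1%:E.
Hypothesis K2 : kernel_moment K 2 = k2%:E.
Hypothesis G : good_density tau flow l0 phi.
Hypotheses (flow0 : 0 < flow) (l00 : 0 < l0) (h0 : 0 < h).
Local Open Scope ereal_scope.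

Let mphi : measurable_fun [set: R] phi. Proof. by case: G. Qed.
Let phi0 u : (0 <= phi u)%R. Proof. by case: G. Qed.
Let mK := kernel_measurable KC.
Let K0 := kernel_ge0 KC.

Let phi_ge u : (flow - l0 * `|u| <= phi u)%R.
Proof.
case: G => _ _ h1 h2 _; have := h2 u 0%R; rewrite subr0 => h3.
have : (phi 0 - phi u <= `|phi u - phi 0|)%R by rewrite -normrN opprB ler_norm.
by lra.
Qed.

Let phi_near0 u : (`|phi u - phi 0| <= l0 * `|u|)%R.
Proof. by case: G => _ _ _ h2 _; have := h2 u 0%R; rewrite subr0. Qed.

(** A density that is Lipschitz and large at the origin carries mass of order
    [flow ^ 2 / l0]. *)
Lemma good_flow_sqr_le : (flow ^+ 2 <= 4 * l0)%R.
Proof.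
have ab : (0 <= flow / (2 * l0))%R by rewrite divr_ge0// ?mulr_ge0// ltW.
have c0 : (0 <= flow / 2)%R by rewrite divr_ge0// ltW.
have := @integral_ge_itv R phi 0%R (flow / (2 * l0))%R (flow / 2)%R mphi ab phi0 c0.
case: G => _ _ _ _ [-> _]; rewrite lee_fin subr0 => H.
have := H _; rewrite mulf_div -expr2 ler_pdivrMr ?mulr_gt0// mul1r mulrA.
move=> H'; have -> : (4 * l0 = 2 * 2 * l0)%R by rewrite -natrM.
apply: H' => u /andP[u0 u1]; apply: le_trans (phi_ge u); rewrite ger0_norm//.
by move/ltW: u1; rewrite ler_pdivlMr ?mulr_gt0//; lra.
Qed.

Let mconv (q m : R -> R) : measurable_fun [set: R] q -> measurable_fun [set: R] m ->
  (forall a, (0 <= q a)%R) -> (forall u, (0 <= m u)%R) ->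
  measurable_fun [set: R] (fun v => \int[mu]_u (q (u + h * v) * m u)%:E).
Proof.
move=> mq mm q0 m0.
have mF : measurable_fun [set: mR * mR]
    (fun z : mR * mR => (q (z.1 + h * z.2) * m z.1)%:E).
  apply/measurable_EFinP; apply: measurable_funM.
    apply: (measurableT_comp mq); apply: measurable_funD => //.
    exact: measurable_funM.
  exact: (measurableT_comp mm measurable_fst).
have F0 z : 0 <= (q (z.1 + h * z.2) * m z.1)%:E by rewrite lee_fin mulr_ge0.
exact: (@measurable_fun_fubini_tonelli_G _ _ mR mR R mu _ mF F0).
Qed.

(** Tonelli exchanges the smoothing by the kernel with the integration against
    the density. *)
Lemma conv_swap (q m : R -> R) : measurable_fun [set: R] q -> measurable_fun [set: R] m ->
  (forall a, (0 <= q a)%R) -> (forall u, (0 <= m u)%R) ->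
  \int[mu]_u ((\int[mu]_v (q (u + h * v) * K v)%:E) * (m u)%:E) =
  \int[mu]_v ((\int[mu]_u (q (u + h * v) * m u)%:E) * (K v)%:E).
Proof.
move=> mq mm q0 m0.
have mqs : measurable_fun [set: mR * mR] (fun z : mR * mR => q (z.1 + h * z.2)%R).
  by apply: (measurableT_comp mq); apply: measurable_funD => //; exact: measurable_funM.
have mF : measurable_fun [set: mR * mR]
    (fun z : mR * mR => (q (z.1 + h * z.2) * K z.2 * m z.1)%:E).
  apply/measurable_EFinP; apply: measurable_funM.
    by apply: measurable_funM => //; exact: (measurableT_comp mK measurable_snd).
  exact: (measurableT_comp mm measurable_fst).
have F0 z : 0 <= (q (z.1 + h * z.2) * K z.2 * m z.1)%:E :> \bar R.
  by rewrite lee_fin !mulr_ge0.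
have mqu u : measurable_fun [set: R] (fun v => q (u + h * v)%R).
  by apply: (measurableT_comp mq); exact: measurable_shift.
have mqv v : measurable_fun [set: R] (fun u => q (u + h * v)%R).
  by apply: (measurableT_comp mq); exact: measurable_funD.
transitivity (\int[mu]_u \int[mu]_v (q (u + h * v) * K v * m u)%:E).
  apply: eq_integral => u _; rewrite -ge0_integralZr//.
  - by apply/measurable_EFinP; exact: (measurable_funM (mqu u) mK).
  - by move=> v _; rewrite lee_fin mulr_ge0.
  - by rewrite lee_fin.
rewrite [LHS](@fubini_tonelli _ _ mR mR R mu mu _ mF F0).
apply: eq_integral => v _; rewrite -ge0_integralZr//.
- by apply: eq_integral => u _; rewrite -EFinM mulrAC.
- by apply/measurable_EFinP; exact: (measurable_funM (mqv v) mm).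
- by move=> u _; rewrite lee_fin mulr_ge0.
- by rewrite lee_fin K0.
Qed.

Lemma kernel_integral_affine (a b c : R) : (0 <= a)%R -> (0 <= b)%R -> (0 <= c)%R ->
  \int[mu]_v ((a + b * `|v| ^+ 1 + c * `|v| ^+ 2) * K v)%:E = (a + b * k1 + c * k2)%:E.
Proof.
move=> a0 b0 c0.
have mX j : measurable_fun [set: R] (fun v : R => (`|v| ^+ j * K v)%R).
  have mX' : measurable_fun [set: R] (fun v : R => `|v| ^+ j)%R by exact: measurable_funX.
  exact: (measurable_funM mX' mK).
transitivity (\int[mu]_v (a%:E * (K v)%:E + (b%:E * (`|v| ^+ 1 * K v)%:E +
    c%:E * (`|v| ^+ 2 * K v)%:E))).
  by apply: eq_integral => v _; rewrite -!EFinM -!EFinD; congr EFin; ring.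
have p0 j v : 0 <= (`|v| ^+ j * K v)%:E by rewrite lee_fin mulr_ge0 ?exprn_ge0 ?K0.
have pK v : 0 <= (K v)%:E by rewrite lee_fin K0.
have mKE : measurable_fun [set: R] (fun v => (K v)%:E) by exact/measurable_EFinP.
have mXE j : measurable_fun [set: R] (fun v : R => (`|v| ^+ j * K v)%:E).
  by apply/measurable_EFinP; exact: mX.
have mZ (x : R) (g : R -> \bar R) : measurable_fun [set: R] g ->
    measurable_fun [set: R] (fun v => x%:E * g v).
  by move=> mg; exact: (emeasurable_funM (measurable_cst _) mg).
rewrite ge0_integralD//; first last.
- exact: (emeasurable_funD (mZ _ _ (mXE 1%N)) (mZ _ _ (mXE 2%N))).
- by move=> v _; rewrite adde_ge0// mule_ge0// lee_fin.
- exact: (mZ _ _ mKE).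
- by move=> v _; rewrite mule_ge0// lee_fin.
rewrite ge0_integralD//; first last.
- exact: (mZ _ _ (mXE 2%N)).
- by move=> v _; rewrite mule_ge0// lee_fin.
- exact: (mZ _ _ (mXE 1%N)).
- by move=> v _; rewrite mule_ge0// lee_fin.
rewrite (ge0_integralZl mu measurableT (mXE 2%N))// (ge0_integralZl mu measurableT (mXE 1%N))//.
rewrite (ge0_integralZl mu measurableT mKE)//.
have := K1; rewrite /kernel_moment => ->; have := K2; rewrite /kernel_moment => ->.
by rewrite (kernel_mass KC) mule1 -!EFinM -!EFinD addrA.
Qed.

(** The integrand is at most [|s| * flow] and vanishes outside an interval of
    length [2 * |s|]; the truncation makes the bound proportional to [flow],
    however large the density is. *)
Lemma trunc_excess_le s :
  \int[mu]_u (excess K h u s * Num.min (phi u) flow)%:E <= (2 * flow * s ^+ 2)%:E.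
Proof.
pose m u := Num.min (phi u) flow.
have mm : measurable_fun [set: R] m by exact: measurable_minr.
have m0 u : (0 <= m u)%R by rewrite /m le_min phi0 ltW.
have mk : measurable_fun [set: R] (knight^~ s) by exact: measurable_knight.
have -> : \int[mu]_u (excess K h u s * m u)%:E =
    \int[mu]_v ((\int[mu]_u (knight (u + h * v) s * m u)%:E) * (K v)%:E).
  rewrite -[RHS](conv_swap mk mm (fun a => knight_ge0 a s) m0).
  by apply: eq_integral => u _; rewrite EFinM (excessE KC K1).
have inner v : \int[mu]_u (knight (u + h * v) s * m u)%:E <= (2 * flow * s ^+ 2)%:E.
  have := @integral_le_itv R (fun u => knight (u + h * v) s * m u)%R
    (- (h * v) - `|s|)%R (- (h * v) + `|s|)%R (`|s| * flow)%R.
  have -> : (`|s| * flow * (- (h * v) + `|s| - (- (h * v) - `|s|)) = 2 * flow * s ^+ 2)%R.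
    by rewrite -(real_normK (num_real s)); ring.
  apply.
  - apply: measurable_funM => //; apply: measurable_knight => //.
    exact: measurable_funD.
  - by have := normr_ge0 s; lra.
  - by move=> u; rewrite mulr_ge0 ?knight_ge0.
  - by move=> u _; rewrite ler_pM ?knight_ge0 ?knight_le// /m ge_min lexx orbT.
  - move=> u; rewrite negb_and -!ltNge => hu; rewrite knight_supp ?mul0r//.
    by rewrite lter_normr; move: hu => /orP[hu|hu]; apply/orP; [right|left]; lra.
apply: (@le_trans _ _ (\int[mu]_v ((2 * flow * s ^+ 2)%:E * (K v)%:E))).
  apply: ge0_le_integral => //.
  - move=> v _; apply: mule_ge0; last by rewrite lee_fin K0.
    by apply: integral_ge0 => u _; rewrite lee_fin mulr_ge0 ?knight_ge0.
  - apply: emeasurable_funM; last exact/measurable_EFinP.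
    exact: (mconv mk mm (fun a => knight_ge0 a s) m0).
  - by apply: emeasurable_funM => //; exact/measurable_EFinP.
  - by move=> v _; rewrite lee_wpmul2r// lee_fin K0.
have c0 : 0 <= (2 * flow * s ^+ 2)%:E.
  by rewrite lee_fin mulr_ge0 ?sqr_ge0// mulr_ge0// ltW.
rewrite ge0_integralZl//; first by rewrite (kernel_mass KC) mule1.
- exact/measurable_EFinP.
- by move=> v _; rewrite lee_fin K0.
Qed.

(** For each shift [v] of the kernel, the excess is at least [|s| / 2] on an
    interval of length [|s| / 4] within [|s| + h * |v|] of the origin, and there
    the truncated density is at least [flow - l0 * (|s| + h * |v|)]. *)
Lemma trunc_excess_ge s :
  (flow * s ^+ 2 / 8)%:E <=
  \int[mu]_u (excess K h u s * Num.min (phi u) flow)%:E +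
  (l0 * `|s| * s ^+ 2 / 8 + l0 * h * s ^+ 2 / 8 * k1)%:E.
Proof.
pose m u := Num.min (phi u) flow.
have mm : measurable_fun [set: R] m by exact: measurable_minr.
have m0 u : (0 <= m u)%R by rewrite /m le_min phi0 ltW.
have mk : measurable_fun [set: R] (knight^~ s) by exact: measurable_knight.
pose I v := \int[mu]_u (knight (u + h * v) s * m u)%:E.
have -> : \int[mu]_u (excess K h u s * m u)%:E = \int[mu]_v (I v * (K v)%:E).
  rewrite -[RHS](conv_swap mk mm (fun a => knight_ge0 a s) m0).
  by apply: eq_integral => u _; rewrite EFinM (excessE KC K1).
have I0 v : 0 <= I v.
  by apply: integral_ge0 => u _; rewrite lee_fin mulr_ge0 ?knight_ge0.
have inner v : ((flow - l0 * (`|s| + h * `|v|)) * s ^+ 2 / 8)%:E <= I v.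
  have [k0|k0] := leP (flow - l0 * (`|s| + h * `|v|))%R 0%R.
    apply: le_trans (I0 v); rewrite lee_fin -mulrA mulr_le0_ge0//.
    by rewrite divr_ge0// sqr_ge0.
  have := @integral_ge_itv R (fun u => knight (u + h * v) s * m u)%R
    (- (h * v) + 3 / 8 * s - `|s| / 8)%R (- (h * v) + 3 / 8 * s + `|s| / 8)%R
    (`|s| / 2 * (flow - l0 * (`|s| + h * `|v|)))%R.
  have -> : (`|s| / 2 * (flow - l0 * (`|s| + h * `|v|)) *
     (- (h * v) + 3 / 8 * s + `|s| / 8 - (- (h * v) + 3 / 8 * s - `|s| / 8)) =
     (flow - l0 * (`|s| + h * `|v|)) * s ^+ 2 / 8)%R.
    by rewrite -[in RHS](real_normK (num_real s)); field.
  have s0 := normr_ge0 s.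
  apply.
  - apply: measurable_funM => //; apply: measurable_knight => //.
    exact: measurable_funD.
  - by lra.
  - by move=> u; rewrite mulr_ge0 ?knight_ge0.
  - by apply: mulr_ge0; [lra|exact: ltW].
  - move=> u /andP[u1 u2]; apply: ler_pM; [lra|exact: ltW| |].
      by apply: knight_ge; rewrite ler_norml; apply/andP; split; lra.
    have su : (`|u| <= `|s| + h * `|v|)%R.
      have sle := ler_norm s; have sge : (- s <= `|s|)%R by rewrite -normrN ler_norm.
      have vle : (h * v <= h * `|v|)%R by apply: ler_wpM2l; [exact: ltW|exact: ler_norm].
      have vge : (- (h * v) <= h * `|v|)%R.
        by rewrite -mulrN; apply: ler_wpM2l; [exact: ltW|rewrite -normrN ler_norm].
      by rewrite ler_norml; apply/andP; split; lra.
    have hv0 : (0 <= l0 * (`|s| + h * `|v|))%R.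
      by apply: mulr_ge0; [exact: ltW|apply: addr_ge0 => //; apply: mulr_ge0 => //; exact: ltW].
    rewrite /m le_min; apply/andP; split; last by rewrite gerBl.
    apply: le_trans (phi_ge u); rewrite lerD2l lerN2.
    by apply: ler_wpM2l => //; exact: ltW.
have mI : measurable_fun [set: R] I by exact: (mconv mk mm (fun a => knight_ge0 a s) m0).
pose J v : R :=
  ((l0 * `|s| * s ^+ 2 / 8 + l0 * h * s ^+ 2 / 8 * `|v| ^+ 1 + 0 * `|v| ^+ 2) * K v)%R.
have ca : (0 <= l0 * `|s| * s ^+ 2 / 8)%R.
  by rewrite divr_ge0// mulr_ge0 ?sqr_ge0// mulr_ge0// ltW.
have cb : (0 <= l0 * h * s ^+ 2 / 8)%R.
  by rewrite divr_ge0// mulr_ge0 ?sqr_ge0// mulr_ge0// ltW.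
have cc : (0 <= flow * s ^+ 2 / 8)%R.
  by rewrite divr_ge0// mulr_ge0 ?sqr_ge0// ltW.
have J0 v : (0 <= J v)%R.
  by rewrite /J mulr_ge0 ?K0// mul0r addr0 addr_ge0// mulr_ge0.
have mJ : measurable_fun [set: R] J.
  have mJ1 : measurable_fun [set: R] (fun v : R => l0 * `|s| * s ^+ 2 / 8 +
      l0 * h * s ^+ 2 / 8 * `|v| ^+ 1 + 0 * `|v| ^+ 2)%R.
    apply: measurable_funD; [apply: measurable_funD => //|]; apply: measurable_funM => //;
      exact: measurable_funX.
  exact: (measurable_funM mJ1 mK).
have EJ : \int[mu]_v (J v)%:E = (l0 * `|s| * s ^+ 2 / 8 + l0 * h * s ^+ 2 / 8 * k1)%:E.
  by rewrite (kernel_integral_affine ca cb (lexx 0%R)) mul0r addr0.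
rewrite -EJ -ge0_integralD//; first last.
- exact/measurable_EFinP.
- by move=> v _; rewrite lee_fin.
- by apply: emeasurable_funM => //; exact/measurable_EFinP.
- by move=> v _; rewrite mule_ge0// lee_fin K0.
have -> : (flow * s ^+ 2 / 8)%:E = \int[mu]_v ((flow * s ^+ 2 / 8)%:E * (K v)%:E).
  rewrite ge0_integralZl//; first by rewrite (kernel_mass KC) mule1.
  - exact/measurable_EFinP.
  - by move=> v _; rewrite lee_fin K0.
apply: ge0_le_integral => //.
- by move=> v _; rewrite mule_ge0// lee_fin K0.
- by apply: emeasurable_funM => //; exact/measurable_EFinP.
- apply: emeasurable_funD; last exact/measurable_EFinP.
  by apply: emeasurable_funM => //; exact/measurable_EFinP.
- move=> v _; have := lee_wpmul2r (_ : 0 <= (K v)%:E) (inner v).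
  rewrite lee_fin K0 => /(_ isT) H.
  apply: le_trans (leeD2r _ H); rewrite -!EFinM -EFinD lee_fin le_eqVlt.
  by apply/orP; left; apply/eqP; rewrite /J; ring.
Qed.

(* The distribution function of the density. *)
Let Phi c := \int[mu]_u ((u < c)%R%:R * phi u)%:E.

Let mlt (a : R) : measurable_fun [set: R] (fun u : R => (u < a)%R%:R : R).
Proof.
have := @measurable_below0 R _ mR (fun u : R => u - a)%R
  (measurable_funB (@measurable_id _ _ _) (measurable_cst a)).
by congr measurable_fun; apply/funext => u; rewrite subr_lt0.
Qed.

Let Phi0 : Phi 0%R = tau%:E.
Proof.
case: G => _ _ _ _ [_ <-].
rewrite -integral_itv_bndo_bndc; last first.
  exact/measurable_funTS/measurable_EFinP.
rewrite [RHS]integral_mkcond; apply: eq_integral => u _.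
rewrite patchE; case: ifPn => [|].
  by rewrite inE/= in_itv/= => ->; rewrite mul1r.
by rewrite notin_setE/= in_itv/= => /negP/negbTE ->; rewrite mul0r.
Qed.

Let mstrip a b : measurable_fun [set: R] (fun u : R => (a <= u < b)%R%:R * phi u)%R.
Proof.
have -> : (fun u : R => (a <= u < b)%R%:R * phi u)%R =
    (fun u => (u < b)%R%:R * (1 - (u < a)%R%:R) * phi u)%R.
  apply/funext => u; rewrite leNgt; case: (u < a)%R; case: (u < b)%R => /=;
  by rewrite ?subrr ?subr0 ?mulr0 ?mulr1 ?mul0r.
have m1 : measurable_fun [set: R] (fun u : R => (u < b)%R%:R * (1 - (u < a)%R%:R) : R)%R.
  by apply: measurable_funM => //; exact: measurable_funB.
exact: (measurable_funM m1 mphi).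
Qed.

Let PhiD a b : (a <= b)%R ->
  Phi b = Phi a + \int[mu]_u ((a <= u < b)%R%:R * phi u)%:E.
Proof.
move=> ab.
rewrite -ge0_integralD//; first last.
- by apply/measurable_EFinP; exact: mstrip.
- by move=> u _; rewrite lee_fin mulr_ge0.
- by apply/measurable_EFinP; exact: (measurable_funM (mlt a) mphi).
- by move=> u _; rewrite lee_fin mulr_ge0.
apply: eq_integral => u _; rewrite -EFinD -mulrDl; congr ((_ * _)%:E).
rewrite leNgt; case: (ltP u a) => ua /=; last by rewrite add0r.
by rewrite (lt_le_trans ua ab) addr0.
Qed.

Let strip_le a b y : (0 <= y)%R -> (b - a = y)%R -> (- y <= a)%R -> (b <= y)%R ->
  \int[mu]_u ((a <= u < b)%R%:R * phi u)%:E <= ((phi 0 + l0 * y) * y)%:E.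
Proof.
move=> y0 aby ya yb.
have := @integral_le_itv R _ a b (phi 0 + l0 * y)%R (mstrip a b); rewrite aby; apply.
- by rewrite -subr_ge0 aby.
- by move=> u; rewrite mulr_ge0.
- move=> u /andP[au ub].
  have uy : (`|u| <= y)%R by rewrite ler_norml; apply/andP; split; lra.
  have h1 : (phi u <= phi 0 + l0 * y)%R.
    have := phi_near0 u; have := ler_norm (phi u - phi 0).
    have := ler_wpM2l (ltW l00) uy; lra.
  by case: (_ && _); rewrite ?mul1r// mul0r (le_trans (phi0 u)).
- move=> u; case: andP => //= abu _; case: andP => [[au /ltW ub]|_]; last by rewrite mul0r.
  by exfalso; apply: abu.
Qed.

Let strip_ge a b y : (0 <= y)%R -> (b - a = y)%R -> (- y <= a)%R -> (b <= y)%R ->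
  ((phi 0 - l0 * y) * y)%:E <= \int[mu]_u ((a <= u < b)%R%:R * phi u)%:E.
Proof.
move=> y0 aby ya yb.
have [k0|k0] := leP (phi 0 - l0 * y)%R 0%R.
  apply: (@le_trans _ _ 0); first by rewrite lee_fin mulr_le0_ge0.
  by apply: integral_ge0 => u _; rewrite lee_fin mulr_ge0.
have := @integral_ge_itv R _ a b (phi 0 - l0 * y)%R (mstrip a b); rewrite aby; apply.
- by rewrite -subr_ge0 aby.
- by move=> u; rewrite mulr_ge0.
- exact: ltW.
- move=> u abu; rewrite abu mul1r; case/andP : abu => au ub.
  have uy : (`|u| <= y)%R by rewrite ler_norml; apply/andP; split; lra.
  have := phi_near0 u; have := ler_norm (phi 0 - phi u); rewrite distrC.
  have := ler_wpM2l (ltW l00) uy; lra.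
Qed.

Let Phi_ge0 c : 0 <= Phi c.
Proof. by apply: integral_ge0 => u _; rewrite lee_fin mulr_ge0. Qed.

(** Mass to the left of [y] and of [- y]: the two strips next to the origin
    have nearly the same mass, because the density is Lipschitz. *)
Lemma two_sided_mass y :
  Phi y + Phi (- y)%R <= (2 * tau + 2 * l0 * y ^+ 2)%:E /\
  (2 * tau)%:E <= Phi y + Phi (- y)%R + (2 * l0 * y ^+ 2)%:E.
Proof.
wlog y0 : y / (0 <= y)%R.
  move=> H; have [y0|y0] := leP 0%R y; first exact: H.
  by have := H (- y)%R; rewrite opprK sqrrN addeC oppr_ge0 => /(_ (ltW y0)).
have Ny0 : (- y <= 0)%R by rewrite oppr_le0.
have := PhiD y0; have := PhiD Ny0; rewrite Phi0.
have yE : (y - 0 = y)%R by rewrite subr0.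
have yE' : (0 - - y = y)%R by rewrite sub0r opprK.
have Nyy : (- y <= 0 :> R)%R by lra.
have := strip_le y0 yE Nyy (lexx y); have := strip_ge y0 yE Nyy (lexx y).
have := strip_le y0 yE' (lexx _) y0; have := strip_ge y0 yE' (lexx _) y0.
have I0 a b : 0 <= \int[mu]_u ((a <= u < b)%R%:R * phi u)%:E.
  by apply: integral_ge0 => u _; rewrite lee_fin mulr_ge0.
have := I0 0%R y; have := I0 (- y)%R 0%R; have := Phi_ge0 (- y)%R.
move: (\int[mu]_u _) (\int[mu]_u _) (Phi (- y)%R) (Phi y) => I J A B.
case: I => [I| |]; case: J => [J| |]; case: A => [A| |] //; case: B => [B| |] //;
  rewrite ?lee_fin -?EFinD ?lee_fin => //.
move=> A0 J0 I0' h1 h2 h3 h4 [h5] [h6]; split; nra.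
Qed.

(** The smoothing bias is of order [h ^ 2]: by the symmetry of the kernel only
    the two-sided masses enter. *)
Lemma below_mean :
  \int[mu]_u (below K h u * phi u)%:E <= (tau + l0 * k2 * h ^+ 2)%:E /\
  tau%:E <= \int[mu]_u (below K h u * phi u)%:E + (l0 * k2 * h ^+ 2)%:E.
Proof.
pose q (a : R) : R := (a < 0)%R%:R.
have mq : measurable_fun [set: R] q by exact: measurable_below0.
have q0 a : (0 <= q a)%R by rewrite /q.
set S := \int[mu]_u _.
pose I v := Phi (- (h * v)%R)%R.
have SE : S = \int[mu]_v (I v * (K v)%:E).
  transitivity (\int[mu]_v ((\int[mu]_u (q (u + h * v) * phi u)%:E) * (K v)%:E)).
    rewrite -[RHS](conv_swap mq mphi q0 phi0).
    by apply: eq_integral => u _; rewrite EFinM (belowE KC K1).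
  apply: eq_integral => v _; congr (_ * _); apply: eq_integral => u _.
  by rewrite /q -ltrBrDr sub0r.
have mI : measurable_fun [set: R] I.
  have := mconv mq mphi q0 phi0.
  congr measurable_fun; apply/funext => v; apply: eq_integral => u _.
  by rewrite /q/= -ltrBrDr sub0r.
have mKE : measurable_fun [set: R] (fun v => (K v)%:E) by exact/measurable_EFinP.
have mIK : measurable_fun [set: R] (fun v => I v * (K v)%:E) by exact: emeasurable_funM.
have IK0 v : 0 <= I v * (K v)%:E by apply: mule_ge0; [exact: Phi_ge0|rewrite lee_fin K0].
have mIN : measurable_fun [set: R] (fun v : R => I (- v)%R).
  exact: (measurableT_comp mI (@oppr_measurable R setT)).
have IKN0 v : 0 <= I (- v)%R * (K v)%:E by apply: mule_ge0; [exact: Phi_ge0|rewrite lee_fin K0].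
have SE' : S = \int[mu]_v (I (- v)%R * (K v)%:E).
  rewrite SE (ge0_integralN mIK IK0); apply: eq_integral => v _.
  by rewrite (kernel_even KC).
have mIKN : measurable_fun [set: R] (fun v => I (- v)%R * (K v)%:E) by exact: emeasurable_funM.
have SS : S + S = \int[mu]_v ((I v + I (- v)%R) * (K v)%:E).
  rewrite {1}SE SE' -ge0_integralD//.
  by apply: eq_integral => v _; apply/esym/ge0_muleDl; exact: Phi_ge0.
have bd v : I v + I (- v)%R <= (2 * tau + 2 * l0 * (h * v) ^+ 2)%:E /\
    (2 * tau)%:E <= I v + I (- v)%R + (2 * l0 * (h * v) ^+ 2)%:E.
  by rewrite /I mulrN opprK addeC; exact: two_sided_mass.
have S0 : 0 <= S by rewrite SE; apply: integral_ge0.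
have tau0 : (0 <= tau)%R.
  by have := Phi_ge0 0%R; rewrite Phi0 lee_fin.
have c0 : (0 <= 2 * l0 * h ^+ 2)%R.
  by apply: mulr_ge0; [apply: mulr_ge0 => //; exact: ltW|exact: sqr_ge0].
have t20 : (0 <= 2 * tau)%R by rewrite mulr_ge0.
have mquad (a : R) : measurable_fun [set: R]
    (fun v : R => (a + 0 * `|v| ^+ 1 + 2 * l0 * h ^+ 2 * `|v| ^+ 2) * K v)%R.
  have m1 : measurable_fun [set: R] 
      (fun v : R => a + 0 * `|v| ^+ 1 + 2 * l0 * h ^+ 2 * `|v| ^+ 2)%R.
    apply: measurable_funD; [apply: measurable_funD => //|]; apply: measurable_funM => //;
      exact: measurable_funX.
  exact: (measurable_funM m1 mK).
have quadE (a : R) v : ((a + 0 * `|v| ^+ 1 + 2 * l0 * h ^+ 2 * `|v| ^+ 2) =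
    a + 2 * l0 * (h * v) ^+ 2)%R.
  by rewrite real_normK ?num_real//; ring.
have quad0 (a : R) v : (0 <= a)%R ->
    0 <= ((a + 0 * `|v| ^+ 1 + 2 * l0 * h ^+ 2 * `|v| ^+ 2) * K v)%:E.
  move=> a0; rewrite lee_fin; apply: mulr_ge0; last exact: K0.
  by rewrite mul0r addr0; apply: addr_ge0 => //; apply: mulr_ge0 => //.
have mII : measurable_fun [set: R] (fun v => (I v + I (- v)%R) * (K v)%:E).
  by apply: emeasurable_funM => //; exact: emeasurable_funD.
have II0 v : 0 <= (I v + I (- v)%R) * (K v)%:E.
  apply: mule_ge0; last by rewrite lee_fin K0.
  by apply: adde_ge0; exact: Phi_ge0.
have up : S + S <= (2 * tau + 2 * l0 * h ^+ 2 * k2)%:E.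
  have -> : (2 * tau + 2 * l0 * h ^+ 2 * k2)%:E =
      \int[mu]_v ((2 * tau + 0 * `|v| ^+ 1 + 2 * l0 * h ^+ 2 * `|v| ^+ 2) * K v)%:E.
    by rewrite (kernel_integral_affine t20 (lexx _) c0) mul0r addr0.
  rewrite SS; apply: ge0_le_integral => //.
  - by apply/measurable_EFinP; exact: mquad.
  - move=> v _; rewrite quadE EFinM; apply: lee_wpmul2r; first by rewrite lee_fin K0.
    by case: (bd v).
have lo : (2 * tau)%:E <= S + S + (2 * l0 * h ^+ 2 * k2)%:E.
  have -> : (2 * tau)%:E = \int[mu]_v ((2 * tau + 0 * `|v| ^+ 1 + 0 * `|v| ^+ 2) * K v)%:E.
    by rewrite (kernel_integral_affine t20 (lexx _) (lexx _)) !mul0r !addr0.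
  have -> : (2 * l0 * h ^+ 2 * k2)%:E =
      \int[mu]_v ((0 + 0 * `|v| ^+ 1 + 2 * l0 * h ^+ 2 * `|v| ^+ 2) * K v)%:E.
    by rewrite (kernel_integral_affine (lexx _) (lexx _) c0) mul0r addr0 add0r.
  rewrite SS -ge0_integralD//; first last.
  - by apply/measurable_EFinP; exact: mquad.
  - by move=> v _; exact: quad0.
  apply: ge0_le_integral => //.
  - by move=> v _; rewrite !mul0r !addr0 lee_fin mulr_ge0 ?K0.
  - under eq_fun do rewrite !mul0r !addr0.
    by apply/measurable_EFinP; exact: (measurable_funM (measurable_cst _) mK).
  - by apply: emeasurable_funD => //; apply/measurable_EFinP; exact: mquad.
  - move=> v _; rewrite !mul0r !addr0 add0r exprnP.
    have Kv0 : 0 <= (K v)%:E by rewrite lee_fin K0.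
    have := lee_wpmul2r Kv0 (proj2 (bd v)).
    have II0' : 0 <= I v + I (- v)%R by apply: adde_ge0; exact: Phi_ge0.
    have q0' : 0 <= (2 * l0 * (h * v) ^+ 2)%:E.
      rewrite lee_fin; apply: mulr_ge0; last exact: sqr_ge0.
      by apply: mulr_ge0 => //; exact: ltW.
    rewrite [X in _ <= X -> _](ge0_muleDl _ II0' q0').
    rewrite -!EFinM -exprnP real_normK ?num_real// => /le_trans; apply.
    by rewrite exprMn mulrA.
move: S S0 up lo {SE SE' SS} => [S| |] //= S0; rewrite -?EFinD ?lee_fin => up lo.
by split; lra.
Qed.

End good_density.

(** * Moment generating functions of the score and of the curvature *)

Section kernel_constants.
Context {R : realType}.
Variables (K : R -> R) (ku : R).
Hypothesis KC : kernel_condition K ku.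

Lemma kernel_sup_gt0 : 0 < ku.
Proof.
rewrite ltNge; apply/negP => ku0; have := kernel_mass KC.
rewrite (eq_integral (fun=> 0%E)); last first.
  move=> u _; congr EFin; apply/eqP; rewrite eq_le (kernel_ge0 KC) andbT.
  exact: le_trans (kernel_le KC u) ku0.
by rewrite integral0 => /eqP; rewrite eq_sym onee_eq0.
Qed.

Lemma kernel_moment_ge0 (k : R) m : kernel_moment K m = k%:E -> 0 <= k.
Proof.
move=> Km; rewrite -lee_fin -Km; apply: integral_ge0 => u _.
by rewrite lee_fin mulr_ge0 ?exprn_ge0 ?(kernel_ge0 KC).
Qed.

End kernel_constants.

Section mgf.
Context {R : realType} {d : measure_display} {T : measurableType d}.
Local Notation mu := (@lebesgue_measure R).
Local Notation mR := (measurableTypeR R).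
Variables (P : probability T R) (p : nat) (X : {RV P >-> p.-tuple R}).
Variables (eps : {RV P >-> R}) (f : p.-tuple R -> R -> R) (tau flow l0 ups : R).
Variables (K : R -> R) (ku k1 k2 h : R).
Hypotheses (p0 : (0 < p)%N) (htau : 0 < tau < 1) (h0 : 0 < h).
Hypothesis KC : kernel_condition K ku.
Hypothesis K1 : kernel_moment K 1 = k1%:E.
Hypothesis K2 : kernel_moment K 2 = k2%:E.
Hypothesis DM : design_moments X.
Hypothesis SG : subgaussian_design X ups.
Hypothesis CP : is_cond_prob X [set w | eps w <= 0] (cst tau).
Hypothesis CD : is_cond_density X eps f.
Hypothesis DC : density_condition X f flow l0.

Local Notation m3 := (third_moment X).

Let flow0 : 0 < flow. Proof. by case: DC. Qed.
Let l00 : 0 < l0. Proof. by case: DC. Qed.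
Let ups0 : 0 < ups. Proof. by case: SG. Qed.

Let mf : measurable_fun [set: p.-tuple R * R] (fun z => f z.1 z.2).
Proof. by case: CD. Qed.

Let f0 x u : 0 <= f x u. Proof. by case: CD. Qed.

Let mX : measurable_fun [set: T] X. Proof. exact: measurable_funP. Qed.

Let good := good_density tau flow l0.

Lemma good_ae : {ae P, forall w, good (f (X w))}.
Proof. exact: (good_density_ae CP CD DC). Qed.

Lemma flow_sqr_le : flow ^+ 2 <= 4 * l0.
Proof.
have [N [mN PN sN]] := good_ae.
have [w wN] : exists w, ~ N w.
  apply: contrapT => /forallNP hN.
  have NT : N = setT by apply/seteqP; split => // w _; exact: contrapT (hN w).
  by move: PN; rewrite NT probability_setT => /eqP; rewrite onee_eq0.
have gw : good (f (X w)) by apply: contrapT => ng; apply: wN; exact: sN.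
exact: (good_flow_sqr_le gw flow0 l00).
Qed.

(** The derivative of the smoothed loss in the direction [v], up to sign, as a
    function of the covariate and of the error. *)
Definition score (v : 'cV[R]_p) (z : p.-tuple R * R) : R :=
  (tau - below K h z.2) * wdot X v z.1.

(** Thinning by this factor replaces the conditional density of the error by
    its minimum with [flow]. *)
Definition thin (z : p.-tuple R * R) : R := flow / Num.max (f z.1 z.2) flow.

(** A lower bound on the nonlinear part of the increment of the loss, whose
    conditional mean is comparable to [flow] times the square of [wdot v]. *)
Definition curv (v : 'cV[R]_p) (z : p.-tuple R * R) : R :=
  thin z * excess K h z.2 (wdot X v z.1).

Lemma thin_gt0 z : 0 < thin z.
Proof. by rewrite /thin divr_gt0// lt_max flow0 orbT. Qed.

Lemma thin_le1 z : thin z <= 1.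
Proof. by rewrite /thin ler_pdivrMr ?mul1r ?lt_max ?flow0 ?orbT// le_max lexx orbT. Qed.

Lemma thinM x u : thin (x, u) * f x u = Num.min (f x u) flow.
Proof.
rewrite /thin /=; case: (leP (f x u) flow) => hf.
  by rewrite divff ?mul1r// gt_eqF.
by rewrite divfK// gt_eqF// (lt_trans flow0).
Qed.

Lemma measurable_score v : measurable_fun [set: p.-tuple R * R] (score v).
Proof.
apply: measurable_funM; last exact: (measurableT_comp (measurable_wdot DM v) measurable_fst).
apply: measurable_funB => //.
exact: (measurableT_comp (measurable_below KC h) measurable_snd).
Qed.

Lemma measurable_thin : measurable_fun [set: p.-tuple R * R] thin.
Proof.
have -> : thin = fun z => flow * (Num.max (f z.1 z.2) flow) `^ (-1).
  apply/funext => z; rewrite powR_inv1//.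
  by rewrite le_max (ltW flow0) orbT.
apply: measurable_funM => //.
have mM : measurable_fun [set: p.-tuple R * R] (fun z => Num.max (f z.1 z.2) flow).
  exact: measurable_maxr.
exact: (measurableT_comp (measurable_powR (-1)) mM).
Qed.

Lemma measurable_curv v : measurable_fun [set: p.-tuple R * R] (curv v).
Proof.
apply: measurable_funM; first exact: measurable_thin.
have ms : measurable_fun [set: p.-tuple R * R] (fun z => wdot X v z.1).
  exact: (measurableT_comp (measurable_wdot DM v) measurable_fst).
have me : measurable_fun [set: p.-tuple R * R] (fun z => z.2) by exact: measurable_snd.
exact: (measurable_excess KC h me ms).
Qed.

Lemma curv_ge0 v z : 0 <= curv v z.
Proof. by apply: mulr_ge0; [exact/ltW/thin_gt0|exact: (excess_ge0 KC)]. Qed.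

Lemma curv_le v z : curv v z <= 2 * ku / h * wdot X v z.1 ^+ 2.
Proof.
apply: (le_trans _ (excess_le_sqr KC K1 z.2 (wdot X v z.1) h0)).
by rewrite /curv ler_piMl ?thin_le1//; exact: (excess_ge0 KC).
Qed.

Let mcond (g : p.-tuple R * R -> R) :
  measurable_fun [set: p.-tuple R * R] g -> (forall z, 0 <= g z) ->
  measurable_fun [set: T] (fun w => \int[mu]_u (g (X w, u) * f (X w) u)%:E)%E.
Proof.
move=> mg g0.
have mz : measurable_fun [set: T * mR] (fun z : T * mR => (X z.1, z.2 : R)).
  apply/measurable_fun_pairP; split; last exact: measurable_snd.
  exact: (measurableT_comp mX measurable_fst).
have mF : measurable_fun [set: T * mR]
    (fun z : T * mR => (g (X z.1, z.2 : R) * f (X z.1) z.2)%:E).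
  apply/measurable_EFinP; apply: measurable_funM.
    exact: (measurableT_comp mg mz).
  exact: (measurableT_comp mf mz).
have F0 (z : T * mR) : (0 <= (g (X z.1, z.2 : R) * f (X z.1) z.2)%:E)%E.
  by rewrite lee_fin mulr_ge0.
exact: (@measurable_fun_fubini_tonelli_F _ _ T mR R mu _ mF F0).
Qed.

Let disint (g : p.-tuple R * R -> R) :
  measurable_fun [set: p.-tuple R * R] g -> (forall z, 0 <= g z) ->
  (\int[P]_w (g (X w, eps w))%:E =
   \int[P]_w \int[mu]_u (g (X w, u) * f (X w) u)%:E)%E.
Proof.
move=> mg g0; rewrite (disintegration CD (g := EFin \o g)).
- by apply: eq_integral => w _; apply: eq_integral => u _.
- exact/measurable_EFinP.
- by move=> z; rewrite lee_fin.
Qed.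

(** Conditional bounds for almost every covariate integrate to bounds on
    expectations. *)
Lemma cond_leD (g : p.-tuple R * R -> R) (B C : T -> R) :
  measurable_fun [set: p.-tuple R * R] g -> (forall z, 0 <= g z) ->
  measurable_fun [set: T] B -> (forall w, 0 <= B w) ->
  measurable_fun [set: T] C -> (forall w, 0 <= C w) ->
  (forall w, good (f (X w)) ->
     (\int[mu]_u (g (X w, u) * f (X w) u)%:E + (B w)%:E <= (C w)%:E)%E) ->
  (\int[P]_w (g (X w, eps w))%:E + \int[P]_w (B w)%:E <= \int[P]_w (C w)%:E)%E.
Proof.
move=> mg g0 mB B0 mC C0 hB; rewrite disint// -ge0_integralD//; last 4 first.
- by move=> w _; apply: integral_ge0 => u _; rewrite lee_fin mulr_ge0.
- exact: mcond.
- by move=> w _; rewrite lee_fin.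
- exact/measurable_EFinP.
apply: ae_ge0_le_integral => //.
- move=> w _; apply: adde_ge0; last by rewrite lee_fin.
  by apply: integral_ge0 => u _; rewrite lee_fin mulr_ge0.
- by apply: emeasurable_funD; [exact: mcond|exact/measurable_EFinP].
- by move=> w _; rewrite lee_fin.
- exact/measurable_EFinP.
- near=> w => _; apply: hB; near: w; exact: good_ae.
Unshelve. all: end_near. Qed.

Lemma cond_le (g : p.-tuple R * R -> R) (C : T -> R) :
  measurable_fun [set: p.-tuple R * R] g -> (forall z, 0 <= g z) ->
  measurable_fun [set: T] C -> (forall w, 0 <= C w) ->
  (forall w, good (f (X w)) ->
     (\int[mu]_u (g (X w, u) * f (X w) u)%:E <= (C w)%:E)%E) ->
  (\int[P]_w (g (X w, eps w))%:E <= \int[P]_w (C w)%:E)%E.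
Proof.
move=> mg g0 mC C0 hC.
have := @cond_leD g (fun=> 0) C mg g0 (measurable_cst _) (fun=> lexx 0) mC C0.
by rewrite expectation_cstr adde0; apply => w gw; rewrite adde0; exact: hC.
Qed.

Let mz v : measurable_fun [set: T] (fun w => wdot X v (X w)).
Proof. exact: (measurable_wdotX DM). Qed.

Let mslice (g : p.-tuple R * R -> R) x : measurable_fun [set: p.-tuple R * R] g ->
  measurable_fun [set: R] (fun u => g (x, u)).
Proof.
move=> mg; have mx : measurable_fun [set: mR] (fun u : mR => (x, u : R)).
  by apply/measurable_fun_pairP; split; [exact: measurable_cst|exact: measurable_id].
exact: (measurableT_comp mg mx).
Qed.

Let good_measurable phi : good phi -> measurable_fun [set: R] phi.
Proof. by case. Qed.

Let good_ge0 phi u : good phi -> 0 <= phi u.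
Proof. by case. Qed.

Let good_mass phi : good phi -> (\int[mu]_u (phi u)%:E = 1)%E.
Proof. by case=> _ _ _ _ []. Qed.

(* Pointwise affine inequalities between g1 and g2 integrate against the density
   phi; all terms are kept nonnegative, since the integrals may be infinite. *)
Let good_linear phi (g1 g2 : R -> R) (a a' c c' : R) : good phi ->
  measurable_fun [set: R] g1 -> measurable_fun [set: R] g2 ->
  (forall u, 0 <= g1 u) -> (forall u, 0 <= g2 u) ->
  0 <= a -> 0 <= a' -> 0 <= c -> 0 <= c' ->
  (forall u, g1 u + a * g2 u + c <= c' + a' * g2 u) ->
  (\int[mu]_u (g1 u * phi u)%:E + a%:E * \int[mu]_u (g2 u * phi u)%:E + c%:E <=
   c'%:E + a'%:E * \int[mu]_u (g2 u * phi u)%:E)%E.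
Proof.
move=> gp m1 m2 g10 g20 a0 a0' c0 c0' H.
have mp := good_measurable gp; have pp u : 0 <= phi u by exact: good_ge0.
have M1 : measurable_fun [set: R] (fun u => (g1 u * phi u)%:E).
  by apply/measurable_EFinP; exact: (measurable_funM m1 mp).
have M2 : measurable_fun [set: R] (fun u => (g2 u * phi u)%:E).
  by apply/measurable_EFinP; exact: (measurable_funM m2 mp).
have MP : measurable_fun [set: R] (fun u => (phi u)%:E) by exact/measurable_EFinP.
have Z (b : R) (G : R -> \bar R) : 0 <= b -> measurable_fun [set: R] G ->
    (forall u, 0 <= G u)%E ->
    [/\ measurable_fun [set: R] (fun u => b%:E * G u)%E, (forall u, 0 <= b%:E * G u)%E &
     (b%:E * \int[mu]_u G u = \int[mu]_u (b%:E * G u))%E].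
  move=> b0 mG G0; split.
  - exact: (emeasurable_funM (measurable_cst _) mG).
  - by move=> u; rewrite mule_ge0 ?lee_fin.
  - by rewrite (ge0_integralZl mu measurableT mG) ?lee_fin.
have D (G1 G2 : R -> \bar R) : measurable_fun [set: R] G1 -> (forall u, 0 <= G1 u)%E ->
    measurable_fun [set: R] G2 -> (forall u, 0 <= G2 u)%E ->
    [/\ measurable_fun [set: R] (fun u => G1 u + G2 u)%E, (forall u, 0 <= G1 u + G2 u)%E &
     (\int[mu]_u G1 u + \int[mu]_u G2 u = \int[mu]_u (G1 u + G2 u))%E].
  move=> mG1 G10 mG2 G20; split.
  - exact: (emeasurable_funD mG1 mG2).
  - by move=> u; rewrite adde_ge0.
  - by rewrite (ge0_integralD mu measurableT _ mG1 _ mG2).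
have P1 u : (0 <= (g1 u * phi u)%:E)%E by rewrite lee_fin mulr_ge0.
have P2 u : (0 <= (g2 u * phi u)%:E)%E by rewrite lee_fin mulr_ge0.
have PP u : (0 <= (phi u)%:E)%E by rewrite lee_fin.
have cE (b : R) : (b%:E = b%:E * \int[mu]_u (phi u)%:E)%E by rewrite good_mass// mule1.
rewrite [in leLHS](cE c) [in leRHS](cE c').
have [Ma Pa ->] := Z _ _ a0 M2 P2; have [Mc Pc ->] := Z _ _ c0 MP PP.
have [Ma' Pa' ->] := Z _ _ a0' M2 P2; have [Mc' Pc' ->] := Z _ _ c0' MP PP.
have [M3 P3 ->] := D _ _ M1 P1 Ma Pa; have [M4 P4 ->] := D _ _ M3 P3 Mc Pc.
have [M5 P5 ->] := D _ _ Mc' Pc' Ma' Pa'.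
apply: ge0_le_integral => // u _; rewrite -!EFinM -!EFinD lee_fin.
by have := ler_wpM2r (pp u) (H u); lra.
Qed.

(** Expand the exponential to the second order, conditionally on the covariate:
    the term of order 1 has mean at most [l0 * k2 * h ^ 2] times the size of the
    covariate, since [below] has mean close to [tau], and the remainder is
    controlled by the Gaussian tails. *)
Lemma score_mgf v lam : norm2 v <= 1 -> 0 <= lam -> lam * ups <= 1 ->
  (\int[P]_w (expR (2 * (lam * score v (X w, eps w))))%:E <=
   (2 * expR (lam * (l0 * k2 * h ^+ 2) + 128 * expR 8 * (lam * ups) ^+ 2) - 1)%:E)%E.
Proof.
move=> v1 lam0 hlam; set b0 := l0 * k2 * h ^+ 2.
pose z w := `|wdot X v (X w)|.
pose B w := 1 + 2 * lam * b0 * z w +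
  4 * lam ^+ 2 * (wdot X v (X w) ^+ 2 * expR (2 * lam * z w)).
have k20 : 0 <= k2 := kernel_moment_ge0 KC K2.
have b00 : 0 <= b0 by apply: mulr_ge0; [apply: mulr_ge0 => //; exact: ltW|exact: sqr_ge0].
have c1 : 0 <= 2 * lam * b0 by apply: mulr_ge0 => //; exact: mulr_ge0.
have c2 : 0 <= 4 * lam ^+ 2 by apply: mulr_ge0 => //; exact: sqr_ge0.
have ms u : measurable_fun [set: p.-tuple R * R] (fun z => expR (2 * (lam * score u z))).
  apply: measurableT_comp => //; apply: measurable_funM => //.
  by apply: measurable_funM => //; exact: measurable_score.
have mzz : measurable_fun [set: T] z.
  exact: (measurableT_comp (@normr_measurable R setT) (mz v)).
have me : measurable_fun [set: T] (fun w => wdot X v (X w) ^+ 2 * expR (2 * lam * z w)).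
  apply: measurable_funM; first exact: measurable_funX.
  by apply: measurableT_comp => //; exact: measurable_funM.
have e0 w : 0 <= wdot X v (X w) ^+ 2 * expR (2 * lam * z w).
  by apply: mulr_ge0; [exact: sqr_ge0|exact: expR_ge0].
have mB : measurable_fun [set: T] B.
  apply: measurable_funD; last exact: measurable_funM.
  by apply: measurable_funD => //; exact: measurable_funM.
have B0 w : 0 <= B w.
  apply: addr_ge0; last exact: mulr_ge0.
  by apply: addr_ge0 => //; apply: mulr_ge0 => //; exact: normr_ge0.
apply: (@le_trans _ _ (\int[P]_w (B w)%:E)%E).
  apply: (cond_le (g := fun z => expR (2 * (lam * score v z)))) => //.
  move=> w gw.
  have mphi : measurable_fun [set: R] (f (X w)) by exact: good_measurable.
  have phi0 u : 0 <= f (X w) u by exact: good_ge0.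
  have [bu bl] := below_mean h KC K1 K2 gw l00.
  have bel0 u := below_ge0 KC h u; have bel1 u := below_le1 KC K1 h u.
  have mbel := measurable_below KC h.
  pose x := 2 * lam * wdot X v (X w).
  have xz : `|x| = 2 * lam * z w by rewrite normrM ger0_norm// mulr_ge0.
  pose c := 1 + x ^+ 2 * expR `|x|.
  have c0 : 0 <= c by apply: addr_ge0 => //; apply: mulr_ge0; [exact: sqr_ge0|exact: expR_ge0].
  have pt u : expR (2 * (lam * score v (X w, u))) <= c + x * (tau - below K h u).
    have -> : 2 * (lam * score v (X w, u)) = x * (tau - below K h u).
      by rewrite /score /x/=; ring.
    set y := x * _; apply: le_trans (expR_taylor2 y) _.
    have yx : `|y| <= `|x|.
      rewrite /y normrM ler_piMr// ler_norml; have := bel0 u; have := bel1 u.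
      by case/andP : htau => t0 t1; lra.
    have : y ^+ 2 * expR `|y| <= x ^+ 2 * expR `|x|.
      apply: ler_pM; [exact: sqr_ge0|exact: expR_ge0| |by rewrite ler_expR].
      rewrite -(real_normK (num_real y)) -(real_normK (num_real x)).
      by apply: lerXn2r; rewrite ?nnegrE.
    by rewrite /c; lra.
  have mex : measurable_fun [set: R] (fun u => expR (2 * (lam * score v (X w, u)))).
    exact: (mslice (X w) (ms v)).
  have -> : B w = c + `|x| * b0.
    rewrite /B /c -xz -(real_normK (num_real x)) xz /z exprMn.
    by rewrite real_normK ?num_real//; ring.
  have tau0 : 0 <= tau by case/andP : htau => /ltW.
  have ex0 u : 0 <= expR (2 * (lam * score v (X w, u))) by exact: expR_ge0.
  have S0 : (0 <= \int[mu]_u (below K h u * f (X w) u)%:E)%E.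
    by apply: integral_ge0 => u _; rewrite lee_fin mulr_ge0 ?bel0.
  have I0 : (0 <= \int[mu]_u (expR (2 * (lam * score v (X w, u))) * f (X w) u)%:E)%E.
    by apply: integral_ge0 => u _; rewrite lee_fin mulr_ge0 ?ex0.
  have [x0|x0] := leP 0 x.
    have pt' u : expR (2 * (lam * score v (X w, u))) + x * below K h u + 0 <=
        (c + x * tau) + 0 * below K h u by have := pt u; lra.
    have := good_linear gw mex mbel ex0 bel0 x0 (lexx 0) (lexx 0)
      (addr_ge0 c0 (mulr_ge0 x0 tau0)) pt'.
    move: bu bl S0 I0; rewrite (ger0_norm x0).
    move: (\int[mu]_u (below K h u * f (X w) u)%:E)%E (\int[mu]_u (expR _ * f (X w) u)%:E)%E => S I.
    case: S => [S| |] //; case: I => [I| |] //.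
    rewrite -!EFinM -!EFinD !lee_fin => _ bl S0 I0 H.
    have := ler_wpM2l x0 bl; rewrite /b0; lra.
  have x0' : 0 <= `|x| by [].
  have pt' u : expR (2 * (lam * score v (X w, u))) + 0 * below K h u + `|x| * tau <=
      c + `|x| * below K h u by have := pt u; rewrite (ltr0_norm x0); lra.
  have := good_linear gw mex mbel ex0 bel0 (lexx 0) x0' (mulr_ge0 x0' tau0) c0 pt'.
  move: bu S0 I0.
  move: (\int[mu]_u (below K h u * f (X w) u)%:E)%E (\int[mu]_u (expR _ * f (X w) u)%:E)%E => S I.
  case: S => [S| |] //; case: I => [I| |] //.
  rewrite -!EFinM -!EFinD !lee_fin => bu S0 I0 H.
  have := ler_wpM2l x0' bu; rewrite /b0; lra.
have Iz : (\int[P]_w (z w)%:E <= 1%:E)%E := wdot_abs_le DM v1.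
have Ie := wdot_sqr_exp_abs p0 DM SG v1 lam0 hlam.
set y := lam * b0 + 128 * expR 8 * (lam * ups) ^+ 2.
apply: (@le_trans _ _ (1 + 2 * y)%:E); last first.
  by rewrite lee_fin; have := expR_ge1Dx y; lra.
have z0 w : 0 <= z w by exact: normr_ge0.
have M1 : measurable_fun [set: T] (fun w => 2 * lam * b0 * z w) by exact: measurable_funM.
have M2 : measurable_fun [set: T] (fun w =>
  4 * lam ^+ 2 * (wdot X v (X w) ^+ 2 * expR (2 * lam * z w))) by exact: measurable_funM.
have P1 w : 0 <= 2 * lam * b0 * z w by exact: mulr_ge0.
have P2 w : 0 <= 4 * lam ^+ 2 * (wdot X v (X w) ^+ 2 * expR (2 * lam * z w)) by exact: mulr_ge0.
rewrite (ge0_expectationD _ _ M2 _ P2); last 2 first.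
- exact: measurable_funD.
- by move=> w; apply: addr_ge0.
rewrite (ge0_expectationD _ _ M1 _ P1)// expectation_cstr !ge0_expectationZ//.
have := lee_wpmul2l (_ : (0 <= (2 * lam * b0)%:E)%E) Iz.
have := lee_wpmul2l (_ : (0 <= (4 * lam ^+ 2)%:E)%E) Ie.
rewrite !lee_fin => /(_ c2) Ie' /(_ c1) Iz'.
apply: (le_trans (leeD (leeD (lexx _) Iz') Ie')).
rewrite -!EFinM -!EFinD lee_fin /y; move: (expR 8) => E; lra.
Qed.

Let ku0 : 0 < ku. Proof. exact: kernel_sup_gt0 KC. Qed.

Let k10 : 0 <= k1. Proof. exact (kernel_moment_ge0 KC K1). Qed.

Let m30 : 0 < m3.
Proof. exact: lt_le_trans ltr01 (third_moment_ge1 p0 DM SG). Qed.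

Let curv_trunc v w : (\int[mu]_u (curv v (X w, u) * f (X w) u)%:E =
  \int[mu]_u (excess K h u (wdot X v (X w)) * Num.min (f (X w) u) flow)%:E)%E.
Proof. by apply: eq_integral => u _; rewrite -thinM /curv mulrAC mulrC. Qed.

Let curv_mean_ge0 v w : (0 <= \int[mu]_u (curv v (X w, u) * f (X w) u)%:E)%E.
Proof. by apply: integral_ge0 => u _; rewrite lee_fin mulr_ge0 ?curv_ge0. Qed.

(** In [exp y <= 1 + y * exp y] the factor [y] has conditional mean of order
    [flow] times the square of the covariate. The value of [lam] bounds the factor
    [exp y] by a function of the covariate that at most doubles its second moment. *)
Lemma curv_mgf_up v q lam : 0 < q -> norm2 v <= q ->
  lam = h / (4 * ku * q ^+ 2 * (quartic_cst * (ups ^+ 2 * m3))) ->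
  (\int[P]_w (expR (2 * (lam * curv v (X w, eps w))))%:E <=
   (2 * expR (4 * lam * flow * q ^+ 2) - 1)%:E)%E.
Proof.
move=> q0 vq lamE.
have cm0 : 0 < quartic_cst * (ups ^+ 2 * m3).
  by apply: mulr_gt0; [rewrite /quartic_cst exprn_gt0|apply: mulr_gt0 => //; rewrite exprn_gt0].
have lam0 : 0 <= lam.
  rewrite lamE; apply: divr_ge0; first exact: ltW.
  by rewrite !mulr_ge0 ?sqr_ge0// ltW.
pose W w := expR ((quartic_cst * (ups ^+ 2 * m3))^-1 / q ^+ 2 * wdot X v (X w) ^+ 2).
have W0 w : 0 <= W w by exact: expR_ge0.
have mW : measurable_fun [set: T] W by exact: (measurable_exp_sqr DM).
pose B w := 1 + 4 * lam * flow * (wdot X v (X w) ^+ 2 * W w).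
have M1 : measurable_fun [set: T] (fun w => wdot X v (X w) ^+ 2 * W w).
  by apply: measurable_funM => //; exact: measurable_funX.
have P1 w : 0 <= wdot X v (X w) ^+ 2 * W w by apply: mulr_ge0 => //; exact: sqr_ge0.
have c0 : 0 <= 4 * lam * flow by apply: mulr_ge0; [exact: mulr_ge0|exact: ltW].
have M2 : measurable_fun [set: T] (fun w => 4 * lam * flow * (wdot X v (X w) ^+ 2 * W w)).
  exact: measurable_funM.
have P2 w : 0 <= 4 * lam * flow * (wdot X v (X w) ^+ 2 * W w) by exact: mulr_ge0.
have mg : measurable_fun [set: p.-tuple R * R] (fun z => expR (2 * (lam * curv v z))).
  apply: measurableT_comp => //; apply: measurable_funM => //.
  by apply: measurable_funM => //; exact: measurable_curv.
apply: (@le_trans _ _ (\int[P]_w (B w)%:E)%E).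
  apply: (cond_le mg).
  - by move=> z; exact: expR_ge0.
  - exact: measurable_funD.
  - by move=> w; apply: addr_ge0.
  move=> w gw; set z := wdot X v (X w).
  have a0 : 0 <= 2 * lam * W w by apply: mulr_ge0 => //; exact: mulr_ge0.
  have pt u : expR (2 * (lam * curv v (X w, u))) + 0 * curv v (X w, u) + 0 <=
      1 + 2 * lam * W w * curv v (X w, u).
    rewrite mul0r !addr0; apply: le_trans (expR_le_mul _) _; rewrite lerD2l.
    have -> : 2 * lam * W w * curv v (X w, u) = 2 * (lam * curv v (X w, u)) * W w by ring.
    apply: ler_wpM2l; first by rewrite mulr_ge0// mulr_ge0// curv_ge0.
    rewrite /W ler_expR.
    have := ler_wpM2l lam0 (curv_le v (X w, u)); rewrite -/z /= => H.
    have -> : (quartic_cst * (ups ^+ 2 * m3))^-1 / q ^+ 2 * z ^+ 2 =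
        2 * (lam * (2 * ku / h * z ^+ 2)).
      rewrite lamE; field.
      by rewrite !gt_eqF//= /quartic_cst exprn_gt0.
    by rewrite ler_wpM2l.
  have := good_linear gw (mslice (X w) mg) (mslice (X w) (measurable_curv v))
    (fun u => expR_ge0 _) (fun u => curv_ge0 v (X w, u)) (lexx 0) a0 (lexx 0) ler01 pt.
  rewrite mul0e !adde0 => /le_trans; apply.
  have := trunc_excess_le h KC K1 gw flow0 z; rewrite -curv_trunc => H.
  have := lee_wpmul2l (_ : (0 <= (2 * lam * W w)%:E)%E) H; rewrite lee_fin => /(_ a0) H'.
  apply: (le_trans (leeD (lexx _) H')).
  by rewrite -EFinM -EFinD lee_fin /B -/z; lra.
rewrite (ge0_expectationD _ _ M2 _ P2)// expectation_cstr ge0_expectationZ//.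
have := lee_wpmul2l (_ : (0 <= (4 * lam * flow)%:E)%E) (wdot_sqr_exp p0 DM SG q0 vq).
rewrite lee_fin => /(_ c0) H; apply: (le_trans (leeD (lexx _) H)).
rewrite -EFinM -EFinD lee_fin; have := expR_ge1Dx (4 * lam * flow * q ^+ 2); lra.
Qed.

(** The curvature is nonnegative, so that [exp (- y) <= 1 - y + y ^ 2] reduces the
    bound to its mean and its second moment. The mean is bounded below by
    [trunc_excess_ge], and the second moment is at most the mean times the largest
    value, of order [ku / h] times the square of the covariate. *)
Lemma curv_mgf_lo v q lam ylo : 0 < q -> norm2 v <= q -> 0 <= lam ->
  ylo + l0 * (m3 * q ^+ 3 + h * k1 * q ^+ 2) / 8 <= flow * norm2 v ^+ 2 / 8 ->
  (\int[P]_w (expR (2 * - (lam * curv v (X w, eps w))))%:E <=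
   (2 * expR (- (lam * ylo) +
     lam ^+ 2 * (8 * ku * flow * (quartic_cst * (ups ^+ 2 * m3)) * q ^+ 4 / h)) - 1)%:E)%E.
Proof.
move=> q0 vq lam0 hy.
pose z w := wdot X v (X w).
have mzz : measurable_fun [set: T] z by exact: (mz v).
pose B w := lam * flow / 4 * z w ^+ 2.
pose a4 := 16 * lam ^+ 2 * ku * flow / h.
pose a3 := lam * l0 / 4.
pose a2 := lam * l0 * h * k1 / 4.
pose C w := (1 + a4 * (z w ^+ 4 * expR (0 / q ^+ 2 * z w ^+ 2))) +
  (a3 * `|z w| ^+ 3 + a2 * z w ^+ 2).
have h00 := ltW h0; have flow00 := ltW flow0; have ku00 := ltW ku0; have l000 := ltW l00.
have a40 : 0 <= a4.
  by apply: mulr_ge0; [rewrite !mulr_ge0 ?sqr_ge0|rewrite invr_ge0].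
have a30 : 0 <= a3 by rewrite /a3 !mulr_ge0.
have a20 : 0 <= a2 by rewrite /a2 !mulr_ge0.
have b0 : 0 <= lam * flow / 4 by rewrite !mulr_ge0.
have m2 : measurable_fun [set: T] (fun w => z w ^+ 2) by exact: measurable_funX.
have m3' : measurable_fun [set: T] (fun w => `|z w| ^+ 3).
  by apply: measurable_funX; exact: measurableT_comp.
have m4 : measurable_fun [set: T] (fun w => z w ^+ 4 * expR (0 / q ^+ 2 * z w ^+ 2)).
  by apply: measurable_funM; [exact: measurable_funX|exact: (measurable_exp_sqr DM)].
have p2 w : 0 <= z w ^+ 2 by exact: sqr_ge0.
have p3 w : 0 <= `|z w| ^+ 3 by exact: exprn_ge0.
have p4' w : 0 <= z w ^+ 4.
  by rewrite (_ : 4 = 2 * 2)%N// exprM; exact: sqr_ge0.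
have p4 w : 0 <= z w ^+ 4 * expR (0 / q ^+ 2 * z w ^+ 2).
  by apply: mulr_ge0 => //; exact: expR_ge0.
have m2a : measurable_fun [set: T] (fun w => a2 * z w ^+ 2) by exact: measurable_funM.
have m3a : measurable_fun [set: T] (fun w => a3 * `|z w| ^+ 3) by exact: measurable_funM.
have m4a : measurable_fun [set: T] (fun w => a4 * (z w ^+ 4 * expR (0 / q ^+ 2 * z w ^+ 2))).
  exact: measurable_funM.
have p2a w : 0 <= a2 * z w ^+ 2 by exact: mulr_ge0.
have p3a w : 0 <= a3 * `|z w| ^+ 3 by exact: mulr_ge0.
have p4a w : 0 <= a4 * (z w ^+ 4 * expR (0 / q ^+ 2 * z w ^+ 2)) by exact: mulr_ge0.
have mg : measurable_fun [set: p.-tuple R * R] (fun y => expR (2 * - (lam * curv v y))).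
  apply: measurableT_comp => //; apply: measurable_funM => //.
  by apply: measurableT_comp => //; apply: measurable_funM => //; exact: measurable_curv.
have := @cond_leD _ B C mg (fun y => expR_ge0 _).
have mB : measurable_fun [set: T] B by exact: measurable_funM.
have B0 w : 0 <= B w by exact: mulr_ge0.
have mC : measurable_fun [set: T] C.
  by apply: measurable_funD; apply: measurable_funD.
have C0 w : 0 <= C w by apply: addr_ge0; apply: addr_ge0.
move=> /(_ mB B0 mC C0) H.
have {H} : (\int[P]_w (expR (2 * - (lam * curv v (X w, eps w))))%:E +
    \int[P]_w (B w)%:E <= \int[P]_w (C w)%:E)%E.
  apply: H => w gw.
  have e0 : 0 <= 2 * lam by exact: mulr_ge0.
  pose b := 8 * lam ^+ 2 * ku / h * z w ^+ 2.
  have bb0 : 0 <= b.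
    by apply: mulr_ge0 => //; apply: mulr_ge0; [rewrite !mulr_ge0 ?sqr_ge0|rewrite invr_ge0].
  have pt u : expR (2 * - (lam * curv v (X w, u))) + 2 * lam * curv v (X w, u) + 0 <=
      1 + b * curv v (X w, u).
    have y0 : 2 * - (lam * curv v (X w, u)) <= 0.
      by rewrite mulrN oppr_le0 mulr_ge0// mulr_ge0// curv_ge0.
    have := expR_le_quad y0.
    have := ler_wpM2l (mulr_ge0 (sqr_ge0 (2 * lam)) (curv_ge0 v (X w, u))) (curv_le v (X w, u)).
    have -> : (2 * lam) ^+ 2 * curv v (X w, u) * (2 * ku / h * wdot X v (X w, u).1 ^+ 2) =
        b * curv v (X w, u) by rewrite /b /z; ring.
    move: (curv _ _) (b * curv _ _) (expR (_ * - _)) => Y bY E; lra.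
  have := good_linear gw (mslice (X w) mg) (mslice (X w) (measurable_curv v))
    (fun u => expR_ge0 _) (fun u => curv_ge0 v (X w, u)) e0 bb0 (lexx 0) ler01 pt.
  have := trunc_excess_le h KC K1 gw flow0 (z w).
  have := trunc_excess_ge KC K1 K2 gw flow0 l00 h0 (z w).
  rewrite -!curv_trunc; have := curv_mean_ge0 v w.
  have : (0 <= \int[mu]_u (expR (2 * - (lam * curv v (X w, u))) * f (X w) u)%:E)%E.
    by apply: integral_ge0 => u _; rewrite lee_fin mulr_ge0 ?expR_ge0.
  move: (\int[mu]_u (curv v _ * _)%:E)%E (\int[mu]_u (expR _ * _)%:E)%E => S I.
  case: S => [S| |] //; case: I => [I| |] //.
  rewrite adde0 -!EFinM -!EFinD !lee_fin => I0 S0 Slo Sup H.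
  rewrite /B /C mul0r mul0r expR0 mulr1.
  have H1 := ler_wpM2l lam0 Slo; have H2 := ler_wpM2l bb0 Sup.
  have : b * (2 * flow * z w ^+ 2) = a4 * z w ^+ 4 by rewrite /b /a4; ring.
  have : lam * (l0 * `|z w| * z w ^+ 2 / 8 + l0 * h * z w ^+ 2 / 8 * k1) =
      (a3 * `|z w| ^+ 3 + a2 * z w ^+ 2) / 2.
    rewrite /a3 /a2 -[in LHS](real_normK (num_real (z w))).
    by rewrite -[in RHS](real_normK (num_real (z w))); field.
  move: H1; rewrite mulrDr; lra.
rewrite /C ge0_expectationD//; last 4 first.
- exact: measurable_funD.
- exact: measurable_funD.
- by move=> w; apply: addr_ge0.
- by move=> w; apply: addr_ge0.
rewrite (ge0_expectationD _ _ m4a _ p4a)// (ge0_expectationD _ m3a m2a p3a p2a).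
rewrite expectation_cstr !ge0_expectationZ//.
have v0 : 0 <= q by exact: ltW.
have th0 : 24 * 0 * ups ^+ 2 <= 1 by rewrite mulr0 mul0r ler01.
have H4 := wdot_quartic_exp p0 DM SG q0 vq (lexx 0) th0.
have H3 := wdot_cube_le p0 DM SG v0 vq.
have H2 := wdot_sqr_le DM vq.
have Ez : (\int[P]_w (z w ^+ 2)%:E = (norm2 v ^+ 2)%:E)%E := wdot_sqr_mean DM v.
move=> H; rewrite [X in (_ + _ * X <= _)%E]Ez in H.
have L4 := lee_wpmul2l (_ : (0 <= a4%:E)%E) H4.
have L3 := lee_wpmul2l (_ : (0 <= a3%:E)%E) H3.
have L2 := lee_wpmul2l (_ : (0 <= a2%:E)%E) H2.
move: L4 L3 L2; rewrite !lee_fin => /(_ a40) L4 /(_ a30) L3 /(_ a20) L2.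
have := le_trans H (leeD (leeD (lexx _) L4) (leeD L3 L2)).
have : (0 <= \int[P]_w (expR (2 * - (lam * curv v (X w, eps w))))%:E)%E.
  by apply: integral_ge0 => w _; rewrite lee_fin expR_ge0.
move: (\int[P]_w (expR (2 * _))%:E)%E => I; case: I => [I| |] //.
rewrite -!EFinM -!EFinD !lee_fin => I0 H'.
set y := - _ + _.
apply: (@le_trans _ _ (1 + 2 * y)); last by have := expR_ge1Dx y; lra.
rewrite {}/y.
have -> : lam ^+ 2 * (8 * ku * flow * (quartic_cst * (ups ^+ 2 * m3)) * q ^+ 4 / h) =
  a4 * (quartic_cst * (ups ^+ 2 * m3) * q ^+ 4) / 2.
  by rewrite /a4; move: (quartic_cst * _) => M; field; rewrite gt_eqF.
have := ler_wpM2l lam0 hy.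
move: H'; rewrite /a3 /a2; move: (a4 * _) => A; lra.
Qed.

End mgf.

(** * Localization of minimizers of convex functions *)

Section localization.
Context {R : realType} {p : nat}.
Implicit Types (u v z S : 'cV[R]_p) (G : 'cV[R]_p -> R).

(** Test the net point next to the normalized vector: the error is at most half
    of the norm that is to be bounded. *)
Lemma norm2_le_net (I : Type) (u : I -> 'cV[R]_p) S g :
  (forall v, norm2 v <= 1 -> exists k, norm2 (v - u k) <= 2^-1) ->
  (forall k, dotv (u k) S < g) -> norm2 S <= 2 * g.
Proof.
move=> net hg; have [S0|S0] := eqVneq S 0.
  rewrite S0 in hg *.
  have n0 : norm2 (0 : 'cV[R]_p) = 0 by apply/eqP; rewrite norm2_eq0.
  have [|k _] := net 0; first by rewrite n0.
  by have := hg k; rewrite dotvC dotv0l n0 => /ltW g0; rewrite mulr_ge0.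
have nS : 0 < norm2 S by rewrite lt_neqAle norm2_ge0 andbT eq_sym norm2_eq0.
have nv : norm2 ((norm2 S)^-1 *: S) = 1.
  by rewrite norm2Z ger0_norm ?invr_ge0 ?norm2_ge0// mulVf// gt_eqF.
have [|k hk] := net ((norm2 S)^-1 *: S); first by rewrite nv.
have E : norm2 S = dotv ((norm2 S)^-1 *: S) S.
  by rewrite dotvZl -norm2_sqr expr2 mulKf// gt_eqF.
have := dotv_le ((norm2 S)^-1 *: S - u k) S.
rewrite dotvBl -E => H; have := hg k.
have := ler_wpM2r (ltW nS) hk; lra.
Qed.

Let midconvex G := forall u v, G (2^-1 *: (u + v)) <= (G u + G v) / 2.

(** A point of the half ball is the midpoint of a dilated net point and of a
    vector that lies again in the half ball, so that by convexity the supremum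
    [M] over the half ball satisfies [M <= (g + M) / 2]. *)
Lemma midconvex_le_net (I : Type) (u : I -> 'cV[R]_p) G rho g B : 0 < rho ->
  midconvex G -> (forall v, G v <= B * norm2 v) -> 0 <= B ->
  (forall v, norm2 v <= 1 -> exists k, norm2 (v - u k) <= 2^-1) ->
  (forall k, G (rho *: u k) < g) ->
  forall z, norm2 z <= rho / 2 -> G z <= g.
Proof.
move=> rho0 cG bG B0 net hg z hz.
pose E := [set G y | y in [set y | norm2 y <= rho / 2]].
have Eub : has_ubound E.
  exists (B * (rho / 2)) => _ [y /= hy <-]; apply: le_trans (bG y) _.
  by rewrite ler_wpM2l.
have E0 : E !=set0 by exists (G z), z.
suff H : sup E <= g.
  by apply: le_trans H; apply: ub_le_sup => //; exists z.
suff : sup E <= (g + sup E) / 2 by lra.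
apply: ge_sup => // _ [y /= hy <-].
have [|k hk] := net ((2 / rho) *: y).
  rewrite norm2Z ger0_norm; last by rewrite divr_ge0// ltW.
  by rewrite (mulrC 2) -mulrA ler_pdivrMl//; lra.
pose y' := (2 / rho) *: y - u k.
have -> : y = 2^-1 *: (rho *: u k + rho *: y').
  have r2 : rho * (2 / rho) = 2 by field; rewrite gt_eqF.
  by rewrite -scalerDr /y' addrC subrK 2!scalerA -mulrA r2 mulVf ?scale1r.
apply: le_trans (cG _ _) _; rewrite ler_pM2r//; apply: lerD; first exact/ltW/hg.
apply: ub_le_sup => //; exists (rho *: y') => //=.
by rewrite norm2Z (ger0_norm (ltW rho0)) ler_pM2l.
Qed.

(** If [z] were outside the ball, its radial projection [v] to the sphere of radius
    [r] would also have [F v <= 0]. But [v / 2] is close to [r / 2] times a net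
    point, at which [G] exceeds [gB]; by convexity [G v] is at least
    [2 * gB - gC], which exceeds the linear term. *)
Lemma norm2_le_of_nonpos (I : Type) (u : I -> 'cV[R]_p) (F G : 'cV[R]_p -> R) S r gB gC z :
  0 < r ->
  (forall v t, 0 <= t <= 1 -> F (t *: v) <= t * F v) ->
  (forall v, G v - dotv v S <= F v) -> midconvex G ->
  (forall v, norm2 v <= 1 ->
     exists2 k, norm2 (v - u k) <= 64^-1 & norm2 (u k) <= norm2 v) ->
  (forall v, norm2 v <= r / 64 -> G v <= gC) ->
  (forall k, 63 / 64 <= norm2 (u k) -> gB < G ((r / 2) *: u k)) ->
  r * norm2 S + gC <= 2 * gB ->
  F z <= 0 -> norm2 z <= r.
Proof.
move=> r0 cF lF cG net hC hB hr Fz; rewrite leNgt; apply/negP => rz.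
have z0 : 0 < norm2 z by exact: lt_trans rz.
pose v := (r / norm2 z) *: z.
have t01 : 0 <= r / norm2 z <= 1.
  by apply/andP; split; [rewrite divr_ge0// ltW|rewrite ler_pdivrMr// mul1r ltW].
have Fv : F v <= 0.
  apply: le_trans (cF _ _ t01) _; rewrite mulr_ge0_le0//; by case/andP: t01.
have nv : norm2 v = r.
  by rewrite norm2Z ger0_norm ?divfK ?gt_eqF//; case/andP : t01.
have n1 : norm2 (r^-1 *: v) = 1.
  by rewrite norm2Z nv ger0_norm ?mulVf ?gt_eqF// invr_ge0 ltW.
have [|k hk1 hk2] := net (r^-1 *: v); first by rewrite n1.
have hk3 : 63 / 64 <= norm2 (u k).
  have := norm2D (r^-1 *: v - u k) (u k); rewrite subrK n1; lra.
pose v' := r *: (u k - r^-1 *: v).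
have nv' : norm2 v' <= r / 64.
  by rewrite norm2Z -norm2N opprB (ger0_norm (ltW r0)) ler_pM2l.
have := cG v v'; have -> : 2^-1 *: (v + v') = (r / 2) *: u k.
  rewrite /v' scalerBr scalerA divff ?gt_eqF// scale1r addrC subrK scalerA.
  by rewrite mulrC.
have := hB k hk3; have := hC _ nv'; have := lF v; have := dotv_le v S.
rewrite nv; lra.
Qed.

End localization.

(** * Increments of the bootstrap loss *)

Section increments.
Context {R : realType} {d : measure_display} {T : measurableType d}.
Variables (P : probability T R) (p n : nat) (X : {RV P >-> p.-tuple R}).
Variables (tau : R) (K : R -> R) (ku k1 h : R).
Variables (f : p.-tuple R -> R -> R) (flow l0 : R) (beta : 'cV[R]_p).
Hypotheses (DM : design_moments X) (htau : 0 < tau < 1) (h0 : 0 < h).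
Hypothesis DC : density_condition X f flow l0.
Hypothesis KC : kernel_condition K ku.
Hypothesis K1 : kernel_moment K 1 = k1%:E.

Local Notation Sigma := (second_moment_mx X).

(** An observation determines the covariate and the error. *)
Definition resid (z : R * p.-tuple R) : p.-tuple R * R :=
  (z.2, z.1 - dotv (vec z.2) beta).

Lemma measurable_resid : measurable_fun [set: R * p.-tuple R] resid.
Proof.
have md := measurable_dotv_vec beta.
apply/measurable_fun_pairP; split; first exact: measurable_snd.
apply: measurable_funB; first exact: measurable_fst.
exact: (measurableT_comp md measurable_snd).
Qed.

Variables (D : 'I_n -> R * p.-tuple R) (w : 'I_n -> R).
Hypothesis w0 : forall i, 0 <= w i.

(** The increment of the loss, in the coordinates that turn the norm of
    [Sigma] into the Euclidean norm. *)
Definition loss_incr (v : 'cV[R]_p) : R :=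
  \sum_i w i * (excess K h (resid (D i)).2 (wdot X v (D i).2) -
                score X tau K h v (resid (D i))).

Definition score_vec : 'cV[R]_p :=
  \sum_i (w i * (tau - below K h (resid (D i)).2)) *: whiten X (D i).2.

Definition curv_sum (v : 'cV[R]_p) : R :=
  \sum_i w i * curv X f flow K h v (resid (D i)).

Lemma boot_loss_incr b : (0 < n)%N ->
  boot_loss tau K h D w b - boot_loss tau K h D w beta =
  n%:R^-1 * loss_incr (sqrtmx Sigma *m (b - beta)).
Proof.
move=> n0; rewrite /boot_loss -mulrBr -sumrB; congr (_ * _); apply: eq_bigr => i _.
case: DM => _ _ _ /sqrtmxP [_ _ uS].
rewrite -mulrBr; congr (_ * _); rewrite /score /resid /=.
set s := wdot X _ _.
have -> : (D i).1 - dotv (vec (D i).2) b = (D i).1 - dotv (vec (D i).2) beta - s.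
  by rewrite /s wdotE// mulKmx// dotvBl !(dotvC _ (vec _)); ring.
rewrite (smoothed_lossB KC K1 _ _ htau h0); ring.
Qed.

Lemma loss_incr_scale v t : 0 <= t <= 1 -> loss_incr (t *: v) <= t * loss_incr v.
Proof.
move=> ht; rewrite mulr_sumr; apply: ler_sum => i _.
rewrite mulrCA; apply: ler_wpM2l => //; rewrite /score !wdotZ.
have := excess_convex KC K1 h (resid (D i)).2 (wdot X v (D i).2) 0 ht.
rewrite mulr0 addr0 (excess0 KC K1) mulr0 addr0; lra.
Qed.

Lemma dotv_score v : dotv v score_vec = \sum_i w i * score X tau K h v (resid (D i)).
Proof.
rewrite /score_vec dotvE mulmx_sumr summxE; apply: eq_bigr => i _.
by rewrite -dotvE dotvZr mulrA.
Qed.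

Lemma curv_sum_mid u v : curv_sum (2^-1 *: (u + v)) <= (curv_sum u + curv_sum v) / 2.
Proof.
rewrite -big_split/= mulr_suml; apply: ler_sum => i _.
rewrite -mulrDr -mulrA; apply: ler_wpM2l => //.
rewrite /curv -mulrDr -mulrA; apply: ler_wpM2l; first exact/ltW/(thin_gt0 DC).
have h2 : 0 <= (2^-1 : R) <= 1 by lra.
have := excess_convex KC K1 h (resid (D i)).2 (wdot X u (resid (D i)).1)
  (wdot X v (resid (D i)).1) h2.
have -> : 2^-1 * wdot X u (resid (D i)).1 + (1 - 2^-1) * wdot X v (resid (D i)).1 =
    wdot X (2^-1 *: (u + v)) (resid (D i)).1 by rewrite wdotZ wdotD; field.
lra.
Qed.

Lemma curv_sum_le v : curv_sum v <= (\sum_i w i * norm2 (whiten X (D i).2)) * norm2 v.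
Proof.
rewrite mulr_suml; apply: ler_sum => i _; rewrite -mulrA; apply: ler_wpM2l => //.
apply: (@le_trans _ _ (excess K h (resid (D i)).2 (wdot X v (D i).2))).
  by rewrite /curv ler_piMl ?(thin_le1 DC)//; exact: (excess_ge0 KC).
apply: le_trans (excess_le KC K1 _ _ _) _.
have := dotv_le v (whiten X (D i).2); have := dotv_le (- v) (whiten X (D i).2).
by rewrite dotvNl norm2N ler_norml /wdot mulrC; lra.
Qed.

Lemma loss_incr_ge v : curv_sum v - dotv v score_vec <= loss_incr v.
Proof.
rewrite dotv_score -sumrB; apply: ler_sum => i _; rewrite -mulrBr.
apply: ler_wpM2l => //; rewrite lerD2r /curv ler_piMl ?(thin_le1 DC)//.
exact: (excess_ge0 KC).
Qed.

(** The net [u] of mesh 1/2 controls the score and, at the scale [r / 32], the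
    curvature of small vectors; the finer net [u'] bounds the curvature from below
    at the scale [r / 2]. Points of [u'] of norm below [63 / 64] are not close to
    unit vectors. *)
Theorem boot_localization (I J : Type) (u : I -> 'cV[R]_p) (u' : J -> 'cV[R]_p)
    (r gA gB gC : R) b : (0 < n)%N -> 0 < r ->
  (forall v, norm2 v <= 1 -> exists k, norm2 (v - u k) <= 2^-1) ->
  (forall v, norm2 v <= 1 ->
     exists2 k, norm2 (v - u' k) <= 64^-1 & norm2 (u' k) <= norm2 v) ->
  (forall k, \sum_i w i * score X tau K h (u k) (resid (D i)) < gA) ->
  (forall k, curv_sum ((r / 32) *: u k) < gC) ->
  (forall k, 63 / 64 <= norm2 (u' k) -> gB < curv_sum ((r / 2) *: u' k)) ->
  r * (2 * gA) + gC <= 2 * gB ->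
  boot_loss tau K h D w b <= boot_loss tau K h D w beta ->
  normS Sigma (b - beta) <= r.
Proof.
move=> n0 r0 net net' hA hC hB hr hb; rewrite /normS.
have B0 : 0 <= \sum_i w i * norm2 (whiten X (D i).2).
  by apply: sumr_ge0 => i _; rewrite mulr_ge0 ?norm2_ge0.
apply: (norm2_le_of_nonpos r0 loss_incr_scale loss_incr_ge curv_sum_mid net' _ hB).
- move=> v hv; have r32 : 0 < r / 32 by rewrite divr_gt0.
  apply: (midconvex_le_net r32 curv_sum_mid curv_sum_le B0 net hC); lra.
- have hS : norm2 score_vec <= 2 * gA.
    by apply: norm2_le_net net _ => k; rewrite dotv_score.
  by apply: le_trans hr; rewrite lerD2r ler_pM2l.
- have nn : 0 < n%:R^-1 :> R by rewrite invr_gt0 ltr0n.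
  by rewrite -(pmulr_rle0 _ nn) -boot_loss_incr// subr_le0.
Qed.

End increments.

Section transfer.
Context {R : realType} {d : measure_display} {T : measurableType d}.
Variables (P : probability T R) (p n : nat) (X : {RV P >-> p.-tuple R}) (eps : {RV P >-> R}).
Variables (beta : 'cV[R]_p) (Z : 'I_n -> {RV P >-> (R * p.-tuple R)%type}).
Hypothesis CZ : copies_of X eps beta Z.

(** The observations have the law of [(<X, beta> + eps, X)], from which [resid]
    recovers [(X, eps)]. *)
Lemma copies_expectation (g : p.-tuple R * R -> R) i :
  measurable_fun [set: p.-tuple R * R] g -> (forall z, 0 <= g z) ->
  (\int[P]_w (g (resid beta (Z i w)))%:E = \int[P]_w (g (X w, eps w))%:E)%E.
Proof.
move=> mg g0; pose obs w := (dotv (vec (X w)) beta + eps w, X w) : R * p.-tuple R.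
have mZ : measurable_fun [set: T] (Z i) by exact: measurable_funP.
have md := measurable_dotv_vec beta.
have mX : measurable_fun [set: T] X by exact: measurable_funP.
have mobs : measurable_fun [set: T] obs.
  apply/measurable_fun_pairP; split; last exact: mX.
  by apply: measurable_funD; [exact: (measurableT_comp md mX)|exact: measurable_funP].
have mgr : measurable_fun [set: R * p.-tuple R] (fun z => (g (resid beta z))%:E).
  by apply/measurable_EFinP; exact: (measurableT_comp mg (measurable_resid beta)).
have gr0 z : (0 <= (g (resid beta z))%:E)%E by rewrite lee_fin.
rewrite -(ge0_integral_image P mZ mgr gr0).
rewrite (eq_measure_integral (image_measure P mobs)); last first.
  by move=> A mA _; rewrite !image_measureE; exact: CZ.
rewrite ge0_integral_image//; apply: eq_integral => w _.
by rewrite /resid /obs /= addrC addKr.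
Qed.

End transfer.

(** * The bootstrap estimator *)

(** The numerical constants are locked because conversion would evaluate them in
    unary. *)
Definition size_cst {R : realType} : R := locked (2 ^+ 38).
Definition score_cst {R : realType} : R := locked (128 * expR 8 + 4).
Definition radius_cst {R : realType} : R := locked (256 * score_cst + 257).

Lemma radius_cst_ge1 {R : realType} : 1 <= radius_cst :> R.
Proof. rewrite /radius_cst /score_cst -!lock; have := expR_gt0 (8 : R); lra. Qed.

Lemma score_cst_ge0 (R : realType) : 0 <= score_cst :> R.
Proof. rewrite /score_cst -lock; have := expR_gt0 (8 : R); lra. Qed.

Lemma mulr_sqrt_div {R : rcfType} (x y : R) : 0 < y -> 0 <= x ->
  y * Num.sqrt (x / y) ^+ 2 = x.
Proof.
move=> y0 x0; rewrite sqr_sqrtr; last by rewrite divr_ge0// ltW.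
by rewrite mulrC divfK// gt_eqF.
Qed.

Lemma size_cst_ge {R : realType} : 66 * (120 ^+ 2 * 2) * quartic_cst <= size_cst :> R.
Proof.
rewrite /size_cst -lock /quartic_cst (_ : 38 = 21 + 17)%N// exprD.
apply: ler_wpM2r; first exact: exprn_ge0.
lra.
Qed.

Lemma size_cst_ge4 {R : realType} : 4 * quartic_cst <= size_cst :> R.
Proof.
apply: le_trans size_cst_ge; apply: ler_wpM2r; first exact: exprn_ge0.
lra.
Qed.

(** Union bound over a net: the exponents beat the entropy of the net, as
    [2 <= exp 1]. *)
Lemma sum_expR_le {R : realType} (I : finType) (g : I -> R) (s p : nat) (t : R) :
  #|I|%:R <= (2 ^ (s * p))%:R :> R -> (2 <= s)%N -> 0 <= t ->
  (forall k, g k <= - (s%:R * (p%:R + t))) ->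
  \sum_k expR (g k) <= expR (- (2 * t)).
Proof.
move=> cI s2 t0 hg.
apply: (@le_trans _ _ (#|I|%:R * expR (- (s%:R * (p%:R + t))))).
  apply: (@le_trans _ _ (\sum_(k : I) expR (- (s%:R * (p%:R + t))))).
    by apply: ler_sum => k _; rewrite ler_expR.
  by rewrite sumr_const -[leLHS]mulr_natl.
apply: (@le_trans _ _ (expR (s * p)%:R * expR (- (s%:R * (p%:R + t))))).
  apply: ler_wpM2r; first exact: expR_ge0.
  apply: le_trans cI _; rewrite -[(s * p)%:R in leRHS]mulr1 expRM_natl natrX.
  apply: lerXn2r; rewrite ?nnegrE ?expR_ge0//.
  by have := expR_ge1Dx (1 : R); lra.
rewrite -expRD ler_expR natrM.
have s2' : 2 <= s%:R :> R by rewrite ler_nat.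
have := ler_wpM2r t0 s2'; lra.
Qed.

Section monotonicity.
Context {R : realType} {d : measure_display} {T : measurableType d}.
Variables (P : probability T R) (n : nat) (e : 'I_n -> {RV P >-> R}).
Hypotheses (rad : forall i, rademacher (e i)) (inde : mutually_independent e).

Lemma Pstar_le (A B : set ('I_n -> R)) :
  (forall s, (forall i, s i = 1 \/ s i = -1) -> A s -> B s) -> (Pstar e A <= Pstar e B)%E.
Proof.
move=> AB; rewrite !PstarE// lee_fin; apply: ler_sum => b _.
apply: ler_wpM2l; first exact: exprn_ge0.
case: (boolP (_ \in A)) => [|_]; last by rewrite ler0n.
rewrite inE => Ab; rewrite mem_set//; apply: AB => // i.
by rewrite /sign_of; case: (b i); [left|right].
Qed.

End monotonicity.

Section bootstrap_deviation.
Context {R : realType} {d : measure_display} {T : measurableType d}.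
Variables (P : probability T R) (p n : nat) (X : {RV P >-> p.-tuple R}).
Variables (eps : {RV P >-> R}) (beta : 'cV[R]_p) (f : p.-tuple R -> R -> R).
Variables (tau flow l0 ups : R) (K : R -> R) (ku k1 k2 h t : R).
Variables (Z : 'I_n -> {RV P >-> (R * p.-tuple R)%type}) (e : 'I_n -> {RV P >-> R}).
Hypotheses (p0 : (0 < p)%N) (n0 : (0 < n)%N) (htau : 0 < tau < 1) (h0 : 0 < h) (t0 : 0 <= t).
Hypothesis KC : kernel_condition K ku.
Hypothesis K1 : kernel_moment K 1 = k1%:E.
Hypothesis K2 : kernel_moment K 2 = k2%:E.
Hypothesis DM : design_moments X.
Hypothesis SG : subgaussian_design X ups.
Hypothesis CP : is_cond_prob X [set w | eps w <= 0] (cst tau).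
Hypothesis CD : is_cond_density X eps f.
Hypothesis DC : density_condition X f flow l0.
Hypothesis indZ : mutually_independent Z.
Hypothesis CZ : copies_of X eps beta Z.
Hypothesis rad : forall i, rademacher (e i).
Hypothesis inde : mutually_independent e.

Local Notation m3 := (third_moment X).
Local Notation Sigma := (second_moment_mx X).

Let a := Num.sqrt ((p%:R + t) / n%:R).
Let b0 := l0 * k2 * h ^+ 2.

Definition radius : R := radius_cst / flow * (ups * a + b0).
Local Notation r := radius.

Let flow0 : 0 < flow. Proof. by case: DC. Qed.
Let l00 : 0 < l0. Proof. by case: DC. Qed.
Let ups0 : 0 < ups. Proof. by case: SG. Qed.
Let ku0 : 0 < ku. Proof. exact: kernel_sup_gt0 KC. Qed.
Let k20 : 0 <= k2. Proof. exact (kernel_moment_ge0 KC K2). Qed.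
Let m30 : 0 < m3. Proof. exact: lt_le_trans ltr01 (third_moment_ge1 p0 DM SG). Qed.
Let n0' : 0 < n%:R :> R. Proof. by rewrite ltr0n. Qed.
Let pt0 : 0 < p%:R + t. Proof. by rewrite ltr_wpDr// ltr0n. Qed.
Let a0 : 0 < a. Proof. by rewrite sqrtr_gt0 divr_gt0. Qed.

Let na2 : n%:R * a ^+ 2 = p%:R + t.
Proof. exact: (mulr_sqrt_div n0' (ltW pt0)). Qed.

Let b00 : 0 <= b0.
Proof. by apply: mulr_ge0; [apply: mulr_ge0 => //; exact: ltW|exact: sqr_ge0]. Qed.

Let r0 : 0 < r.
Proof.
apply: mulr_gt0; last by rewrite ltr_wpDr// mulr_gt0.
exact: (divr_gt0 (lt_le_trans ltr01 radius_cst_ge1) flow0).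
Qed.

Let cm := quartic_cst * (ups ^+ 2 * m3).
Let cm0 : 0 < cm.
Proof.
apply: mulr_gt0; first by rewrite /quartic_cst exprn_gt0.
by apply: mulr_gt0 => //; rewrite exprn_gt0.
Qed.

(* Parameters of the three families of Chernoff bounds: the score at net points
   (A), the upper tail of the curvature at net points of norm at most r / 32 (C)
   and its lower tail at net points of norm about r / 2 (B). In case (B), 2 * gB is
   a lower bound on the mean, VB is twice a bound on the second moment, and lamB
   minimizes - lam * gB + lam ^ 2 * VB. *)
Let lamA := a / ups.
Let gA := b0 + score_cst * ups * a.
Let qC := r / 32.
Let lamC := h / (4 * ku * qC ^+ 2 * cm).
Let gC := 8 * flow * qC ^+ 2.
Let gB := flow * r ^+ 2 / 120.
Let VB := 8 * ku * flow * cm * (r / 2) ^+ 4 / h.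
Let lamB := gB / (2 * VB).

Let lamA0 : 0 < lamA. Proof. exact: divr_gt0. Qed.
Let qC0 : 0 < qC. Proof. exact: divr_gt0. Qed.
Let lamC0 : 0 < lamC.
Proof.
have q20 : 0 < qC ^+ 2 by rewrite exprn_gt0.
have k40 : 0 < 4 * ku by rewrite mulr_gt0.
exact: (divr_gt0 h0 (mulr_gt0 (mulr_gt0 k40 q20) cm0)).
Qed.
Let gB0 : 0 < gB.
Proof.
have r20 : 0 < r ^+ 2 by rewrite exprn_gt0.
by apply: divr_gt0; [exact: (mulr_gt0 flow0 r20)|].
Qed.

Let VB0 : 0 < VB. Proof.
have q40 : 0 < (r / 2) ^+ 4 by rewrite exprn_gt0// divr_gt0.
have k80 : 0 < 8 * ku * flow by rewrite !mulr_gt0.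
exact: (divr_gt0 (mulr_gt0 (mulr_gt0 k80 cm0) q40) h0).
Qed.
Let lamB0 : 0 < lamB. Proof. exact: (divr_gt0 gB0 (mulr_gt0 (ltr0Sn R 1) VB0)). Qed.

Let expA : n%:R * (lamA * b0 + 128 * expR 8 * (lamA * ups) ^+ 2) - n%:R * (lamA * gA) =
  - (4 * (p%:R + t)).
Proof.
rewrite -na2 /lamA /gA /score_cst -lock; move: (expR 8) => E; field.
by rewrite gt_eqF.
Qed.

Hypothesis a_le1 : a <= 1.
Hypothesis NH : size_cst * ku * ups ^+ 2 * m3 * a ^+ 2 <= flow * h.
Hypothesis bias_small : l0 * h * k1 <= flow / 4.
Hypothesis radius_small : l0 * m3 * r <= flow / 4.

Let nfh : size_cst * (ku * ups ^+ 2 * m3 * (p%:R + t)) <= n%:R * (flow * h).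
Proof.
apply: le_trans (ler_wpM2l (ltW n0') NH); rewrite -na2 le_eqVlt.
by apply/orP; left; apply/eqP; move: size_cst => N; ring.
Qed.

Let M0 : 0 <= ku * ups ^+ 2 * m3 * (p%:R + t).
Proof. by rewrite !mulr_ge0 ?sqr_ge0// ltW. Qed.

Let expC : n%:R * (4 * lamC * flow * qC ^+ 2) - n%:R * (lamC * gC) <= - (4 * (p%:R + t)).
Proof.
have -> : n%:R * (4 * lamC * flow * qC ^+ 2) - n%:R * (lamC * gC) =
    - (n%:R * (flow * h) / (ku * cm)).
  by rewrite /lamC /gC; field; rewrite !gt_eqF.
rewrite lerN2 ler_pdivlMr; last exact: mulr_gt0.
apply: le_trans nfh; rewrite /cm.
have -> : 4 * (p%:R + t) * (ku * (quartic_cst * (ups ^+ 2 * m3))) =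
  4 * quartic_cst * (ku * ups ^+ 2 * m3 * (p%:R + t)) by ring.
exact: (ler_wpM2r M0 size_cst_ge4).
Qed.

Let expB : n%:R * (- (lamB * (2 * gB)) + lamB ^+ 2 * VB) - - (n%:R * (lamB * gB)) <=
  - (66 * (p%:R + t)).
Proof.
have -> : n%:R * (- (lamB * (2 * gB)) + lamB ^+ 2 * VB) - - (n%:R * (lamB * gB)) =
    - (n%:R * (flow * h) / (120 ^+ 2 * 2 * (ku * cm))).
  rewrite /lamB /VB /gB; field.
  by rewrite !gt_eqF.
rewrite lerN2 ler_pdivlMr; last by rewrite !mulr_gt0// exprn_gt0.
apply: le_trans nfh; rewrite /cm.
have -> : 66 * (p%:R + t) * (120 ^+ 2 * 2 * (ku * (quartic_cst * (ups ^+ 2 * m3)))) =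
  66 * (120 ^+ 2 * 2) * quartic_cst * (ku * ups ^+ 2 * m3 * (p%:R + t)) by ring.
exact: (ler_wpM2r M0 size_cst_ge).
Qed.

Let mgfA v i : norm2 v <= 1 ->
  (\int[P]_w (expR (2 * (lamA * score X tau K h v (resid beta (Z i w)))))%:E <=
   (2 * expR (lamA * b0 + 128 * expR 8 * (lamA * ups) ^+ 2) - 1)%:E)%E.
Proof.
move=> v1; pose g z := expR (2 * (lamA * score X tau K h v z)).
have mg : measurable_fun [set: p.-tuple R * R] g.
  apply: measurableT_comp => //; apply: measurable_funM => //.
  by apply: measurable_funM => //; exact: (measurable_score tau h KC DM v).
rewrite (copies_expectation CZ i mg (fun z => expR_ge0 _)).
apply: (score_mgf h p0 htau KC K1 K2 DM SG CP CD DC v1 (ltW lamA0)).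
by rewrite /lamA divfK// gt_eqF.
Qed.

Let mgfC v i : norm2 v <= qC ->
  (\int[P]_w (expR (2 * (lamC * curv X f flow K h v (resid beta (Z i w)))))%:E <=
   (2 * expR (4 * lamC * flow * qC ^+ 2) - 1)%:E)%E.
Proof.
move=> vq; pose g z := expR (2 * (lamC * curv X f flow K h v z)).
have mg : measurable_fun [set: p.-tuple R * R] g.
  apply: measurableT_comp => //; apply: measurable_funM => //.
  by apply: measurable_funM => //; exact: (measurable_curv h KC DM CD DC _).
rewrite (copies_expectation CZ i mg (fun z => expR_ge0 _)).
exact: (curv_mgf_up p0 htau h0 KC K1 DM SG CP CD DC qC0 vq erefl).
Qed.

Let mgfB v i : norm2 v <= 1 -> 63 / 64 <= norm2 v ->
  (\int[P]_w (expR (2 * - (lamB * curv X f flow K h ((r / 2) *: v) (resid beta (Z i w)))))%:E <=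
   (2 * expR (- (lamB * (2 * gB)) + lamB ^+ 2 * VB) - 1)%:E)%E.
Proof.
move=> v1 v2; have q0 : 0 < r / 2 by rewrite divr_gt0.
have nv : norm2 ((r / 2) *: v) = r / 2 * norm2 v by rewrite norm2Z (ger0_norm (ltW q0)).
pose g z := expR (2 * - (lamB * curv X f flow K h ((r / 2) *: v) z)).
have mg : measurable_fun [set: p.-tuple R * R] g.
  apply: measurableT_comp => //; apply: measurable_funM => //.
  apply: measurableT_comp => //; apply: measurable_funM => //.
  exact: (measurable_curv h KC DM CD DC _).
rewrite (copies_expectation CZ i mg (fun z => expR_ge0 _)).
apply: (curv_mgf_lo p0 htau h0 KC K1 K2 DM SG CP CD DC q0 _ (ltW lamB0)).
  by rewrite nv ler_piMr// ltW.
rewrite nv /gB.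
have y2 : (63 / 64) ^+ 2 <= norm2 v ^+ 2 by apply: lerXn2r; rewrite ?nnegrE ?norm2_ge0.
have fr : 0 <= flow * r ^+ 2 by rewrite mulr_ge0 ?sqr_ge0// ltW.
have := ler_wpM2l fr y2.
have := ler_wpM2l (sqr_ge0 r) radius_small.
have := ler_wpM2l (sqr_ge0 r) bias_small.
move: fr; move: (norm2 v) r (third_moment X) => y rr mm; lra.
Qed.

Let gA_le : gA <= flow * r / 256.
Proof.
rewrite /gA /radius mulrA [flow * _]mulrC divfK ?gt_eqF// /radius_cst -lock.
have ua : 0 <= ups * a by rewrite mulr_ge0// ltW.
have H (G b y : R) : 0 <= G -> 0 <= b -> 0 <= y ->
    b + G * y <= (256 * G + 257) * (y + b) / 256.
  by move=> G0 bb0 y0; have := mulr_ge0 G0 bb0; lra.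
by have := H _ _ _ (score_cst_ge0 R) b00 ua; rewrite mulrA.
Qed.

(** One union bound over the three families of test functions at net points turns
    [boot_localization] into a statement about probabilities. The number 66
    is the base 2 entropy per dimension of the net of mesh 1/64; its points of norm
    below [63 / 64] get the test function 0, with a threshold large enough for the
    union bound. *)
Theorem bootstrap_radius : exists E, [/\ sigma_RV Z E,
  ((1 - 3 * expR (- t))%:E <= P E)%E &
  forall w, E w -> ((1 - 2 * expR (- t))%:E <= Pstar e [set s | (forall b,
    boot_loss tau K h (fun i => Z i w) (multipliers s) b <=
      boot_loss tau K h (fun i => Z i w) (multipliers s) beta ->
    normS Sigma (b - beta) <= r)%R])%E].
Proof.
have [I [u [cI u1 net]]] := @lattice_net R p 2 p0 isT.
have [J [u' [cJ u1' net']]] := @lattice_net R p 64 p0 isT.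
pose phi (k : I + I + J) (z : R * p.-tuple R) : R := match k with
  | inl (inl k) => lamA * score X tau K h (u k) (resid beta z)
  | inl (inr k) => lamC * curv X f flow K h (qC *: u k) (resid beta z)
  | inr k => if 63 / 64 <= norm2 (u' k)
             then - (lamB * curv X f flow K h ((r / 2) *: u' k) (resid beta z)) else 0
  end.
pose q (k : I + I + J) : R := match k with
  | inl (inl k) => lamA * b0 + 128 * expR 8 * (lamA * ups) ^+ 2
  | inl (inr k) => 4 * lamC * flow * qC ^+ 2
  | inr k => if 63 / 64 <= norm2 (u' k)
             then - (lamB * (2 * gB)) + lamB ^+ 2 * VB else 0
  end.
pose c (k : I + I + J) : R := match k with
  | inl (inl k) => n%:R * (lamA * gA)
  | inl (inr k) => n%:R * (lamC * gC)
  | inr k => if 63 / 64 <= norm2 (u' k)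
             then - (n%:R * (lamB * gB)) else 66 * (p%:R + t)
  end.
have mS v := measurableT_comp (measurable_score tau h KC DM v) (measurable_resid beta).
have mC v := measurableT_comp (measurable_curv h KC DM CD DC v) (measurable_resid beta).
have mphi k : measurable_fun [set: R * p.-tuple R] (phi k).
  case: k => [[k|k]|k] /=.
  - exact: (measurable_funM (measurable_cst lamA) (mS (u k))).
  - exact: (measurable_funM (measurable_cst lamC) (mC (qC *: u k))).
  - rewrite /phi; case: (_ <= _); last exact: measurable_cst.
    have mM := measurable_funM (measurable_cst lamB) (mC ((r / 2) *: u' k)).
    exact: (measurableT_comp (@oppr_measurable R setT) mM).
have mgf k i : (\int[P]_w (expR (2 * phi k (Z i w)))%:E <= (2 * expR (q k) - 1)%:E)%E.
  case: k => [[k|k]|k] /=.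
  - exact: mgfA.
  - by apply: mgfC; rewrite norm2Z (ger0_norm (ltW qC0)) ler_piMr// ltW.
  - case: ifPn => hk; first exact: mgfB.
    by rewrite mulr0 expR0 expectation_cstr lee_fin mulr1 (_ : 2 - 1 = 1)//; ring.
have eps0 : 0 < 2 * expR (- t) by rewrite mulr_gt0// expR_gt0.
have sum_le : \sum_k expR (n%:R * q k - c k) <= 6 * expR (- (2 * t)).
  rewrite big_sumType big_sumType /=.
  have SA := @sum_expR_le R I (fun k => n%:R * q (inl (inl k)) - c (inl (inl k))) 4 p t cI isT t0.
  have SC := @sum_expR_le R I (fun k => n%:R * q (inl (inr k)) - c (inl (inr k))) 4 p t cI isT t0.
  have SB := @sum_expR_le R J (fun k => n%:R * q (inr k) - c (inr k)) 66 p t cJ isT t0.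
  have {}SA : \sum_(k : I) expR (n%:R * q (inl (inl k)) - c (inl (inl k))) <= expR (- (2 * t)).
    by apply: SA => k; rewrite /q /c expA.
  have {}SC : \sum_(k : I) expR (n%:R * q (inl (inr k)) - c (inl (inr k))) <= expR (- (2 * t)).
    by apply: SC => k; exact: expC.
  have {}SB : \sum_(k : J) expR (n%:R * q (inr k) - c (inr k)) <= expR (- (2 * t)).
    apply: SB => k; rewrite /q /c; case: ifP => _; first exact: expB.
    by rewrite mulr0 sub0r.
  apply: (le_trans (lerD (lerD SA SC) SB)).
  by have := expR_ge0 (- (2 * t)); lra.
have [E [sE PE hE]] := boot_union indZ rad inde mphi mgf eps0 sum_le.
exists E; split => //.
  apply: le_trans PE; rewrite lee_fin lerD2l lerN2.
  have -> : expR (- (2 * t)) = expR (- t) * expR (- t) by rewrite -expRD; congr expR; ring.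
  have := expR_gt0 (- t); move: (expR (- t)) => y y0.
  by rewrite (_ : 6 * (y * y) / (2 * y) = 3 * y)//; field; rewrite gt_eqF.
move=> w /hE; move/le_trans; apply; apply: Pstar_le => // s hs /= hk b hb.
have w0 i : 0 <= multipliers s i.
  by rewrite /multipliers; case: (hs i) => ->; rewrite ?subrr// addr_ge0.
have hA k : \sum_i multipliers s i * score X tau K h (u k) (resid beta (Z i w)) < n%:R * gA.
  have := hk (inl (inl k)); rewrite /= mulrCA.
  under eq_bigr do rewrite mulrCA.
  by rewrite -mulr_sumr ltr_pM2l.
have hC k : curv_sum X K h f flow beta (fun i => Z i w) (multipliers s) ((r / 32) *: u k)
    < n%:R * gC.
  have := hk (inl (inr k)); rewrite /= mulrCA.
  under eq_bigr do rewrite mulrCA.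
  by rewrite -mulr_sumr ltr_pM2l.
have hB k : 63 / 64 <= norm2 (u' k) ->
    n%:R * gB < curv_sum X K h f flow beta (fun i => Z i w) (multipliers s) ((r / 2) *: u' k).
  move=> h63; have := hk (inr k); rewrite /= h63 mulrCA.
  under eq_bigr do rewrite mulrN mulrCA -mulrN.
  by rewrite -mulr_sumr -mulrN ltr_pM2l// sumrN ltrN2.
apply: (boot_localization DM htau h0 DC KC K1 w0 n0 r0 _ net' hA hC hB _ hb).
  by move=> v /net [k hk1 _]; exists k.
have -> : r * (2 * (n%:R * gA)) = n%:R * (2 * r * gA) by ring.
rewrite [2 * (_ * gB)]mulrCA -mulrDr ler_pM2l//.
have rr : 0 <= 2 * r by rewrite mulr_ge0// ltW.
have fr : 0 <= flow * r ^+ 2 by rewrite mulr_ge0 ?sqr_ge0// ltW.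
have := ler_wpM2l rr gA_le; move: fr; rewrite /gC /gB /qC.
move: r gA => y g; lra.
Qed.

End bootstrap_deviation.

(** * Choice of the constants *)

Section constants.
Context {R : realType}.

(** With [y = sqrt m3 * ups * a] the hypotheses give
    [c1 * y <= h * flow <= c2 * flow ^ 2 <= 4 * c2 * l0 <= 1 / 2], where
    [flow ^ 2 <= 4 * l0] closes the chain; so [y] is small, and the condition on
    the sample size follows from [y ^ 2 <= y / (2 * c1)]. *)
Lemma regime (flow l0 k1 k2 ku ups a m3 h c1 c2 C : R) :
  0 < flow -> flow ^+ 2 <= 4 * l0 -> 0 < l0 -> 0 <= k1 -> 0 <= k2 -> 0 < ku ->
  0 < ups -> 1 <= 32 * ups ^+ 2 -> 0 <= a -> 1 <= m3 -> 0 < h -> 0 <= C ->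
  6 <= c1 -> size_cst * ku <= 2 * c1 ^+ 2 -> 0 < c2 ->
  8 * c2 * l0 <= 1 -> 4 * c2 * (l0 * k1) <= 1 -> 8 * c2 * (l0 * C) <= 1 ->
  8 * c2 ^+ 2 * (l0 ^+ 2 * C * k2) <= 1 ->
  c1 * flow^-1 * Num.sqrt m3 * ups * a <= h -> h <= c2 * flow * (Num.sqrt m3)^-1 ->
  [/\ a <= 1, size_cst * ku * ups ^+ 2 * m3 * a ^+ 2 <= flow * h, l0 * h * k1 <= flow / 4 &
      l0 * m3 * (C / flow * (ups * a + l0 * k2 * h ^+ 2)) <= flow / 4].
Proof.
move=> flow0 f4 l00 k10 k20 ku0 ups0 ups1 a0 m31 h0 C0 c16 hc1 c20 d1 d2 d3 d4.
have m30 : 0 <= m3 by exact: le_trans ler01 m31.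
have := sqr_sqrtr m30; set s := Num.sqrt m3 => sE.
have s1 : 1 <= s by rewrite -sqrtr1 ler_sqrt.
have s0 : 0 < s by exact: lt_le_trans ltr01 s1.
set y := s * (ups * a) => b1 b2.
have y0 : 0 <= y by rewrite /y !mulr_ge0// ltW.
have {}b1 : c1 * y <= h * flow.
  rewrite -ler_pdivrMr// /y; apply: le_trans b1; rewrite le_eqVlt.
  by apply/orP; left; apply/eqP; ring.
have {}b2 : h * s <= c2 * flow by rewrite -ler_pdivlMr.
have b3 : h <= c2 * flow by apply: le_trans b2; rewrite ler_peMr// ltW.
have b4 : h * flow <= 1 / 2.
  have := ler_wpM2r (ltW flow0) b3; have := ler_wpM2l (ltW c20) f4; lra.
have yc : 6 * y <= c1 * y by rewrite ler_wpM2r.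
split.
- have u6 : 1 <= 6 * ups.
    rewrite -(ler_pXn2r (_ : 0 < 2)%N) ?nnegrE// ?mulr_ge0// ?ltW// expr1n; lra.
  have := ler_wpM2r a0 u6; have : ups * a <= y by rewrite /y ler_peMl// mulr_ge0// ltW.
  lra.
- have -> : size_cst * ku * ups ^+ 2 * m3 * a ^+ 2 = size_cst * ku * y ^+ 2.
    by rewrite /y -sE; move: size_cst => N; ring.
  apply: le_trans (ler_wpM2r (sqr_ge0 y) hc1) _.
  have cy0 : 0 <= c1 * y by lra.
  have : 2 * (c1 * y) <= 1 by lra.
  by move=> /(ler_wpM2l cy0); lra.
- have lk : 0 <= l0 * k1 by rewrite mulr_ge0// ltW.
  have := ler_wpM2l lk b3; have := ler_wpM2r (ltW flow0) d2; lra.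
have -> : l0 * m3 * (C / flow * (ups * a + l0 * k2 * h ^+ 2)) =
    (l0 * C * (s * y) + l0 ^+ 2 * C * k2 * (h * s) ^+ 2) / flow.
  by rewrite /y -sE; field; rewrite gt_eqF.
rewrite ler_pdivrMr//.
have e1 : l0 * C * (s * y) <= flow ^+ 2 / 8.
  have yh : y <= h * flow by lra.
  have lC : 0 <= l0 * C by rewrite mulr_ge0// ltW.
  have := ler_wpM2l lC (ler_wpM2l (ltW s0) yh).
  have := ler_wpM2l lC (ler_wpM2r (ltW flow0) b2).
  have := ler_wpM2r (sqr_ge0 flow) d3; lra.
have e2 : l0 ^+ 2 * C * k2 * (h * s) ^+ 2 <= flow ^+ 2 / 8.
  have hs0 : 0 <= h * s by rewrite mulr_ge0// ltW.
  have q : (h * s) ^+ 2 <= (c2 * flow) ^+ 2.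
    by apply: lerXn2r; rewrite ?nnegrE// mulr_ge0// ltW.
  have lC := mulr_ge0 (mulr_ge0 (sqr_ge0 l0) C0) k20.
  have := ler_wpM2l lC q; have := ler_wpM2r (sqr_ge0 flow) d4; lra.
lra.
Qed.

Lemma lower_cst (ku : R) : 0 < ku ->
  let c1 := 2 ^+ 19 * (1 + `|ku|) in 6 <= c1 /\ size_cst * ku <= 2 * c1 ^+ 2.
Proof.
move=> ku0 c1; rewrite /c1 gtr0_norm// /size_cst -lock.
split; first lra.
rewrite exprMn -exprM mulrCA; apply: ler_wpM2l; first exact: exprn_ge0.
have := sqr_ge0 ku; lra.
Qed.

Lemma upper_cst (l0 k1 k2 C : R) : 0 < l0 -> 0 <= k1 -> 0 <= k2 -> 1 <= C ->
  let c2 := (8 * C * (1 + `|l0|) ^+ 2 * (1 + `|k1|) * (1 + `|k2|))^-1 in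
  [/\ 0 < c2, 8 * c2 * l0 <= 1, 4 * c2 * (l0 * k1) <= 1, 8 * c2 * (l0 * C) <= 1 &
      8 * c2 ^+ 2 * (l0 ^+ 2 * C * k2) <= 1].
Proof.
move=> l00 k10 k20 C1; rewrite gtr0_norm// !ger0_norm//; set D := _ * (1 + k2) => c2.
have L1 : 1 <= (1 + l0) ^+ 2 by have := sqr_ge0 l0; lra.
have D4 (x y z w : R) : 0 <= x <= C -> 0 <= y <= (1 + l0) ^+ 2 ->
    0 <= z <= 1 + k1 -> 0 <= w <= 1 + k2 -> 8 * (x * y * z * w) <= D.
  move=> /andP[x0 xC] /andP[y0 yL] /andP[z0 zk] /andP[w0 wk].
  rewrite /D -!(mulrA 8); apply: ler_wpM2l => //.
  apply: ler_pM => //; first by rewrite !mulr_ge0.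
  by apply: ler_pM => //; [rewrite mulr_ge0|apply: ler_pM].
have c1 : 0 <= (1 : R) <= C by rewrite ler01.
have c1' : 0 <= (1 : R) <= 1 + k1 by rewrite ler01 lerDl.
have c1'' : 0 <= (1 : R) <= 1 + k2 by rewrite ler01 lerDl.
have L2 : 0 <= l0 <= (1 + l0) ^+ 2 by have := sqr_ge0 l0; lra.
have L3 : 0 <= l0 ^+ 2 <= (1 + l0) ^+ 2 by have := sqr_ge0 l0; lra.
have L4 : 0 <= (1 : R) <= (1 + l0) ^+ 2 by lra.
have CC : 0 <= C <= C by lra.
have kk1 : 0 <= k1 <= 1 + k1 by lra.
have kk2 : 0 <= k2 <= 1 + k2 by lra.
have D8 := D4 _ _ _ _ c1 L4 c1' c1''.
have D0 : 0 < D by lra.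
have cD (x : R) : 8 * x <= D -> 8 * c2 * x <= 1.
  by move=> xD; rewrite mulrAC ler_pdivrMr// mul1r.
split.
- by rewrite invr_gt0.
- by apply: cD; have := D4 _ _ _ _ c1 L2 c1' c1''; lra.
- have lk : 0 <= c2 * (l0 * k1) by rewrite !mulr_ge0 ?invr_ge0// ltW.
  have := D4 _ _ _ _ c1 L2 kk1 c1''; rewrite mul1r mulr1 => /cD; lra.
- by apply: cD; have := D4 _ _ _ _ CC L2 c1' c1''; lra.
have := D4 _ _ _ _ CC L3 c1' kk2; rewrite mulr1 (mulrC C) => /cD H.
have c21 : c2 <= 1 by rewrite invf_le1//; lra.
have c20 : 0 <= c2 by rewrite invr_ge0 ltW.
have := ler_wpM2l c20 H; lra.
Qed.

End constants.

Theorem theorem4p4 (R : realType) :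
  exists2 C : R, 0 < C &
  forall tau k1 k2 ku l0 : R, 0 < tau < 1 ->
  exists c1 c2 : R, [/\ 0 < c1, 0 < c2 &
  forall (p n : nat) (hp : (2 <= p)%N) (hn : (0 < n)%N)
    (K : R -> R) (d : measure_display) (T : measurableType d)
    (P : probability T R)
    (X : {RV P >-> p.-tuple R}) (eps : {RV P >-> R}) (beta : 'cV[R]_p)
    (f : p.-tuple R -> R -> R) (flow ups1 : R)
    (Z : 'I_n -> {RV P >-> (R * p.-tuple R)%type})
    (e : 'I_n -> {RV P >-> R}),
  kernel_condition K ku ->
  kernel_moment K 1 = k1%:E ->
  kernel_moment K 2 = k2%:E ->
  design_moments X ->
  is_cond_prob X [set w | eps w <= 0] (cst tau) ->
  is_cond_density X eps f ->
  density_condition X f flow l0 ->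
  subgaussian_design X ups1 ->
  mutually_independent Z ->
  copies_of X eps beta Z ->
  (forall i, rademacher (e i)) ->
  mutually_independent e ->
  independent_classes P (sigma_RV Z) (sigma_RV e) ->
  forall (t h : R)
    (bhat : ('I_n -> R * p.-tuple R) -> ('I_n -> R) -> 'cV[R]_p),
  0 <= t ->
  0 < h ->
  c1 * flow^-1 * Num.sqrt (third_moment X) * ups1
    * Num.sqrt ((p%:R + t) / n%:R) <= h ->
  h <= c2 * flow * (Num.sqrt (third_moment X))^-1 ->
  is_boot_estimator tau K h bhat ->
  exists E : set T,
  [/\ sigma_RV Z E,
      ((1 - 3 * expR (- t))%:E <= P E)%E &
      forall w, E w ->
      ((1 - 2 * expR (- t))%:E <=
       Pstar e [set s | (normS (second_moment_mx X)
                           (bhat (fun i => Z i w) s - beta)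
                         <= C / flow *
                            (ups1 * Num.sqrt ((loglog h^-1 + p%:R + t) / n%:R)
                             + l0 * k2 * h ^+ 2))%R])%E]].
Proof.
exists radius_cst; first exact: lt_le_trans ltr01 radius_cst_ge1.
move=> tau k1 k2 ku l0 htau.
pose c1 : R := 2 ^+ 19 * (1 + `|ku|).
pose c2 : R := (8 * radius_cst * (1 + `|l0|) ^+ 2 * (1 + `|k1|) * (1 + `|k2|))^-1.
have C1 := @radius_cst_ge1 R; have C0 : 0 < radius_cst :> R := lt_le_trans ltr01 C1.
have nn (x : R) : 0 < 1 + `|x| by rewrite ltr_pwDl.
exists c1, c2; split.
- by rewrite mulr_gt0 ?exprn_gt0.
- rewrite /c2 invr_gt0; apply: mulr_gt0 => //; apply: mulr_gt0 => //.
  by apply: mulr_gt0; [exact: mulr_gt0|rewrite exprn_gt0].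
move=> p n hp hn K d T P X eps beta f flow ups Z e KC K1 K2 DM CP CD DC SG indZ CZ rad inde _.
move=> t h bhat t0 h0 hlo hup bhatP.
have p0 : (0 < p)%N by exact: ltnW.
have [flow0 l00 _ _] := DC; have [ups0 _] := SG.
have ku0 := kernel_sup_gt0 KC.
have k10 := kernel_moment_ge0 KC K1; have k20 := kernel_moment_ge0 KC K2.
have [d0 d1] := lower_cst ku0.
have [e0 e1 e2 e3 e4] := upper_cst l00 k10 k20 C1.
have f4 := flow_sqr_le htau CP CD DC.
have u1 := ups_sqr_ge p0 DM SG; have m31 := third_moment_ge1 p0 DM SG.
have [a1 NH b1 b2] := regime flow0 f4 l00 k10 k20 ku0 ups0 u1 (sqrtr_ge0 _) m31 h0 (ltW C0)
  d0 d1 e0 e1 e2 e3 e4 hlo hup.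
have [E [sE PE hE]] := bootstrap_radius p0 hn htau h0 t0 KC K1 K2 DM SG CP CD DC indZ CZ
  rad inde a1 NH b1 b2.
exists E; split => // w /hE /le_trans; apply; apply: Pstar_le => // s hs /= hb.
apply: le_trans (hb _ (bhatP _ _ hs _)) _; rewrite /radius.
apply: ler_wpM2l; first by rewrite divr_ge0// ltW.
rewrite lerD2r; apply: ler_wpM2l; first exact: ltW.
have ll0 : 0 <= loglog h^-1.
  apply: ln_ge0; rewrite -[leLHS](@expRK R) ler_ln ?posrE ?expR_gt0//.
    by rewrite le_max lexx orbT.
  by rewrite lt_max expR_gt0 orbT.
have pt : 0 <= p%:R + t :> R by rewrite addr_ge0.
apply: ler_wsqrtr; rewrite ler_wpM2r ?invr_ge0//; lra.
Qed.
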